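(* Let $p>1$ and let $(\mathcal{X},\mathcal{F},\{\mathcal{F}_n\}_{n\ge0},\mu)$ be a discrete-time filtered probability space. For all $\mathbf{f}\ge0$ and $F\ge\mathbf{f}^p$, $$\widetilde{\mathcal{B}}^{\mathcal{F}}_\mu(F,\mathbf{f})\le\mathcal{B}^{\mathcal{F}}_\mu(F,\mathbf{f},1;1).$$ Moreover, if $\{\mathcal{F}_n\}_{n\ge0}$ is an infinitely refining filtration, then $\widetilde{\mathcal{B}}^{\mathcal{F}}_\mu(F,\mathbf{f})=\mathcal{B}^{\mathcal{F}}_\mu(F,\mathbf{f},1;1)$ (which by the coincidence theorem also equals the dyadic Bellman function $\mathcal{B}(F,\mathbf{f},1;1)$).
   Context: $f_n=\mathbb{E}^\mu[f\mid\mathcal{F}_n]$, $f^*=\sup_{n\ge0}|f_n|$. $\widetilde{\mathcal{B}}^{\mathcal{F}}_\mu(F,\mathbf{f})=\sup\{\mathbb{E}^\mu[|f^*|^p]: f\ge0,\ \mathbb{E}^\mu[f^p]=F,\ \mathbb{E}^\mu[f]=\mathbf{f}\}$. $\mathcal{B}^{\mathcal{F}}_\mu(F,\mathbf{f},M;C)$ is the supremum of $\mathbb{E}^\mu[\sum_{n\ge0}\alpha_nf_n^p]$ over all non-negative $f$ and all sequences of non-negative random variables $\{\alpha_n\}$ with $\alpha_n$ $\mathcal{F}_n$-measurable and $\mathbb{E}^\mu[\sum_{k\ge n}\alpha_k\mid\mathcal{F}_n]\le C$ for all $n$, such that $\mathbb{E}^\mu[f^p]=F$, $\mathbb{E}^\mu[f]=\mathbf{f}$,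 $\mathbb{E}^\mu[\sum_n\alpha_n]=M$. The dyadic Bellman function $\mathcal{B}(F,\mathbf{f},M;C)$ is the supremum of $|I|^{-1}\sum_{J\in\mathcal{D},J\subseteq I}\alpha_J\langle f\rangle_J^p$ over non-negative $f$ on a dyadic interval $I$ and non-negative $\{\alpha_J\}$ with $\langle f^p\rangle_I=F$, $\langle f\rangle_I=\mathbf{f}$, $|I|^{-1}\sum_{J\subseteq I}\alpha_J=M$, $\sum_{J'\subseteq J}\alpha_{J'}\le C|J|$ for all dyadic $J\subseteq I$. The filtration is infinitely refining if for every $\varepsilon>0$, $n\ge0$, $E\in\mathcal{F}_n$ there exist $k>n$ and real-valued $\mathcal{F}_k$-measurable $h$ with $|h\mathbf{1}_E|=\mathbf{1}_E$ and $\int_E|\mathbb{E}^\mu[h\mid\mathcal{F}_n]|\,d\mu\le\varepsilon$. *)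

(* Defs.v *)
From HB Require Import structures.
From mathcomp Require Import all_boot all_order all_algebra.
From mathcomp Require Import all_classical all_reals all_analysis.
From mathcomp Require Import measurable_realfun.
Set Implicit Arguments. Unset Strict Implicit. Unset Printing Implicit Defensive.
Import Order.TTheory GRing.Theory Num.Theory.
Import numFieldNormedType.Exports.
Local Open Scope classical_set_scope.
Local Open Scope ring_scope.

Definition G_measurable {d} {T : measurableType d} {R : realType}
  (G : set (set T)) (g : T -> \bar R) : Prop :=
  forall B : set (\bar R), measurable B -> G (g @^-1` B).

Definition filtration {d} {T : measurableType d} (F : nat -> set (set T)) : Prop :=
  forall n, [/\ sigma_algebra setT (F n), F n `<=` measurable & F n `<=` F n.+1].

Definition is_condexp {d} {T : measurableType d} {R : realType}
  (mu : {measure set T -> \bar R}) (G : set (set T)) (h g : T -> \bar R) : Prop :=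
  G_measurable G g /\
  forall A, G A -> (\int[mu]_(x in A) g x = \int[mu]_(x in A) h x)%E.

Definition cond_exps {d} {T : measurableType d} {R : realType}
  (mu : {measure set T -> \bar R}) (F : nat -> set (set T))
  (f : T -> R) (fn : nat -> T -> R) : Prop :=
  forall n, is_condexp mu (F n) (EFin \o f) (EFin \o fn n) /\
            mu.-integrable setT (EFin \o fn n).

Definition maxfun {T} {R : realType} (fn : nat -> T -> R) (x : T) : \bar R :=
  ereal_sup (range (fun n => (`|fn n x|)%:E)).

Definition Btilde {d} {T : measurableType d} {R : realType}
  (mu : probability T R) (F : nat -> set (set T)) (p Fv fv : R) : \bar R :=
  ereal_sup [set v | exists (f : T -> R) (fn : nat -> T -> R),
    [/\ [/\ measurable_fun setT f, (forall x, 0 <= f x),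
            (\int[mu]_x ((f x) `^ p)%:E = Fv%:E)%E &
            (\int[mu]_x (f x)%:E = fv%:E)%E],
        cond_exps mu F f fn &
        v = (\int[mu]_x (maxfun fn x `^ p))%E]].

Definition Bmart {d} {T : measurableType d} {R : realType}
  (mu : probability T R) (F : nat -> set (set T)) (p Fv fv M C : R) : \bar R :=
  ereal_sup [set v | exists (f : T -> R) (fn : nat -> T -> R) (alpha : nat -> T -> R),
    [/\ [/\ measurable_fun setT f, (forall x, 0 <= f x),
            (\int[mu]_x ((f x) `^ p)%:E = Fv%:E)%E,
            (\int[mu]_x (f x)%:E = fv%:E)%E &
            cond_exps mu F f fn],
        (forall n x, 0 <= alpha n x) /\
        (forall n, G_measurable (F n) (EFin \o alpha n)),
        (forall n, exists g : T -> \bar R,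
            [/\ is_condexp mu (F n) (fun x => (\sum_(n <= k <oo) (alpha k x)%:E)%E) g,
                (forall x, (0 <= g x)%E) &
                {ae mu, forall x, (g x <= C%:E)%E}]),
        (\int[mu]_x (\sum_(k <oo) (alpha k x)%:E) = M%:E)%E &
        v = (\int[mu]_x (\sum_(k <oo) ((alpha k x) * (fn k x `^ p))%:E))%E]].

Definition inf_refining {d} {T : measurableType d} {R : realType}
  (mu : probability T R) (F : nat -> set (set T)) : Prop :=
  forall (eps : R) (n : nat) (E : set T), 0 < eps -> F n E ->
  exists (k : nat) (h : T -> R),
    [/\ (n < k)%N, G_measurable (F k) (EFin \o h),
        mu.-integrable setT (EFin \o h),
        (forall x, `|h x * \1_E x| = \1_E x) &
        exists g : T -> R,
          [/\ is_condexp mu (F n) (EFin \o h) (EFin \o g),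
              mu.-integrable setT (EFin \o g) &
              (\int[mu]_(x in E) (`|g x|)%:E <= eps%:E)%E]].

(* dyadic intervals of [0,1): J_{m,j} = [j 2^-m, (j+1) 2^-m), j < 2^m *)
Definition dyad {R : realType} (m j : nat) : set R :=
  [set x : R | (j%:R / 2 ^+ m <= x) && (x < j.+1%:R / 2 ^+ m)].

Definition dyavg {R : realType} (f : R -> R) (m j : nat) : \bar R :=
  ((2 ^+ m)%:E * \int[lebesgue_measure]_(x in dyad m j) (f x)%:E)%E.

(* sum of alpha_{J'} over dyadic J' contained in J_{m,j} *)
Definition dsub {R : realType} (alpha : nat -> nat -> R) (m j : nat) : \bar R :=
  (\sum_(m <= m' <oo) \sum_(j' < 2 ^ m' | (j' %/ 2 ^ (m' - m) == j)%N)
      (alpha m' j')%:E)%E.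

Definition Bdyadic {R : realType} (p Fv fv M C : R) : \bar R :=
  ereal_sup [set v | exists (f : R -> R) (alpha : nat -> nat -> R),
    [/\ [/\ measurable_fun (dyad 0 0) f, (forall x, dyad 0 0 x -> 0 <= f x),
            (\int[lebesgue_measure]_(x in dyad 0 0) ((f x) `^ p)%:E = Fv%:E)%E &
            (\int[lebesgue_measure]_(x in dyad 0 0) (f x)%:E = fv%:E)%E],
        (forall m j, 0 <= alpha m j),
        (\sum_(m <oo) \sum_(j < 2 ^ m) (alpha m j)%:E = M%:E)%E,
        (forall m j, (j < 2 ^ m)%N -> (dsub alpha m j <= (C / 2 ^+ m)%:E)%E) &
        v = (\sum_(m <oo) \sum_(j < 2 ^ m) ((alpha m j)%:E * (dyavg f m j `^ p)))%E]].

(* Main.v *)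
Require Import Defs.
From HB Require Import structures.
From mathcomp Require Import all_boot all_order all_algebra.
From mathcomp Require Import all_classical all_reals all_analysis.
From mathcomp Require Import measurable_realfun.
From mathcomp Require Import ring lra.
Import Order.TTheory GRing.Theory Num.Theory.
Import numFieldNormedType.Exports.
Local Open Scope classical_set_scope.
Local Open Scope ring_scope.
Set Implicit Arguments. Unset Strict Implicit. Unset Printing Implicit Defensive.

(* Two facts carry the proof.

   (1) For every filtration and every admissible [f], the supremum over the
   Carleson sequences [alpha] of [E (sum_n alpha_n f_n^p)] is [E (f^* )^p], so
   the first two Bellman functions always agree.  Upper bound: Abel summation
   against the increments of the running maximum [M_n^p], together with
   [E (sum_(k >= n) alpha_k | F_n) <= 1].  Lower bound: take
   [alpha_k = E (1_(E_k) | F_k)], where [E_k] is the event that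
   [max (f_0, ..., f_N)] is first attained at time [k], and let [N] tend to
   infinity.

   (2) For an infinitely refining filtration the common value depends only on
   [F] and [f].  Writing [F = f^p (1 - a)^p / (1 - a p)] with [0 <= a < 1/p],
   it is [f^p / (1 - a p)].  "At most" is Doob's argument for
   [max (f, f^* )], closed by Young's inequality with parameter [1 - a].
   "At least" imitates [c t^(-a)] on [(0, 1]]: a decreasing chain of sets
   [E_0, E_1, ...], where [E_j] minus [E_(j+1)] takes up the proportion [s] of
   [E_j] almost uniformly with respect to the past, carries a function whose
   mean over [E_j] is a geometric progression in [j]; then [s] tends to 0.

   The dyadic Bellman function is the one of the dyadic filtration of [[0, 1[],
   which is infinitely refining. *)

(** * Conditional expectation *)

(** The mean of [c * t ^ (- a)] over [[0, t]] is its value at [t] divided by [1 - a], so this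
    function is [1 - a] times its maximal function. With mean [fv], the maximal function is
    [fv * t ^ (- a)], of [p]-th moment [fv ^ p / (1 - a * p)]. Hence the two formulas, and the
    parameter of Young's inequality, which has to be an equality there.

    Copying this function in a general filtration meets two obstacles. At the time when [E_j] is
    known, the conditional expectation of the step function need not be constant on [E_j], and the
    part to be removed is only nearly independent of the past. What is controlled is the integral of
    that conditional expectation over the removed part; convexity then bounds its [p]-th moment from
    below. Moreover, the [p]-th moment must be exactly [F]. The step function is built with a
    slightly smaller one, and a small share of its mass is moved onto a late, tiny link of the chain
    until the moment is right. The room for this comes from a parameter smaller than [a], which
    finally tends to [a]. *)

Section sub_sigma_algebra.
Context (d : measure_display) (T : measurableType d) (R : realType).
Variables (G : set (set T)).
Hypotheses (sG : sigma_algebra setT G) (Gm : G `<=` measurable).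
Local Notation TG := (g_sigma_algebraType G).
Implicit Types (A : set T) (g h : T -> \bar R).

Lemma measurable_subsigmaE : @measurable _ TG = G.
Proof. exact: sigma_algebra_id. Qed.

Lemma measurable_G A : @measurable _ TG A -> G A.
Proof. by rewrite measurable_subsigmaE. Qed.

Lemma G_measurableP g : G_measurable G g <-> @measurable_fun _ _ TG _ setT g.
Proof.
split=> [mg _ B mB|mg B mB]; first by rewrite setTI measurable_subsigmaE; exact: mg.
have := mg measurableT B mB; rewrite setTI measurable_subsigmaE; exact.
Qed.

Lemma G_measurable_EFinP (u : T -> R) :
  G_measurable G (EFin \o u) <-> @measurable_fun _ _ TG _ setT u.
Proof.
split=> [/G_measurableP/measurable_EFinP//|mu]; apply/G_measurableP.
exact/measurable_EFinP.
Qed.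

Lemma measurable_fun_id_subsigma : @measurable_fun _ _ T TG setT id.
Proof. by move=> _ A; rewrite measurable_subsigmaE setTI => /Gm. Qed.

Lemma G_measurableW g : G_measurable G g -> measurable_fun setT g.
Proof. by move=> mg _ B mB; rewrite setTI; apply: Gm; exact: mg. Qed.

Lemma G_setT : G setT. Proof. by rewrite -measurable_subsigmaE; exact: measurableT. Qed.

Lemma G_setI A B : G A -> G B -> G (A `&` B).
Proof. by rewrite -measurable_subsigmaE => mA mB; exact: measurableI. Qed.

Lemma G_setD A B : G A -> G B -> G (A `\` B).
Proof. by rewrite -measurable_subsigmaE => mA mB; exact: measurableD. Qed.

Import HBNNSimple.

(** Approximating [Y] by functions that are simple for [G] itself keeps their level sets in [G],
    where the integrals of [g] and [h] agree; monotone convergence does the rest. With non-negative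
    extended functions no product has to be integrable. *)
Lemma integral_pullout (mu : {measure set T -> \bar R}) g h (Y : T -> \bar R) :
  measurable_fun setT g -> measurable_fun setT h ->
  (forall x, (0 <= g x)%E) -> (forall x, (0 <= h x)%E) ->
  (forall A, G A -> (\int[mu]_(x in A) g x = \int[mu]_(x in A) h x)%E) ->
  G_measurable G Y -> (forall x, (0 <= Y x)%E) ->
  (\int[mu]_x (Y x * g x) = \int[mu]_x (Y x * h x))%E.
Proof.
move=> mg mh g0 h0 gh /G_measurableP mY Y0.
pose f := @nnsfun_approx _ TG R setT measurableT _ mY.
have mf n : measurable_fun setT (f n : T -> R).
  have /measurable_EFinP/G_measurableP/G_measurableW/measurable_EFinP :
    @measurable_fun _ _ TG _ setT (f n) by exact: measurable_funP.
  exact.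
have key k : measurable_fun setT k -> (forall x, (0 <= k x)%E) ->
    (\int[mu]_x (Y x * k x) = limn (fun n => \int[mu]_x ((f n x)%:E * k x)))%E.
  move=> mk k0; rewrite -monotone_convergence//.
  - apply: eq_integral => x _; apply/esym/cvg_lim => //.
    have fY : (f n x)%:E @[n --> \oo] --> Y x.
      by apply: (@cvg_nnsfun_approx _ TG).
    (* The limit of a product is not automatic for 0 times infinity. In both zero cases every
       product vanishes, in the first one because [f n x] lies between 0 and [Y x]. *)
    have [Yx0|Yx0] := eqVneq (Y x) 0%E.
      rewrite Yx0 mul0e.
      suff f0 n : f n x = 0.
        by under eq_fun do rewrite f0 mul0e; exact: cvg_cst.
      apply/eqP; rewrite eq_le fun_ge0 andbT -lee_fin.
      suff : ((f n x)%:E <= Y x)%E by rewrite Yx0.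
      rewrite -(cvg_lim _ fY)//; apply: lime_ge; first by apply/cvg_ex; exists (Y x).
      near=> m; rewrite lee_fin; apply/lefP/(@nd_nnsfun_approx _ TG).
      by near: m; exact: nbhs_infty_ge.
    have [kx0|kx0] := eqVneq (k x) 0%E.
      by rewrite kx0 mule0; under eq_fun do rewrite mule0; exact: cvg_cst.
    apply: cvgeM => //; last exact: cvg_cst.
    by move: Yx0 kx0; case: (Y x) => [r||]; case: (k x) => [s||].
  - by move=> n; apply: emeasurable_funM => //; exact/measurable_EFinP.
  - by move=> n x _; rewrite mule_ge0// lee_fin.
  - move=> x _ m n mn; rewrite lee_wpmul2r// lee_fin.
    exact/lefP/(@nd_nnsfun_approx _ TG).
rewrite !key//; congr (limn _); apply/funext => n.
have step k : measurable_fun setT k -> (forall x, (0 <= k x)%E) ->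
    (\int[mu]_x ((f n x)%:E * k x) =
    \sum_(r \in range (f n)) r%:E * \int[mu]_(x in f n @^-1` [set r]) k x)%E.
  move=> mk k0.
  have mi r : measurable (f n @^-1` [set r] : set T).
    by apply/Gm/measurable_G; exact: measurable_sfunP.
  transitivity (\int[mu]_x (\sum_(r \in range (f n))
      (r * \1_(f n @^-1` [set r]) x)%:E * k x))%E.
    apply: eq_integral => x _.
    rewrite -ge0_mule_fsuml => [|y]; last exact: nnfun_muleindic_ge0.
    by congr (_ * _)%E; rewrite fsumEFin //; congr EFin; exact: (fimfunE (f n) x).
  rewrite ge0_integral_fsum//; last 2 first.
  - move=> r; apply: emeasurable_funM => //; apply/measurable_EFinP.
    by apply: measurable_funM => //; exact: measurable_indic.
  - by move=> m x _; rewrite mule_ge0// nnfun_muleindic_ge0.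
  apply: eq_fsbigr => r /set_mem[x0 _ <-].
  under eq_integral do rewrite EFinM -muleA.
  rewrite ge0_integralZl// ?lee_fin//.
  - congr (_ * _)%E; under eq_integral do rewrite muleC.
    rewrite [RHS]integral_mkcond; apply: eq_integral => x _.
    by rewrite epatch_indic.
  - by apply: emeasurable_funM => //; apply/measurable_EFinP; exact: measurable_indic.
  - by move=> x _; rewrite mule_ge0// lee_fin.
rewrite !step//; apply: eq_fsbigr => r _; rewrite gh//.
by apply: measurable_G; exact: measurable_sfunP.
Unshelve. all: by end_near. Qed.

End sub_sigma_algebra.

(** * Existence of conditional expectations *)

Section condexp_exists.
Context (d : measure_display) (T : measurableType d) (R : realType).
Variables (G : set (set T)) (sG : sigma_algebra setT G) (Gm : G `<=` measurable).
Variables (mu : probability T R) (h : T -> \bar R).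
Hypotheses (hi : mu.-integrable setT h) (h0 : forall x, (0 <= h x)%E).
Local Notation TG := (g_sigma_algebraType G).

Let muG : set TG -> \bar R := mu.
Let muG0 : muG set0 = 0%E. Proof. exact: measure0. Qed.
Let muG_ge0 A : (0 <= muG A)%E. Proof. exact: measure_ge0. Qed.
Let muG_sa : semi_sigma_additive muG.
Proof.
move=> F mF tF mUF; apply: measure_semi_sigma_additive => //.
- by move=> n; apply/Gm/(measurable_G sG); exact: mF.
- by apply/Gm/(measurable_G sG).
Qed.
HB.instance Definition _ := isMeasure.Build _ _ _ muG muG0 muG_ge0 muG_sa.
Let muG_fin : fin_num_fun muG.
Proof. by move=> A mA; apply/fin_num_measure/Gm/(measurable_G sG). Qed.
HB.instance Definition _ := Measure_isFinite.Build _ _ _ muG muG_fin.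

Let nuG : set TG -> \bar R := fun A => (\int[mu]_(x in A) h x)%E.
Let nuG0 : nuG set0 = 0%E. Proof. exact: integral_set0. Qed.
Let nuG_ge0 A : (0 <= nuG A)%E. Proof. exact: integral_ge0. Qed.
Let nuG_sa : semi_sigma_additive nuG.
Proof.
move=> F mF tF mUF; apply: semi_sigma_additive_nng_induced => //.
- exact: measurable_int hi.
- by move=> n; apply/Gm/(measurable_G sG); exact: mF.
- by apply/Gm/(measurable_G sG).
Qed.
HB.instance Definition _ := isMeasure.Build _ _ _ nuG nuG0 nuG_ge0 nuG_sa.
Let nuG_fin : fin_num_fun nuG.
Proof.
move=> A mA; apply: integrable_fin_num => //.
  by apply/Gm/(measurable_G sG).
by apply: integrableS hi => //; apply/Gm/(measurable_G sG).
Qed.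
HB.instance Definition _ := Measure_isFinite.Build _ _ _ nuG nuG_fin.

(** A Radon-Nikodym derivative on the sub-sigma-algebra, of the measure with density [h] against the
    restriction of [mu]. A version that is real and non-negative everywhere spares later arguments
    about null sets. *)
Lemma condexp_exists :
  exists X : T -> R, [/\ is_condexp mu G h (EFin \o X),
    mu.-integrable setT (EFin \o X) & forall x, 0 <= X x].
Proof.
have numu : nuG `<< muG.
  apply/null_content_dominatesP => A mA A0.
  have mA' : measurable (A : set T) by apply/Gm/(measurable_G sG).
  rewrite /nuG; apply: null_set_integral => //.
  by apply: measurable_funTS; exact: measurable_int hi.
have [f [f0 ffin fint fE]] := radon_nikodym_sigma_finite numu.
have mf := measurable_int _ fint.
have Ef : EFin \o (fine \o f) = f by apply/funext => x /=; rewrite fineK.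
have mfT : measurable_fun setT (f : T -> \bar R).
  by apply: (G_measurableW Gm); apply/G_measurableP.
have intE A : G A -> (\int[mu]_(x in A) f x = \int[mu]_(x in A) h x)%E.
  move=> GA; have mA : @measurable _ TG A by rewrite measurable_subsigmaE.
  rewrite -[RHS]/(nuG A) fE//.
  have mfA : @measurable_fun _ _ TG _ A f by exact: measurable_funTS.
  by have /esym := ge0_integral_pushforward (measurable_fun_id_subsigma sG Gm) mu mA mfA
    (fun x _ => f0 x).
exists (fine \o f); rewrite Ef; split => //; last first.
- by move=> x; rewrite fine_ge0.
- apply/integrableP; split => //.
  under eq_integral do rewrite gee0_abs//.
  rewrite intE; last exact: G_setT.
  by rewrite ltey_eq integrable_fin_num.
- by split => //; apply/G_measurableP.
Qed.

End condexp_exists.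

Section condexp_theory.
Context (d : measure_display) (T : measurableType d) (R : realType).
Variables (G : set (set T)) (sG : sigma_algebra setT G) (Gm : G `<=` measurable).
Variable mu : probability T R.

(** A version may be negative somewhere, being fixed only up to null sets. The set where it is
    belongs to [G], and over it [X] has the integral of [h], which is not negative. *)
Lemma condexp_neg_null (h : T -> \bar R) (X : T -> R) :
  (forall x, (0 <= h x)%E) -> is_condexp mu G h (EFin \o X) ->
  mu.-integrable setT (EFin \o X) ->
  G [set x | X x < 0] /\ (\int[mu]_(x in [set x | (X x < 0)%R]) (`|X x|)%:E = 0)%E.
Proof.
move=> h0 [mX Xh] iX; set A := [set x | _].
have GA : G A.
  have -> : A = (EFin \o X) @^-1` [set y | (y < 0)%E].
    by apply/seteqP; split => x /=; rewrite lte_fin.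
  apply: mX; rewrite (_ : [set y | _] = `]-oo, 0%E[%classic).
    exact: emeasurable_itv.
  by apply/seteqP; split => x /=; rewrite in_itv.
split => //; apply/eqP; rewrite eq_le integral_ge0// ?andbT.
have mA := Gm GA.
rewrite (eq_integral (fun x => (-1)%:E * (EFin \o X) x)%E); last first.
  by move=> x /[!inE]; rewrite /A/= => x0; rewrite ltr0_norm// -EFinM mulN1r.
rewrite integralZl//; last exact: (integrableS measurableT).
by rewrite EFinN mulN1e oppe_le0 (Xh A GA) integral_ge0.
Qed.

Lemma condexp_ae_ge0 (h : T -> \bar R) (X : T -> R) :
  (forall x, (0 <= h x)%E) -> is_condexp mu G h (EFin \o X) ->
  mu.-integrable setT (EFin \o X) -> {ae mu, forall x, 0 <= X x}.
Proof.
move=> h0 Xh iX; have [GA] := condexp_neg_null h0 Xh iX.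
have mA := Gm GA.
have mX : measurable_fun [set x | X x < 0] (EFin \o X).
  by apply: measurable_funTS; exact: measurable_int iX.
move/(ae_eq_integral_abs mu mA mX); apply: filterS => x /= H.
by rewrite leNgt; apply/negP => x0; move: (H x0) => -[] Xx0; rewrite Xx0 ltxx in x0.
Qed.

(** The maximal function is built on absolute values. [|X|] differs from [X] only on the null set
    where [X] is negative, and it is non-negative everywhere, as pulling out requires. *)
Lemma condexp_abs (h : T -> \bar R) (X : T -> R) :
  measurable_fun setT h -> (forall x, (0 <= h x)%E) ->
  is_condexp mu G h (EFin \o X) ->
  mu.-integrable setT (EFin \o X) ->
  is_condexp mu G h (fun x => (`|X x|)%:E).
Proof.
move=> mh h0 Xh iX; have [GA A0] := condexp_neg_null h0 Xh iX.
have [mX Xh'] := Xh; set A := [set x | _] in GA A0.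
have mX' : measurable_fun setT X by apply/measurable_EFinP/measurable_int/iX.
split.
  apply/(G_measurable_EFinP sG); apply: measurableT_comp => //.
  exact/(G_measurable_EFinP sG).
move=> B GB; have [mA mB] := (Gm GA, Gm GB).
have split_int k : measurable_fun setT k -> (forall x, (0 <= k x)%E) ->
    (\int[mu]_(x in B) k x =
    \int[mu]_(x in B `\` A) k x + \int[mu]_(x in B `&` A) k x)%E.
  move=> mk k0; rewrite -ge0_integral_setU//.
  - by rewrite setUC setUIDK.
  - exact: measurableD.
  - exact: measurableI.
  - exact: measurable_funTS.
  - by apply/disj_set2P; rewrite setDE setIACA setICl setI0.
rewrite !split_int//; last exact/measurable_EFinP/measurableT_comp.
congr (_ + _)%E.
- rewrite -Xh'; last exact: (G_setD sG).
  by apply: eq_integral => x /[!inE]-[_ /negP]; rewrite -leNgt => ?; rewrite /= ger0_norm.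
- have -> : (\int[mu]_(x in B `&` A) (`|X x|)%:E = 0)%E.
    apply/eqP; rewrite eq_le integral_ge0// ?andbT.
    rewrite -A0; apply: ge0_subset_integral => //; first exact: measurableI.
    by apply: measurable_funTS; exact/measurable_EFinP/measurableT_comp.
  apply/esym/eqP; rewrite eq_le integral_ge0// ?andbT.
  rewrite -Xh'; last exact: (G_setI sG).
  have mBA : measurable (B `&` A) by exact: measurableI.
  rewrite -(integral0 mu (B `&` A)); apply: le_integral => //.
  + exact: (integrableS measurableT).
  + exact: integrable0.
  + by move=> x /[!inE] -[_ Ax]; rewrite lee_fin; exact: ltW.
Qed.

(** Tested on the set where [X] exceeds 1: it belongs to [G], and the integral of [X - 1] over it is
    at most 0. *)
Lemma condexp_le1_ae (X : T -> R) :
  G_measurable G (EFin \o X) -> (forall x, 0 <= X x) ->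
  (forall A, G A -> (\int[mu]_(x in A) (X x)%:E <= mu A)%E) ->
  {ae mu, forall x, X x <= 1}.
Proof.
move=> mX X0 XA; have mX' := G_measurableW Gm mX.
pose A := [set x | 1 < X x].
have GA : G A.
  have -> : A = (EFin \o X) @^-1` [set y | (1 < y)%E].
    by apply/seteqP; split => x /=; rewrite lte_fin.
  apply: mX; rewrite (_ : [set y | _] = `]1%E, +oo[%classic).
    exact: emeasurable_itv.
  by apply/seteqP; split => x /=; rewrite in_itv/= andbT.
have mA := Gm GA.
have mX1 : measurable_fun A (fun x => (X x - 1)%:E).
  apply/measurable_funTS/measurable_EFinP/measurable_funB => //.
  exact/measurable_EFinP.
have X10 x : A x -> (0 <= (X x - 1)%:E)%E.
  by rewrite /A/= lee_fin subr_ge0 => /ltW.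
have : (\int[mu]_(x in A) `|(X x - 1)%:E| = 0)%E.
  rewrite (eq_integral (fun x => (X x - 1)%:E)); last first.
    by move=> x /[!inE] Ax; rewrite gee0_abs// X10.
  apply/eqP; rewrite eq_le integral_ge0// ?andbT.
  have := XA _ GA; rewrite [X in (X <= _)%E -> _](eq_integral (fun x => (X x - 1)%:E +
    1)%E); last first.
    by move=> x _; rewrite -EFinD subrK.
  rewrite ge0_integralD//= integral_cst// mul1e.
  by rewrite -[X in (_ <= X)%E -> _]add0e leeD2rE//; exact: fin_num_measure.
move/(ae_eq_integral_abs mu mA mX1); apply: filterS => x /= H.
rewrite leNgt; apply/negP => x1; move: (H x1) => -[] /eqP.
by rewrite subr_eq0 => /eqP Xx; rewrite Xx ltxx in x1.
Qed.

End condexp_theory.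

(** * Powers and running maxima *)

Section powR_inequalities.
Context (R : realType).
Implicit Types x y p : R.

(** Young's inequality for the exponents [p] and [p / (p - 1)], cleared of fractions: the [p]-th
    power lies above its tangent at [x]. The inequalities of Bernoulli, Doob and Jensen below all
    come from it. *)
Lemma powR_young p x y : 1 < p -> 0 <= x -> 0 <= y ->
  p * (y * x `^ (p - 1)) <= y `^ p + (p - 1) * x `^ p.
Proof.
move=> p1 x0 y0; have p0 : 0 < p by lra.
have p10 : 0 < p - 1 by lra.
have q0 : 0 < p / (p - 1) by rewrite divr_gt0.
have := conjugate_powR y0 (powR_ge0 x (p - 1)) p0 q0.
rewrite -powRrM mulrCA divff ?lt0r_neq0// mulr1 => H.
have {}H : y * x `^ (p - 1) <= y `^ p / p + x `^ p / (p / (p - 1)).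
  by apply: H; field; rewrite !lt0r_neq0.
rewrite -(ler_pM2l p0) in H; apply: (le_trans H).
rewrite le_eqVlt; apply/orP; left; apply/eqP; field.
by rewrite !lt0r_neq0.
Qed.

Lemma powR_bernoulli p y : 1 < p -> 0 <= y -> 1 + p * (y - 1) <= y `^ p.
Proof.
move=> p1 y0; have := powR_young p1 ler01 y0; rewrite !powR1 !mulr1.
lra.
Qed.

(** Young's inequality rearranged. For consecutive running maxima [x] and [y], the factor [y] can be
    replaced by the current martingale term, since the bracket vanishes unless that term is the new
    maximum. *)
Lemma powR_doob p x y : 1 < p -> 0 <= x -> 0 <= y ->
  (p - 1) * (y `^ p - x `^ p) <= p * (y * (y `^ (p - 1) - x `^ (p - 1))).
Proof.
move=> p1 x0 y0; have := powR_young p1 x0 y0.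
have -> : y `^ p = y * y `^ (p - 1) by rewrite mulr_powRB1//; lra.
nra.
Qed.

Lemma le_powR p x y : 0 <= p -> 0 <= x -> x <= y -> x `^ p <= y `^ p.
Proof. by move=> p0 x0 xy; rewrite ge0_ler_powR ?nnegrE//; exact: le_trans xy. Qed.

Lemma le_poweR p (x y : \bar R) : 0 <= p -> (0 <= x)%E -> (x <= y)%E ->
  (x `^ p <= y `^ p)%E.
Proof.
move=> p0 x0 xy; apply: gt0_ler_poweR => //; rewrite in_itv/= leey andbT//.
exact: le_trans xy.
Qed.

End powR_inequalities.

Section running_max.
Context (R : realType).
Implicit Types (c : R) (a : nat -> R).

(* The maximum of [c, a 0, ..., a (n - 1)]: [a n] itself is left out. *)
Fixpoint rmax c a n : R :=
  if n is m.+1 then Num.max (rmax c a m) (a m) else c.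

Lemma rmax_leS c a n : rmax c a n <= rmax c a n.+1.
Proof. by rewrite /= le_max lexx. Qed.

Lemma rmax_le c a : {homo rmax c a : m n / (m <= n)%N >-> m <= n}.
Proof. by apply: homo_leq => // [x y z|n]; [exact: le_trans|exact: rmax_leS]. Qed.

Lemma rmax_ge c a n : c <= rmax c a n.
Proof. exact: (@rmax_le _ _ 0%N). Qed.

Lemma rmax_geS c a n : a n <= rmax c a n.+1.
Proof. by rewrite /= le_max lexx orbT. Qed.

Lemma rmax_leP c a n b : c <= b -> (forall i, (i < n)%N -> a i <= b) ->
  rmax c a n <= b.
Proof.
move=> cb; elim: n => [//|n IH] ab /=; rewrite ge_max ab// IH// => i ni.
by apply: ab; rewrite ltnW.
Qed.

Lemma measurable_rmax d (T : measurableType d) c (u : nat -> T -> R) n :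
  (forall i, (i < n)%N -> measurable_fun setT (u i)) ->
  measurable_fun setT (fun x => rmax c (u^~ x) n).
Proof.
elim: n => [|n IH] mu /=; first exact: measurable_cst.
apply: measurable_maxr; last exact: mu.
by apply: IH => i ni; apply: mu; rewrite ltnW.
Qed.

End running_max.

Section maxfun.
Context (R : realType) (T : Type).
Variables (fn : nat -> T -> R) (p : R) (p0 : 0 < p).

Lemma rmax_le_maxfun x n : ((rmax 0 (fun i => `|fn i x|) n)%:E <= maxfun fn x)%E.
Proof.
have ge i : ((`|fn i x|)%:E <= maxfun fn x)%E.
  by apply: ereal_sup_ubound; exists i.
elim: n => [|n IH] /=; first by apply: le_trans (ge 0%N); rewrite lee_fin.
by rewrite EFin_max ge_max IH ge.
Qed.

Lemma maxfun_ge0 x : (0 <= maxfun fn x)%E.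
Proof. exact: (rmax_le_maxfun x 0%N). Qed.

(** Power and supremum commute by monotonicity, used for the exponent [p] in one direction and
    [1 / p] in the other; the supremum may be infinite. *)
Lemma cvg_rmax_maxfun x :
  ((rmax 0 (fun i => `|fn i x|) n) `^ p)%:E @[n --> \oo] --> (maxfun fn x `^ p)%E.
Proof.
set M := rmax 0 _.
have M0 n : 0 <= M n by exact: rmax_ge.
pose u n := ((M n) `^ p)%:E.
have nd : nondecreasing_seq u.
  by move=> m n mn; rewrite lee_fin le_powR ?(ltW p0)//; exact: rmax_le.
suff -> : (maxfun fn x `^ p)%E = ereal_sup (range u).
  exact: ereal_nondecreasing_cvgn.
have L0 : (0 <= ereal_sup (range u))%E.
  apply: le_trans (_ : (u 0%N <= _)%E); first by rewrite lee_fin powR_ge0.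
  by apply: ereal_sup_ubound; exists 0%N.
apply/eqP; rewrite eq_le; apply/andP; split; last first.
  apply: ub_ereal_sup => _ [n _ <-]; rewrite /u -poweR_EFin.
  by rewrite le_poweR ?(ltW p0) ?lee_fin//; exact: rmax_le_maxfun.
rewrite -[leRHS]poweRe1// -(mulVf (lt0r_neq0 p0)) poweRrM.
apply: le_poweR; rewrite ?(ltW p0)// ?maxfun_ge0//.
apply: ub_ereal_sup => _ [n _ <-].
apply: (@le_trans _ _ (M n.+1)%:E); first by rewrite lee_fin; exact: rmax_geS.
rewrite -[leLHS]poweRe1 ?lee_fin// -(mulfV (lt0r_neq0 p0)) poweRrM poweR_EFin.
apply: le_poweR; rewrite ?invr_ge0 ?(ltW p0) ?lee_fin ?powR_ge0//.
by apply: ereal_sup_ubound; exists n.+1.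
Qed.

End maxfun.

Lemma int_maxfun_cvg (R : realType) (d : measure_display) (T : measurableType d)
    (mu : {measure set T -> \bar R}) (fn : nat -> T -> R) (p : R) : 0 < p ->
  (forall n, measurable_fun setT (fn n)) ->
  (\int[mu]_x ((rmax 0 (fun i => `|fn i x|) n) `^ p)%:E)%E @[n --> \oo] -->
  (\int[mu]_x (maxfun fn x `^ p))%E.
Proof.
move=> p0 mfn.
rewrite (@eq_integral _ _ _ mu setT (fun x => limn (fun n => ((rmax 0 (fun i => `|fn i x|)
  n) `^ p)%:E))); last first.
  by move=> x _; apply/esym/cvg_lim => //; exact: cvg_rmax_maxfun.
apply: cvg_monotone_convergence => //.
- move=> n; apply/measurable_EFinP/(measurableT_comp (measurable_powR p)).
  by apply: measurable_rmax => i _; exact: measurableT_comp.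
- by move=> n x _; rewrite lee_fin powR_ge0.
- move=> x _ m n mn; rewrite lee_fin le_powR ?(ltW p0) ?rmax_ge//.
  exact: rmax_le.
Qed.

Lemma measurable_maxfun_pow (R : realType) (d : measure_display)
    (T : measurableType d) (fn : nat -> T -> R) (p : R) : 0 < p ->
  (forall n, measurable_fun setT (fn n)) ->
  measurable_fun setT (fun x => (maxfun fn x `^ p)%E).
Proof.
move=> p0 mfn; apply: (emeasurable_fun_cvg
  (fun n x => ((rmax 0 (fun i => `|fn i x|) n) `^ p)%:E)).
- move=> n; apply/measurable_EFinP/(measurableT_comp (measurable_powR p)).
  by apply: measurable_rmax => i _; exact: measurableT_comp.
- by move=> x _; exact: cvg_rmax_maxfun.
Qed.

Lemma measurable_nneseries_from (R : realType) (d : measure_display)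
    (T : measurableType d) (u : nat -> T -> \bar R) n :
  (forall k, measurable_fun setT (u k)) -> (forall k x, (0 <= u k x)%E) ->
  measurable_fun setT (fun x => \sum_(n <= k <oo) u k x)%E.
Proof.
move=> mu u0.
apply: (emeasurable_fun_cvg (fun m x => \sum_(n <= k < m) u k x)%E).
- by move=> m; apply: emeasurable_sum.
- by move=> x _; apply: is_cvg_nneseries => k _ _.
Qed.

(** * Carleson sequences and the maximal function *)

Section filtered.
Context (d : measure_display) (T : measurableType d) (R : realType).
Variables (mu : probability T R) (F : nat -> set (set T)).
Hypothesis filF : filtration F.

Lemma filtration_le m n : (m <= n)%N -> F m `<=` F n.
Proof.
move=> mn; rewrite -(subnK mn); elim: (n - m)%N => [//|k IH] A FA.
by rewrite addSn; have [_ _] := filF (k + m); apply; exact: IH.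
Qed.

Lemma filtration_sigma n : sigma_algebra setT (F n).
Proof. by have [] := filF n. Qed.

Lemma filtration_measurable n : F n `<=` measurable.
Proof. by have [] := filF n. Qed.

Lemma filtration_measurableS (m n : nat) (g : T -> \bar R) : (m <= n)%N ->
  G_measurable (F m) g -> G_measurable (F n) g.
Proof. by move=> mn mg B mB; apply: (filtration_le mn); exact: mg. Qed.

Local Notation sF := (filtration_sigma _).
Local Notation mF n := (@filtration_measurable n).

Variables (f : T -> R) (fn : nat -> T -> R).
Hypotheses (mf : measurable_fun setT f) (f0 : forall x, 0 <= f x).
Hypothesis fnE : cond_exps mu F f fn.

Let mfE : measurable_fun setT (EFin \o f). Proof. exact/measurable_EFinP. Qed.

Lemma cond_exps_G n : G_measurable (F n) (EFin \o fn n).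
Proof. by have [[]] := fnE n. Qed.

Lemma cond_exps_measurable n : measurable_fun setT (fn n).
Proof. by have [_ /measurable_int/measurable_EFinP] := fnE n. Qed.

Lemma cond_exps_abs n : is_condexp mu (F n) (EFin \o f) (fun x => (`|fn n x|)%:E).
Proof.
have [ce int] := fnE n; apply: (condexp_abs sF) => //; first exact: filtration_measurable.
Qed.

Lemma cond_exps_ge0 n : {ae mu, forall x, 0 <= fn n x}.
Proof.
have [ce int] := fnE n.
by apply: (condexp_ae_ge0 (mF n) _ ce int) => x; rewrite lee_fin.
Qed.

Local Notation M c x := (rmax c (fun i => `|fn i x|)).

(** As [rmax c a n] stops at the term [n - 1], it is known one step before its index. This lets the
    increment from [i] to [i.+1] be pulled out at time [i]. *)
Lemma G_measurable_rmax c n k : (n <= k.+1)%N ->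
  G_measurable (F k) (fun x => (M c x n)%:E).
Proof.
move=> nk; apply/(G_measurable_EFinP sF).
apply: (@measurable_rmax _ _ (g_sigma_algebraType (F k)) c (fun i x => `|fn i x|)).
move=> i ni; apply: measurableT_comp => //; apply/(G_measurable_EFinP sF).
apply: (@filtration_measurableS i); last exact: cond_exps_G.
by rewrite -ltnS; exact: leq_trans nk.
Qed.

Lemma measurable_rmaxfun c n : measurable_fun setT (fun x => M c x n).
Proof.
apply/measurable_EFinP/(@G_measurableW _ _ _ (F n)); first exact: filtration_measurable.
exact: G_measurable_rmax.
Qed.

(** * Carleson sums are dominated by the maximal function *)

Section carleson.
Variables (p : R) (p0 : 0 < p) (alpha : nat -> T -> R).
Hypotheses (al0 : forall n x, 0 <= alpha n x).
Hypotheses (alG : forall n, G_measurable (F n) (EFin \o alpha n)).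
Hypothesis alC : forall n, exists g : T -> \bar R,
            [/\ is_condexp mu (F n) (fun x => (\sum_(n <= k <oo) (alpha k x)%:E)%E) g,
                (forall x, (0 <= g x)%E) &
                {ae mu, forall x, (g x <= 1%:E)%E}].

Let mal n : measurable_fun setT (alpha n).
Proof. by apply/measurable_EFinP; apply: (G_measurableW (mF n)). Qed.

Let D i x := (M 0 x i.+1) `^ p - (M 0 x i) `^ p.

Let D0 i x : 0 <= D i x.
Proof. by rewrite subr_ge0 le_powR ?rmax_ge ?(ltW p0)//; exact: rmax_leS. Qed.

Let DE n x : \sum_(i < n) D i x = (M 0 x n) `^ p.
Proof.
elim: n => [|n IH]; first by rewrite big_ord0 powR0// lt0r_neq0.
by rewrite big_ord_recr IH /D /= addrCA subrr addr0.
Qed.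

Let DG i : G_measurable (F i) (fun x => (D i x)%:E).
Proof.
apply/(G_measurable_EFinP sF); apply: measurable_funB.
- apply: (measurableT_comp (measurable_powR p)).
  by apply/(G_measurable_EFinP sF); exact: G_measurable_rmax.
- apply: (measurableT_comp (measurable_powR p)).
  by apply/(G_measurable_EFinP sF); exact: G_measurable_rmax.
Qed.

Let mD i : measurable_fun setT (fun x => (D i x)%:E).
Proof. by apply: (G_measurableW (mF i)). Qed.

(** Bound [|fn k x|] by the maximum up to time [k], whose [p]-th power is the sum of the [D i x]
    with [i <= k], and exchange the two sums. *)
Let abel n x : \sum_(k < n) alpha k x * `|fn k x| `^ p <=
  \sum_(i < n) D i x * \sum_(i <= k < n) alpha k x.
Proof.
elim: n => [|n IH]; first by rewrite !big_ord0.
rewrite big_ord_recr [leRHS]big_ord_recr /= big_nat1.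
rewrite [X in _ <= X + _](eq_bigr (fun i : 'I_n => D i x * (\sum_(i <= k < n) alpha k x) +
   D i x * alpha n x)); last first.
  by move=> i _; rewrite big_nat_recr//= ?mulrDr// ltnW.
rewrite big_split /= -addrA lerD// -mulr_suml -mulrDl mulrC.
have -> : \sum_(i < n) D i x + D n x = \sum_(i < n.+1) D i x by rewrite big_ord_recr.
by rewrite DE ler_wpM2r// le_powR ?(ltW p0)//; exact: rmax_geS.
Qed.

Lemma carleson_le_maximal :
  (\int[mu]_x (\sum_(k <oo) ((alpha k x) * (fn k x `^ p))%:E) <=
   \int[mu]_x (maxfun fn x `^ p))%E.
Proof.
have mt k : measurable_fun setT (fun x => ((alpha k x) * (fn k x `^ p))%:E).
  apply/measurable_EFinP/measurable_funM => //.
  by apply: (measurableT_comp (measurable_powR p)); exact: cond_exps_measurable.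
have ma k : measurable_fun setT (fun x => ((alpha k x) * (`|fn k x| `^ p))%:E).
  apply/measurable_EFinP/measurable_funM => //.
  apply: (measurableT_comp (measurable_powR p)); apply: measurableT_comp => //.
  exact: cond_exps_measurable.
rewrite integral_nneseries//; last first.
  by move=> n x _; rewrite lee_fin mulr_ge0 ?powR_ge0.
apply: lime_le.
  by apply: is_cvg_nneseries => n _ _; apply: integral_ge0 => x _; rewrite lee_fin mulr_ge0
    ?powR_ge0.
near=> n.
apply: (@le_trans _ _ (\int[mu]_x ((M 0 x n) `^ p)%:E)%E); last first.
  apply: ge0_le_integral => //.
  - by move=> x _; rewrite lee_fin powR_ge0.
  - apply/measurable_EFinP/(measurableT_comp (measurable_powR p)).
    exact: measurable_rmaxfun.
  - by apply: measurable_maxfun_pow => // k; exact: cond_exps_measurable.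
  - move=> x _; rewrite -poweR_EFin le_poweR ?(ltW p0) ?lee_fin ?rmax_ge//.
    exact: rmax_le_maxfun.
rewrite big_mkord.
(* [fn k] may be negative on a null set; the summation by parts compares [|fn k|] with the running
   maximum, so the absolute value is put in first. *)
rewrite (eq_bigr (fun k : 'I_n => \int[mu]_x ((alpha k x) * (`|fn k x| `^ p))%:E)%E); last
  first.
  move=> k _; apply: ge0_ae_eq_integral => //.
  - by move=> x _; rewrite lee_fin mulr_ge0 ?powR_ge0.
  - by move=> x _; rewrite lee_fin mulr_ge0 ?powR_ge0.
  - by apply: filterS (cond_exps_ge0 k) => x fx0 _; rewrite ger0_norm.
rewrite -ge0_integral_sum//; last by move=> k x _; rewrite lee_fin mulr_ge0 ?powR_ge0.
pose S i x := (\sum_(i <= k <oo) (alpha k x)%:E)%E.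
have S0 i x : (0 <= S i x)%E by apply: nneseries_ge0 => k _ _; rewrite lee_fin.
have mS i : measurable_fun setT (S i).
  apply: measurable_nneseries_from => [k|k x]; first exact/measurable_EFinP.
  by rewrite lee_fin.
apply: (@le_trans _ _ (\int[mu]_x (\sum_(i < n) (D i x)%:E * S i x))%E).
  apply: ge0_le_integral => //.
  - by move=> x _; apply: sume_ge0 => k _; rewrite lee_fin mulr_ge0 ?powR_ge0.
  - by apply: emeasurable_sum => k.
  - by apply: emeasurable_sum => i; apply: emeasurable_funM.
  - move=> x _; rewrite sumEFin.
    apply: (@le_trans _ _ (\sum_(i < n) D i x * \sum_(i <= k < n) alpha k x)%:E).
      by rewrite lee_fin; exact: abel.
    rewrite -sumEFin; apply: lee_sum => i _; rewrite EFinM lee_wpmul2l ?lee_fin//.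
    rewrite -sumEFin; apply: nneseries_lim_ge => k _ _; rewrite lee_fin//.
rewrite ge0_integral_sum//; last 2 first.
- by move=> i; apply: emeasurable_funM.
- by move=> i x _; rewrite mule_ge0 ?lee_fin.
rewrite (eq_integral (fun x => (\sum_(i < n) (D i x)%:E)%E)); last first.
  by move=> x _; rewrite sumEFin DE.
rewrite ge0_integral_sum//; last by move=> i x _; rewrite lee_fin.
apply: lee_sum => i _; have [g [[mg gS] g0 g1]] := alC i.
(* [D i] is known at time [i], so its integral against the tail of [alpha] is the one against [g],
   which is at most 1 almost everywhere. *)
rewrite -(@integral_pullout _ _ _ (F i) sF (mF i) mu g) ?lee_fin//; last 2 first.
- exact: (G_measurableW (mF i)).
- by move=> x; rewrite lee_fin.
apply: ae_ge0_le_integral => //.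
- by move=> x _; rewrite mule_ge0 ?lee_fin.
- by apply: emeasurable_funM => //; exact: (G_measurableW (mF i)).
- by move=> x _; rewrite lee_fin.
- by apply: filterS g1 => x gx1 _; rewrite -[leRHS]mule1 lee_wpmul2l ?lee_fin.
Unshelve. all: by end_near. Qed.

End carleson.


Lemma ge0_integral_nneseries_from (u : nat -> T -> \bar R) n A : measurable A ->
  (forall k, measurable_fun setT (u k)) -> (forall k x, (0 <= u k x)%E) ->
  (\int[mu]_(x in A) (\sum_(n <= k <oo) u k x) =
   \sum_(n <= k <oo) \int[mu]_(x in A) u k x)%E.
Proof.
move=> mA mu_ u0; under eq_integral do rewrite -nneseries_addn//.
rewrite integral_nneseries//; last by move=> k; exact: measurable_funTS.
by rewrite (@nneseries_addn _ (fun k => \int[mu]_(x in A) u k x)%E)// => k; exact: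
  integral_ge0.
Qed.

(** * Carleson sequences that reach the maximal function *)

Section maximal_le_carleson.
Variables (p : R) (p0 : 0 < p) (N : nat).
Local Notation Mx x := (M (-1) x).

(** Starting at [-1], below every [|fn i x|], makes time 0 a strict increase even where all the
    terms vanish, so that the maximum always has a first time. From index 1 on the starting value is
    forgotten. *)
Let M1 x n : M (-1) x n.+1 = M 0 x n.+1.
Proof.
elim: n => [|n IH] /=; first by rewrite !max_r// (le_trans (lerN10 _)).
by rewrite /= in IH; rewrite IH.
Qed.

Let B k := [set x | Mx x k < Mx x N.+1].
(* The indicator of the event that the maximum is first attained at time [k]. *)
Let e k x : R := \1_(B k) x - \1_(B k.+1) x.

Let mB k : measurable (B k).
Proof.
have -> : B k = setT `&` (fun x => Mx x N.+1 - Mx x k) @^-1` `]0, +oo[%classic.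
  by rewrite setTI; apply/seteqP; split => x /=; rewrite in_itv/= andbT subr_gt0.
by apply: measurable_funB => //; exact: measurable_rmaxfun.
Qed.

Let me k : measurable_fun setT (EFin \o e k).
Proof. by apply/measurable_EFinP/measurable_funB; exact: measurable_indic. Qed.

Let Bsub k : B k.+1 `<=` B k.
Proof. by move=> x; apply: le_lt_trans; exact: rmax_leS. Qed.

Let e0 k x : 0 <= e k x.
Proof.
rewrite /e !indicE; case: (boolP (x \in B k.+1)) => [xB|_]; last by rewrite subr0.
by rewrite mem_set ?subrr//; apply: Bsub; exact: set_mem.
Qed.

Let esum m n x : (m <= n)%N -> \sum_(m <= k < n) e k x = \1_(B m) x - \1_(B n) x.
Proof.
move=> mn; have := telescope_sumr (fun k => - \1_(B k) x : R) mn.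
rewrite opprK addrC => <-; apply: eq_bigr => k _.
by rewrite /e opprK addrC.
Qed.

Let BN : B N.+1 = set0.
Proof. by apply/seteqP; split => x //=; rewrite /B/= ltxx. Qed.

Let B0 : B 0%N = setT.
Proof.
apply/seteqP; split => x // _; rewrite /B/mkset M1.
by rewrite (lt_le_trans (ltrN10 _))// rmax_ge.
Qed.

Let eseries_le1 n x : (\sum_(n <= k <oo) (e k x)%:E <= 1)%E.
Proof.
apply: lime_le; first by apply: is_cvg_nneseries => k _ _; rewrite lee_fin.
near=> m; rewrite sumEFin lee_fin esum; last by near: m; exact: nbhs_infty_ge.
rewrite !indicE; apply: (@le_trans _ _ ((x \in B n)%:R : R)); last by case: (_ \in _).
by rewrite lerBlDr lerDl.
Unshelve. all: by end_near. Qed.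

Let eseries_eq1 x : (\sum_(k <oo) (e k x)%:E = 1)%E.
Proof.
apply/eqP; rewrite eq_le eseries_le1/=.
apply: le_trans (@nneseries_lim_ge _ _ _ 0%N N.+1 _).
  by rewrite sumEFin esum// BN B0 lee_fin !indicE in_setT in_set0 subr0.
by move=> k _ _; rewrite lee_fin.
Qed.

(** Where [e k x] is not 0, the running maximum jumps to its final value exactly at time [k], so
    [|fn k x|] is that value. *)
Let e_max k x : e k x * `|fn k x| `^ p = e k x * (M 0 x N.+1) `^ p.
Proof.
rewrite -M1; have [ek|] := eqVneq (e k x) 0; first by rewrite ek !mul0r.
rewrite /e !indicE; case: (boolP (x \in B k)) => [/set_mem xBk|xBk]; last first.
  case: (boolP (x \in B k.+1)) => [/set_mem/Bsub/mem_set|]; first by rewrite (negbTE xBk).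
  by rewrite subrr eqxx.
case: (boolP (x \in B k.+1)) => [|/negP xBk1 _]; first by rewrite subrr eqxx.
have {}xBk1 : Mx x N.+1 <= Mx x k.+1.
  by rewrite leNgt; apply/negP => ?; apply: xBk1; exact: mem_set.
congr (_ * _ `^ p); apply/eqP; rewrite eq_le; apply/andP; split; last first.
  by move: xBk1; rewrite [X in _ <= X -> _]/= le_max leNgt xBk.
apply: (le_trans (rmax_geS (-1) (fun i => `|fn i x|) k)); apply: rmax_le.
by rewrite ltnNge; apply/negP => /(rmax_le (-1) (fun i => `|fn i x|)); rewrite leNgt xBk.
Qed.

(** [e k] looks ahead up to time [N], hence its projection on [F k]. The relevant integrals do not
    change: tails from [n] on are tested on sets of [F n], which lie in [F k] for [k >= n], and
    [|fn k| ^ p] is known at time [k]. *)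
Lemma maximal_le_carleson : exists alpha : nat -> T -> R,
  [/\ (forall n x, 0 <= alpha n x) /\ (forall n, G_measurable (F n) (EFin \o alpha n)),
      (forall n, exists g : T -> \bar R,
            [/\ is_condexp mu (F n) (fun x => (\sum_(n <= k <oo) (alpha k x)%:E)%E) g,
                (forall x, (0 <= g x)%E) &
                {ae mu, forall x, (g x <= 1%:E)%E}]),
      (\int[mu]_x (\sum_(k <oo) (alpha k x)%:E) = 1%:E)%E &
      (\int[mu]_x (\sum_(k <oo) ((alpha k x) * (fn k x `^ p))%:E) =
       \int[mu]_x ((M 0 x N.+1) `^ p)%:E)%E].
Proof.
have e0E k x : (0 <= (e k x)%:E)%E by rewrite lee_fin.
have ie k : mu.-integrable setT (EFin \o e k).
  apply/integrableP; split => //.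
  under eq_integral do rewrite /= ger0_norm//.
  apply: (@le_lt_trans _ _ (\int[mu]_x (cst 1%E x))%E); last first.
    by rewrite integral_cst// mul1e -ge0_fin_numE// fin_num_measure.
  apply: ge0_le_integral => //; [exact: me|move=> x _].
  apply: le_trans (eseries_le1 k x).
  by apply: le_trans (@nneseries_lim_ge _ _ _ k k.+1 _); rewrite ?big_nat1.
have /choice[alpha alphaP] k := condexp_exists (filtration_sigma k) (mF k) (ie k) (e0E k).
have al0 k x : 0 <= alpha k x by have [_ _] := alphaP k; apply.
have al0E k x : (0 <= (alpha k x)%:E)%E by rewrite lee_fin.
have mal k : measurable_fun setT (EFin \o alpha k).
  by have [_ /measurable_int] := alphaP k.
have intA n A : F n A -> (\int[mu]_(x in A) (\sum_(n <= k <oo) (alpha k x)%:E) =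
    \int[mu]_(x in A) (\sum_(n <= k <oo) (e k x)%:E))%E.
  move=> FA; have mA := mF n FA.
  rewrite ge0_integral_nneseries_from// [RHS]ge0_integral_nneseries_from//.
  congr (limn _); apply/funext => m; apply: eq_big_nat => k /andP[nk _].
  by have [[_ ->//]] := alphaP k; exact: (filtration_le nk).
have intle n A : F n A -> (\int[mu]_(x in A) (\sum_(n <= k <oo) (alpha k x)%:E) <= mu A)%E.
  move=> FA; have mA := mF n FA; rewrite intA//.
  rewrite -[leRHS]mul1e -integral_cst//; apply: ge0_le_integral => //.
  - by move=> x _; apply: nneseries_ge0.
  - by apply: measurable_funTS; exact: measurable_nneseries_from.
have mser n : measurable_fun setT (fun x => \sum_(n <= k <oo) (alpha k x)%:E)%E.
  exact: measurable_nneseries_from.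
exists alpha; split.
- by split => // k; have [[]] := alphaP k.
- move=> n.
  have s0 x : (0 <= \sum_(n <= k <oo) (alpha k x)%:E)%E by apply: nneseries_ge0.
  have is_ : mu.-integrable setT (fun x => \sum_(n <= k <oo) (alpha k x)%:E)%E.
    apply/integrableP; split => //; under eq_integral do rewrite gee0_abs//.
    apply: le_lt_trans (intle n setT (G_setT (filtration_sigma n))) _.
    by rewrite -ge0_fin_numE// fin_num_measure.
  have [g [[mg gE] _ g0]] := condexp_exists (filtration_sigma n) (mF n) is_ s0.
  exists (EFin \o g); split => //=.
    by apply: (condexp_le1_ae (mF n)) => // A FA; rewrite -[leLHS]/(\int[mu]_(x in A) (EFin
      \o g) x)%E gE// intle.
- rewrite (intA 0%N setT (G_setT (filtration_sigma 0)))//.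
  under eq_integral do rewrite eseries_eq1.
  by rewrite integral_cst// mul1e; exact: probability_setT.
- have mfk k : measurable_fun setT (fun x => (fn k x `^ p)).
    by apply: (measurableT_comp (measurable_powR p)); exact: cond_exps_measurable.
  have mfa k : measurable_fun setT (fun x => (`|fn k x| `^ p)).
    apply: (measurableT_comp (measurable_powR p)); apply: measurableT_comp => //.
    exact: cond_exps_measurable.
  have mal' k : measurable_fun setT (alpha k) by exact/measurable_EFinP.
  rewrite integral_nneseries//; last 2 first.
  + by move=> k; apply/measurable_EFinP/measurable_funM.
  + by move=> k x _; rewrite lee_fin mulr_ge0 ?powR_ge0.
  transitivity (\sum_(k <oo) \int[mu]_x ((M 0 x N.+1 `^ p)%:E * (e k x)%:E))%E.
    apply: eq_eseriesr => k _.
    transitivity (\int[mu]_x ((`|fn k x| `^ p)%:E * (alpha k x)%:E))%E.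
      apply: ge0_ae_eq_integral => //.
      * by apply/measurable_EFinP/measurable_funM.
      * by apply/emeasurable_funM; exact/measurable_EFinP.
      * by move=> x _; rewrite lee_fin mulr_ge0 ?powR_ge0.
      * by move=> x _; rewrite mule_ge0 ?lee_fin ?powR_ge0.
      * by apply: filterS (cond_exps_ge0 k) => x fx0 _; rewrite ger0_norm// muleC.
    transitivity (\int[mu]_x ((`|fn k x| `^ p)%:E * (e k x)%:E))%E; last first.
      by apply: eq_integral => x _; rewrite -!EFinM mulrC e_max mulrC.
    apply: (@integral_pullout _ _ _ (F k) (filtration_sigma k) (mF k) mu
      (EFin \o alpha k) (EFin \o e k)) => //.
    * exact: al0E.
    * exact: e0E.
    * by have [[]] := alphaP k.
    * apply/(G_measurable_EFinP (filtration_sigma k)).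
      apply: (measurableT_comp (measurable_powR p)); apply: measurableT_comp => //.
      by apply/(G_measurable_EFinP (filtration_sigma k)); exact: cond_exps_G.
  rewrite -integral_nneseries//; last 2 first.
  + move=> k; apply/emeasurable_funM; last exact: me.
    apply/measurable_EFinP.
    by apply: (measurableT_comp (measurable_powR p)); exact: measurable_rmaxfun.
  + by move=> k x _; rewrite mule_ge0 ?lee_fin ?powR_ge0.
  by apply: eq_integral => x _; rewrite nneseriesZl// eseries_eq1 mule1.
Qed.

End maximal_le_carleson.

End filtered.

Lemma Btilde_Bmart (R : realType) (d : measure_display) (T : measurableType d)
  (mu : probability T R) (F : nat -> set (set T)) (p Fv fv : R) :
  0 < p -> filtration F -> Btilde mu F p Fv fv = Bmart mu F p Fv fv 1 1.
Proof.
move=> p0 filF; apply/eqP; rewrite eq_le; apply/andP; split.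
- apply: ub_ereal_sup => _ [f [fn [[mf f0 fF fE] fnE ->]]].
  have mfn := cond_exps_measurable fnE.
  have H := int_maxfun_cvg (mu := mu) p0 mfn.
  rewrite -(cvg_lim _ H)//; apply: lime_le; first by apply/cvg_ex; eexists; exact: H.
  near=> n.
  have n0 : (0 < n)%N by near: n; exact: nbhs_infty_gt.
  rewrite -(prednK n0).
  have [alpha [al0 alC al1 alE]] := maximal_le_carleson filF f0 fnE p n.-1.
  by apply: ereal_sup_ubound; exists f, fn, alpha; split => //; rewrite alE.
- apply: ub_ereal_sup => _ [f [fn [alpha [[mf f0 fF fE fnE] [al0 alG] alC al1 ->]]]].
  apply: (@le_trans _ _ (\int[mu]_x (maxfun fn x `^ p))%E).
    exact: (carleson_le_maximal filF f0 fnE p0 al0 alG alC).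
  by apply: ereal_sup_ubound; exists f, fn.
Unshelve. all: by end_near. Qed.

(** * The upper bound *)

Lemma ge0_integral_lin2 (d : measure_display) (T : measurableType d)
    (R : realType) (mu : {measure set T -> \bar R}) (c1 c2 : R) (u v : T -> R) :
  0 <= c1 -> 0 <= c2 -> measurable_fun setT u -> measurable_fun setT v ->
  (forall x, 0 <= u x) -> (forall x, 0 <= v x) ->
  (\int[mu]_x (c1 * u x + c2 * v x)%:E =
   c1%:E * \int[mu]_x (u x)%:E + c2%:E * \int[mu]_x (v x)%:E)%E.
Proof.
move=> c10 c20 mu_ mv u0 v0.
have mE (w : T -> R) : measurable_fun setT w -> measurable_fun setT (fun x => (w x)%:E :
  \bar R).
  by move=> mw; exact/measurable_EFinP.
rewrite -!ge0_integralZl//; do ?[exact: mE]; do ?by move=> x _; rewrite lee_fin.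
rewrite -ge0_integralD//.
- by move=> x _; rewrite mule_ge0 ?lee_fin.
- by apply: measurable_funeM; exact: mE.
- by move=> x _; rewrite mule_ge0 ?lee_fin.
- by apply: measurable_funeM; exact: mE.
Qed.

Lemma integral_cst_prob (d : measure_display) (T : measurableType d)
    (R : realType) (mu : probability T R) (c : \bar R) :
  (\int[mu]_x (cst c x) = c)%E.
Proof.
rewrite integral_cst// -[RHS]mule1; congr (_ * _)%E; exact: probability_setT.
Qed.

(** Elimination of [K] between Doob's bound and Young's; after the bound on [Fv] the positive factor
    [(p - 1) * B * a] cancels. In use, [c] is [fv ^ p], [B] is [(1 - a) ^ (p - 1)], [I] is the
    [p]-th moment of the truncated maximum [m], and [K] is the integral of
    [f * (m ^ (p - 1) - fv ^ (p - 1))]. *)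
Lemma upper_bound_arith (R : realType) (p a c B I K Fv : R) : 1 < p -> 0 < a ->
  a * p < 1 -> 0 < B -> (p - 1) * I <= (p - 1) * c + p * K ->
  p * B * K + p * B * c <= Fv + (p - 1) * ((1 - a) * B) * I ->
  Fv * (1 - a * p) <= c * ((1 - a) * B) -> I * (1 - a * p) <= c.
Proof.
move=> p1 a0 ap B0 H1 H2 H3.
have H4 : (p - 1) * B * a * I <= Fv - B * c.
  have : B * ((p - 1) * I) <= B * ((p - 1) * c + p * K) by rewrite ler_pM2l.
  by lra.
have H5 : (p - 1) * B * a * (I * (1 - a * p)) <= (p - 1) * B * a * c.
  have : (p - 1) * B * a * I * (1 - a * p) <= (Fv - B * c) * (1 - a * p).
    by rewrite ler_pM2r// subr_gt0.
  by lra.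
by move: H5; rewrite ler_pM2l// !mulr_gt0// subr_gt0.
Qed.

Section doob_upper.
Context (d : measure_display) (T : measurableType d) (R : realType).
Variables (mu : probability T R) (F : nat -> set (set T)).
Hypothesis filF : filtration F.
Variables (f : T -> R) (fn : nat -> T -> R).
Hypotheses (mf : measurable_fun setT f) (f0 : forall x, 0 <= f x).
Hypothesis fnE : cond_exps mu F f fn.
Variables (p Fv fv : R) (p1 : 1 < p) (fv0 : 0 <= fv).
Hypotheses (intfp : (\int[mu]_x ((f x) `^ p)%:E = Fv%:E)%E).
Hypotheses (intf : (\int[mu]_x (f x)%:E = fv%:E)%E).
Local Notation M c x := (rmax c (fun i => `|fn i x|)).

Let p0 : 0 < p. Proof. exact: lt_trans p1. Qed.
Let p10 : 0 <= p - 1. Proof. by rewrite subr_ge0 ltW. Qed.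

Section truncated.
Variables (L : R) (fvL : fv <= L).
(* Truncation at [L] makes all integrals finite before anything is subtracted. *)
Let m x k := Num.min (M fv x k) L.
Let D i x := m x i.+1 `^ (p - 1) - m x i `^ (p - 1).

Let m_ge x k : fv <= m x k.
Proof. by rewrite le_min fvL rmax_ge. Qed.

Let m_ge0 x k : 0 <= m x k.
Proof. exact: le_trans (m_ge x k). Qed.

Let m_leS x k : m x k <= m x k.+1.
Proof. by rewrite le_min !ge_min rmax_leS lexx orbT. Qed.

Let m_leL x k : m x k <= L.
Proof. by rewrite ge_min lexx orbT. Qed.

Let D0 i x : 0 <= D i x.
Proof. by rewrite subr_ge0 le_powR. Qed.

Let DE n x : \sum_(i < n) D i x = m x n `^ (p - 1) - fv `^ (p - 1).
Proof.
elim: n => [|n IH]; first by rewrite big_ord0 /m /= min_l// subrr.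
by rewrite big_ord_recr IH /D /= addrC addrA subrK.
Qed.

(** Where the truncated maximum rises, its new value is at most the term that made it rise;
    elsewhere [D i x] is 0. *)
Let m_fn i x : m x i.+1 * D i x <= `|fn i x| * D i x.
Proof.
have [lt|ge] := ltP (m x i) (m x i.+1); last first.
  have -> : m x i.+1 = m x i by apply/eqP; rewrite eq_le ge m_leS.
  by rewrite /D (_ : m x i.+1 = m x i) ?subrr ?mulr0//; apply/eqP; rewrite eq_le ge m_leS.
rewrite ler_wpM2r//.
have : M fv x i < M fv x i.+1.
  rewrite ltNge; apply/negP => h; move: lt; rewrite ltNge => /negP; apply.
  by rewrite le_min !ge_min h lexx orbT.
by rewrite /m /= ge_min lt_max ltxx/= => h; rewrite max_r ?lexx ?(ltW h).
Qed.

Let step n x : (p - 1) * m x n `^ p <=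
  (p - 1) * fv `^ p + p * \sum_(i < n) D i x * `|fn i x|.
Proof.
elim: n => [|n IH]; first by rewrite big_ord0 mulr0 addr0 /m /= min_l.
rewrite big_ord_recr /= mulrDr addrA.
have := powR_doob p1 (m_ge0 x n) (m_ge0 x n.+1).
rewrite -/(D n x) => H; have := m_fn n x; rewrite -(ler_pM2l p0) => H2.
rewrite (mulrC (D n x)); move: (m x n.+1 * D n x) H H2 => z.
rewrite mulrBr lerBlDr => H H2; apply: (le_trans H); rewrite addrC lerD//.
Qed.

Let mm k : measurable_fun setT (fun x => m x k).
Proof. by apply: measurable_minr => //; exact: (measurable_rmaxfun filF). Qed.

Let mmp q k : measurable_fun setT (fun x => m x k `^ q).
Proof. by apply: (measurableT_comp (measurable_powR q)). Qed.

Let DG i : G_measurable (F i) (fun x => (D i x)%:E).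
Proof.
have sF := filtration_sigma filF i.
apply/(G_measurable_EFinP sF); apply: measurable_funB;
  apply: (measurableT_comp (measurable_powR _)); apply: measurable_minr => //;
  by apply/(G_measurable_EFinP sF); exact: (G_measurable_rmax filF fnE).
Qed.

Let mD i : measurable_fun setT (D i).
Proof. by apply: measurable_funB. Qed.

Let Kf n x := f x * (m x n `^ (p - 1) - fv `^ (p - 1)).

Let Kf0 n x : 0 <= Kf n x.
Proof. by rewrite mulr_ge0// subr_ge0 le_powR. Qed.

Let mKf n : measurable_fun setT (Kf n).
Proof. by apply: measurable_funM => //; apply: measurable_funB. Qed.

(** [D i] is known at time [i], so [|fn i|] may be exchanged for [f]; the increments then
    telescope. *)
Let intK n : (\int[mu]_x (\sum_(i < n) (D i x)%:E * (`|fn i x|)%:E) =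
  \int[mu]_x (Kf n x)%:E)%E.
Proof.
have mfn i : measurable_fun setT (fun x => (`|fn i x|)%:E).
  by apply/measurable_EFinP/measurableT_comp => //; exact: cond_exps_measurable fnE i.
have mfE : measurable_fun setT (EFin \o f) by exact/measurable_EFinP.
have mDE i : measurable_fun setT (fun x => (D i x)%:E) by exact/measurable_EFinP.
rewrite ge0_integral_sum//; last 2 first.
- by move=> i; apply: emeasurable_funM.
- by move=> i x _; rewrite mule_ge0 ?lee_fin.
rewrite (eq_bigr (fun i : 'I_n => \int[mu]_x ((D i x)%:E * (EFin \o f) x))%E); last first.
  move=> i _; apply: (@integral_pullout _ _ _ (F i) (filtration_sigma filF i)
    (@filtration_measurable _ _ _ filF i) mu
    (fun x => (`|fn i x|)%:E) (EFin \o f)) => //.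
  - by have [] := cond_exps_abs filF mf f0 fnE i.
  - by move=> x; rewrite lee_fin.
rewrite -ge0_integral_sum//; last 2 first.
- by move=> i; apply: emeasurable_funM.
- by move=> i x _; rewrite mule_ge0 ?lee_fin.
apply: eq_integral => x _; rewrite -ge0_sume_distrl; last by move=> i _; rewrite lee_fin.
by rewrite sumEFin DE -EFinM mulrC.
Qed.

Lemma truncated_maximal_le (a : R) n : 0 < a -> a * p < 1 ->
  Fv <= fv `^ p * ((1 - a) `^ p / (1 - a * p)) ->
  (\int[mu]_x (m x n `^ p)%:E <= (fv `^ p / (1 - a * p))%:E)%E.
Proof.
move=> a0 ap FvU; set b := 1 - a.
have b0 : 0 < b.
  by rewrite subr_gt0 (lt_trans _ ap)// ltr_pMr.
have b1 : 0 < b `^ (p - 1) by exact: powR_gt0.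
have bp : b `^ p = b * b `^ (p - 1) by rewrite mulr_powRB1// ltW.
have fvp : fv `^ p = fv * fv `^ (p - 1) by rewrite mulr_powRB1.
have L0 : 0 <= L by exact: le_trans fvL.
have Ifin : (\int[mu]_x (m x n `^ p)%:E)%E \is a fin_num.
  rewrite ge0_fin_numE; last by apply: integral_ge0 => x _; rewrite lee_fin powR_ge0.
  apply: (@le_lt_trans _ _ (\int[mu]_x (cst (L `^ p)%:E x))%E); last first.
    by rewrite integral_cst_prob ltry.
  apply: ge0_le_integral => //.
  - by move=> x _; rewrite lee_fin powR_ge0.
  - exact/measurable_EFinP.
  - by move=> x _; rewrite lee_fin le_powR// ltW.
have Kfin : (\int[mu]_x (Kf n x)%:E)%E \is a fin_num.
  rewrite ge0_fin_numE; last by apply: integral_ge0 => x _; rewrite lee_fin.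
  apply: (@le_lt_trans _ _ (\int[mu]_x ((L `^ (p - 1))%:E * (f x)%:E))%E); last first.
    rewrite ge0_integralZl//; last 3 first.
    - exact/measurable_EFinP.
    - by move=> x _; rewrite lee_fin.
    - by rewrite lee_fin powR_ge0.
    by rewrite intf -EFinM ltry.
  apply: ge0_le_integral => //.
  - by move=> x _; rewrite lee_fin.
  - exact/measurable_EFinP.
  - by apply: emeasurable_funM => //; exact/measurable_EFinP.
  - move=> x _; rewrite -EFinM lee_fin /Kf mulrC ler_wpM2r//.
    by rewrite lerBlDr (@le_trans _ _ (L `^ (p - 1)))// ?le_powR// lerDl powR_ge0.
set I := fine (\int[mu]_x (m x n `^ p)%:E)%E.
set K := fine (\int[mu]_x (Kf n x)%:E)%E.
have IE : (\int[mu]_x (m x n `^ p)%:E)%E = I%:E by rewrite fineK.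
have KE : (\int[mu]_x (Kf n x)%:E)%E = K%:E by rewrite fineK.
have mfn i : measurable_fun setT (fun x => `|fn i x|).
  by apply: measurableT_comp => //; exact: cond_exps_measurable fnE i.
have mS : measurable_fun setT (fun x => \sum_(i < n) D i x * `|fn i x|).
  by apply: measurable_sum => i; apply: measurable_funM.
have S0 x : 0 <= \sum_(i < n) D i x * `|fn i x| by apply: sumr_ge0 => i _; rewrite mulr_ge0.
have SE : (\int[mu]_x (\sum_(i < n) D i x * `|fn i x|)%:E = K%:E)%E.
  by rewrite -KE -intK; apply: eq_integral => x _; rewrite -sumEFin.
have mfp : measurable_fun setT (fun x => f x `^ p).
  exact: (measurableT_comp (measurable_powR _)).
have lin_ge0 (c1 c2 u v : R) : 0 <= c1 -> 0 <= c2 -> 0 <= u -> 0 <= v -> 0 <= c1 * u + c2 * v.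
  by move=> *; rewrite addr_ge0// mulr_ge0.
have mlin (c1 c2 : R) u v : measurable_fun setT u -> measurable_fun setT v ->
    measurable_fun setT (fun x : T => (c1 * u x + c2 * v x)%:E).
  by move=> mu_ mv; apply/measurable_EFinP/measurable_funD; apply: measurable_funM.
have H1 : (p - 1) * I <= (p - 1) * fv `^ p + p * K.
  rewrite -[leLHS]addr0 -[X in _ + X](mul0r I) -lee_fin 2!EFinD !(EFinM _ I) (EFinM p K)
    -IE -SE.
  rewrite EFinM -(integral_cst_prob mu (fv `^ p)%:E).
  rewrite -!(@ge0_integral_lin2 _ _ _ mu)//; do ?[exact: ltW | by move=> x; exact: powR_ge0].
  apply: ge0_le_integral => //.
  - by move=> x _; rewrite lee_fin lin_ge0 ?powR_ge0.
  - exact: mlin.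
  - by apply: mlin => //; exact: measurable_cst.
  - by move=> x _; rewrite lee_fin mul0r addr0; exact: step.
have H2 : p * b `^ (p - 1) * K + p * b `^ (p - 1) * fv `^ (p - 1) * fv <=
    1 * Fv + (p - 1) * b `^ p * I.
  have pb0 : 0 <= p * b `^ (p - 1) by rewrite mulr_ge0 ?powR_ge0 ?ltW.
  have pbf0 : 0 <= p * b `^ (p - 1) * fv `^ (p - 1) by rewrite mulr_ge0 ?powR_ge0.
  have pb1 : 0 <= (p - 1) * b `^ p by rewrite mulr_ge0 ?powR_ge0.
  rewrite -lee_fin !EFinD (EFinM _ K) (EFinM _ fv) (EFinM _ I) (EFinM 1) -IE -KE -intf -intfp.
  rewrite -!(@ge0_integral_lin2 _ _ _ mu)//; do ?by move=> x; exact: powR_ge0.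
  apply: ge0_le_integral => //.
  - by move=> x _; rewrite lee_fin lin_ge0.
  - exact: mlin.
  - exact: mlin.
  - move=> x _; rewrite lee_fin mul1r /Kf.
    (* Young's inequality between [f] and [(1 - a) * m], which are equal for the extremal
       function. *)
    have := powR_young p1 (mulr_ge0 (ltW b0) (m_ge0 x n)) (f0 x).
    rewrite !powRM ?(ltW b0)// => H.
    rewrite [leLHS](_ : _ = p * (f x * (b `^ (p - 1) * m x n `^ (p - 1)))); last by ring.
    by rewrite -mulrA.
rewrite IE lee_fin ler_pdivlMr ?subr_gt0//.
apply: (@upper_bound_arith _ p a _ (b `^ (p - 1)) _ K Fv) => //.
- by move: H2; rewrite mul1r bp -!mulrA (mulrC _ fv) -fvp.
- rewrite -/b -bp; move: FvU; rewrite mulrA ler_pdivlMr// subr_gt0//.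
Qed.

End truncated.

(** Two monotone limits remove the truncation level [fv + k] and the horizon [n]. Starting the
    maximum at [fv] can only raise it, and lets the increments telescope down to [fv ^ (p - 1)],
    whose integral against [f] is known. *)
Lemma maximal_upper (a : R) : 0 < a -> a * p < 1 ->
  Fv <= fv `^ p * ((1 - a) `^ p / (1 - a * p)) ->
  (\int[mu]_x (maxfun fn x `^ p) <= (fv `^ p / (1 - a * p))%:E)%E.
Proof.
move=> a0 ap FvU; have mfn := cond_exps_measurable fnE.
have H := int_maxfun_cvg (mu := mu) p0 mfn.
rewrite -(cvg_lim _ H)//; apply: lime_le; first by apply/cvg_ex; eexists; exact: H.
near=> n.
apply: (@le_trans _ _ (\int[mu]_x (M fv x n `^ p)%:E)%E).
  apply: ge0_le_integral => //.
  - by move=> x _; rewrite lee_fin powR_ge0.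
  - apply/measurable_EFinP/(measurableT_comp (measurable_powR p)).
    exact: (measurable_rmaxfun filF).
  - apply/measurable_EFinP/(measurableT_comp (measurable_powR p)).
    exact: (measurable_rmaxfun filF).
  - move=> x _; rewrite lee_fin le_powR ?rmax_ge ?(ltW p0)//.
    apply: rmax_leP => [|i ni]; first exact: le_trans fv0 (rmax_ge _ _ _).
    by apply: (le_trans (rmax_geS fv (fun i => `|fn i x|) i)); exact: rmax_le.
rewrite (@eq_integral _ _ _ mu setT (fun x => limn (fun k => (Num.min (M fv x n) (fv +
  k%:R) `^ p)%:E))); last first.
  move=> x _; apply/esym/cvg_lim => //; apply: cvg_near_cst.
  near=> k; rewrite min_l//.
  have h : M fv x n - fv <= k%:R by near: k; exact: nbhs_infty_ger.
  by rewrite -lerBlDl.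
have mm k : measurable_fun setT (fun x => (Num.min (M fv x n) (fv + k%:R) `^ p)%:E).
  apply/measurable_EFinP/(measurableT_comp (measurable_powR p)).
  by apply: measurable_minr => //; exact: (measurable_rmaxfun filF).
rewrite monotone_convergence//.
- apply: lime_le.
    apply: ereal_nondecreasing_is_cvgn => i j ij; apply: ge0_le_integral => //.
    + by move=> x _; rewrite lee_fin powR_ge0.
    + move=> x _; rewrite lee_fin le_powR ?(ltW p0)//.
        by rewrite le_min (le_trans fv0) ?rmax_ge// addr_ge0.
      by rewrite le_min !ge_min lexx/= lerD2l ler_nat ij orbT.
  near=> k; apply: truncated_maximal_le => //.
  by rewrite lerDl.
- by move=> k x _; rewrite lee_fin powR_ge0.
- move=> x _ i j ij; rewrite lee_fin le_powR ?(ltW p0)//.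
    by rewrite le_min (le_trans fv0) ?rmax_ge// addr_ge0.
  by rewrite le_min !ge_min lexx/= lerD2l ler_nat ij orbT.
Unshelve. all: by end_near. Qed.

End doob_upper.

(** * Splitting sets along an infinitely refining filtration *)

Section refining.
Context (d : measure_display) (T : measurableType d) (R : realType).
Variables (mu : probability T R) (F : nat -> set (set T)).
Hypothesis filF : filtration F.
Local Notation m A := (fine (mu A)).

Let mF n A : F n A -> measurable A. Proof. exact: filtration_measurable. Qed.

Lemma fine_muE A : measurable A -> ((m A)%:E = mu A)%E.
Proof. by move=> mA; rewrite fineK// fin_num_measure. Qed.

Lemma integral_indic_fine D A : measurable D -> measurable A ->
  (\int[mu]_(x in D) (\1_A x)%:E = (m (A `&` D))%:E)%E.
Proof.
move=> mD mA; rewrite integral_indic//; apply/esym/fine_muE.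
exact: measurableI.
Qed.

Lemma integral_cst_fine D (c : R) : measurable D ->
  (\int[mu]_(x in D) cst c%:E x = (c * m D)%:E)%E.
Proof. by move=> mD; rewrite integral_cst// EFinM fine_muE. Qed.

Lemma fine_mu_setT : m setT = 1.
Proof. by have -> : mu setT = 1%E by exact: probability_setT. Qed.

Lemma fine_mu_setD A B : measurable A -> measurable B -> B `<=` A ->
  m (A `\` B) = m A - m B.
Proof.
move=> mA mB BA; rewrite measureD// ?fin_num_measure//; last first.
  by rewrite -ge0_fin_numE// fin_num_measure.
by rewrite (setIidr BA) fineB// fin_num_measure.
Qed.

Hypothesis irF : inf_refining mu F.

(** [W] is the part of [E] where [h] is 1. Over the part of [E] in [A] the integral of [h] is twice
    the measure of [W] in [A] minus that of [E] in [A]; it is also the integral of [g], whose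
    absolute value integrates over [E] to at most [eta]. So the error is uniform in [A]. *)
Lemma refine_half n E (eta : R) : 0 < eta -> F n E ->
  exists k W, [/\ (n <= k)%N, F k W, W `<=` E &
    forall A, F n A -> `|m (W `&` A) - 2^-1 * m (E `&` A)| <= eta].
Proof.
move=> eta0 FE; have [k [h [nk mh ih habs [g [[mg gh] ig gE]]]]] := irF eta0 FE.
have sF := filtration_sigma filF.
pose W := E `&` [set x | h x = 1].
have FkE : F k E by apply: (filtration_le filF (ltnW nk)).
have FW : F k W.
  apply: (G_setI (sF k)) => //.
  have -> : [set x | h x = 1] = (EFin \o h) @^-1` [set 1%E].
    by apply/seteqP; split => x /= [->].
  exact: mh.
exists k, W; split => //; [exact: ltnW | exact: subIsetl | move=> A FA].
have FB : F n (E `&` A) by exact: (G_setI (sF n)).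
have mB := mF FB; have mW := mF FW; have mE := mF FE; have mA := mF FA.
set B := E `&` A in FB mB *.
have WB : W `&` A = W `&` B.
  by apply/seteqP; split => x; rewrite /W /B /=; tauto.
have intB : (\int[mu]_(x in B) (h x)%:E = (2 * m (W `&` A) - m B)%:E)%E.
  have : (\int[mu]_(x in B) ((h x)%:E + cst 1 x) = \int[mu]_(x in B) (2%:E * (\1_W x)%:E))%E.
    apply: eq_integral => x /[!inE] -[Ex Ax]; rewrite /cst -EFinD -EFinM; congr EFin.
    have := habs x; rewrite !indicE mem_set// mulr1.
    have [xW _|xW] := boolP (x \in W).
      by have /set_mem[_ /= ->] := xW; rewrite mulr1.
    move=> /eqP; rewrite eqr_norml ler01 andbT mulr0 => /orP[/eqP h1|/eqP ->]; last by
      rewrite addNr.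
    by move/negP: xW; case; apply: mem_set; split.
  rewrite integralD//; last 2 first.
  - exact: (integrableS measurableT).
  - apply: (integrableS measurableT) => //; exact: finite_measure_integrable_cst.
  rewrite integral_cst_fine// mul1r ge0_integralZl//; last first.
    by apply/measurable_EFinP; exact: measurable_indic.
  rewrite integral_indic_fine// -WB -EFinM => H.
  by rewrite EFinB -H addeK.
have : (`|(2 * m (W `&` A) - m B)%:E| <= eta%:E)%E.
  rewrite -intB -[X in (`|X| <= _)%E](gh _ FB).
  apply: le_trans (le_abse_integral mu mB _) _.
    by apply: measurable_funTS; exact: measurable_int ig.
  apply: le_trans gE; apply: ge0_subset_integral => //.
  - apply: measurable_funTS; apply/measurable_EFinP/measurableT_comp => //.
    by apply/measurable_EFinP; exact: measurable_int ig.
  - exact: subIsetl.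
rewrite /= lee_fin => H.
have -> : m (W `&` A) - 2^-1 * m B = 2^-1 * (2 * m (W `&` A) - m B) by field.
rewrite normrM gtr0_norm ?invr_gt0//; apply: le_trans H.
by rewrite ler_piMl// invf_le1 ?ler1n.
Qed.

(** The error does not accumulate: halving turns the old [eta] into [eta / 2], and the new split
    adds [eta / 2]. *)
Lemma refine_pow n E (eta : R) i : 0 < eta -> F n E ->
  exists k W, [/\ (n <= k)%N, F k W, W `<=` E &
    forall A, F n A -> `|m (W `&` A) - (2^-1) ^+ i * m (E `&` A)| <= eta].
Proof.
move=> eta0 FE; elim: i => [|i [k [W [nk FW WE WA]]]].
  by exists n, E; split => // A _; rewrite expr0 mul1r subrr normr0 ltW.
have eta20 : 0 < eta / 2 by rewrite divr_gt0.
have [k' [W' [kk' FW' W'W W'A]]] := refine_half eta20 FW.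
exists k', W'; split => //; [exact: leq_trans kk'|exact: subset_trans WE|].
move=> A FA; have := WA _ FA.
have := W'A A (filtration_le filF nk FA); rewrite !ler_norml exprS.
move: (m (W' `&` A)) (m (W `&` A)) (m (E `&` A)) (2^-1 ^+ i) => x y z q.
move=> /andP[h1 h2] /andP[h3 h4]; apply/andP; split; lra.
Qed.

(** The tolerance of each split is [e] times the mass of [E j]. The proportion removed thus stays
    below 1, no link is null, and the chain never stops. *)
Lemma refine_chain (e : R) i : 0 < e -> (2^-1) ^+ i + e < 1 ->
  exists (E W : nat -> set T) (k : nat -> nat), E 0%N = setT /\
  forall j, [/\ F (k j) (E j), measurable (W j), W j `<=` E j,
    E j.+1 = E j `\` W j & 0 < m (E j) /\
    forall A, F (k j) A ->
      `|m (W j `&` A) - (2^-1) ^+ i * m (E j `&` A)| <= e * m (E j)].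
Proof.
move=> e0 se1.
have : forall kE : nat * set T, exists kW : nat * set T,
    F kE.1 kE.2 -> 0 < m kE.2 ->
    [/\ (kE.1 <= kW.1)%N, F kW.1 kW.2, kW.2 `<=` kE.2 &
    forall A, F kE.1 A ->
      `|m (kW.2 `&` A) - (2^-1) ^+ i * m (kE.2 `&` A)| <= e * m kE.2].
  move=> [k E] /=; have [[FE mE0]|nFE] := pselect (F k E /\ 0 < m E); last first.
    by exists (k, E) => ? ?; exfalso; exact: nFE.
  have [k' [W [kk' FW WE WA]]] := refine_pow i (mulr_gt0 e0 mE0) FE.
  by exists (k', W).
move=> /choice[stp stpP].
pose chain := fix chain n : nat * set T := if n is n'.+1 then
  let kE := chain n' in ((stp kE).1, kE.2 `\` (stp kE).2) else (0%N, setT).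
have chainP j : F (chain j).1 (chain j).2 /\ 0 < m (chain j).2.
  elim: j => [|j [FE mE0]] /=.
    by split; [exact: G_setT (filtration_sigma filF 0)|rewrite fine_mu_setT].
  have [kk' FW WE WA] := stpP _ FE mE0; split.
    by apply: (G_setD (filtration_sigma filF _)) => //; exact: (filtration_le filF kk').
  rewrite fine_mu_setD//; [|exact: (mF FE)|exact: (mF FW)].
  have := WA setT (G_setT (filtration_sigma filF _)); rewrite !setIT ler_norml => /andP[_].
  have : 0 < (1 - (2^-1 ^+ i + e)) * m (chain j).2 by rewrite mulr_gt0// subr_gt0.
  move: (m (chain j).2) (m (stp (chain j)).2) (2^-1 ^+ i) => x y q; lra.
exists (fun j => (chain j).2), (fun j => (stp (chain j)).2), (fun j => (chain j).1).
split => // j; have [FE mE0] := chainP j; have [kk' FW WE WA] := stpP _ FE mE0.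
by split => //; exact: (mF FW).
Qed.

(* With [g] the conditional expectation of [\1_W], the integral of [X] over [W]
   is that of [g * f], and [s - g] has a small positive part on [E]. *)
Lemma condexp_split_lower n E W (s eta K : R) (f u X : T -> R) :
  0 <= s -> 0 <= K -> F n E -> measurable W -> W `<=` E ->
  (forall A, F n A -> s * m (E `&` A) <= m (W `&` A) + eta) ->
  measurable_fun setT f -> (forall x, 0 <= u x <= f x) ->
  measurable_fun setT u -> (forall x, u x <= K) -> (forall x, 0 <= X x) ->
  is_condexp mu (F n) (EFin \o f) (EFin \o X) ->
  (s%:E * \int[mu]_(x in E) (u x)%:E <= \int[mu]_(x in W) (X x)%:E + (K * eta)%:E)%E.
Proof.
move=> s0 K0 FE mW WE WA mf uf mu_ uK X0 [mX Xf].
have sF := filtration_sigma filF n.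
have FF : F n `<=` measurable := @filtration_measurable _ _ _ filF n.
have mE := mF FE.
have iW : mu.-integrable setT (EFin \o \1_W).
  apply/integrableP; split; first exact/measurable_EFinP/measurable_indic.
  under eq_integral do rewrite /= ger0_norm//.
  by rewrite integral_indic_fine// ltry.
have W0 x : (0 <= (EFin \o \1_W) x :> \bar R)%E by rewrite lee_fin.
have [g [[mg gW] ig g0]] := condexp_exists sF FF iW W0.
have f0 x : 0 <= f x by have /andP[] := uf x; exact: le_trans.
have u0 x : 0 <= u x by have /andP[] := uf x.
have mXT := G_measurableW FF mX; have mgT := G_measurableW FF mg.
have mX' : measurable_fun setT X by exact/measurable_EFinP.
have mg' : measurable_fun setT g by exact/measurable_EFinP.
(* Pulled out twice: against [X] the indicator of [W] becomes [g], then against [g] the function [X]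
   becomes [f]. *)
have intWX : (\int[mu]_(x in W) (X x)%:E = \int[mu]_x (g x * f x)%:E)%E.
  transitivity (\int[mu]_x ((EFin \o X) x * (EFin \o \1_W) x))%E.
    by rewrite integral_mkcond; apply: eq_integral => x _; rewrite epatch_indic.
  rewrite -(@integral_pullout _ _ _ (F n) sF FF mu (EFin \o g))//.
  - transitivity (\int[mu]_x ((EFin \o g) x * (EFin \o X) x))%E.
      by apply: eq_integral => x _; rewrite muleC.
    apply: (@integral_pullout _ _ _ (F n) sF FF mu (EFin \o X) (EFin \o f)) => //.
    exact/measurable_EFinP.
  - exact/measurable_EFinP/measurable_indic.
pose A := [set x | g x < s].
have FA : F n A.
  have -> : A = (EFin \o g) @^-1` [set y | (y < s%:E)%E].
    by apply/seteqP; split => x /=; rewrite lte_fin.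
  apply: mg; rewrite (_ : [set y | _] = `]-oo, s%:E[%classic).
    exact: emeasurable_itv.
  by apply/seteqP; split => x /=; rewrite in_itv.
have FEA : F n (E `&` A) by exact: (G_setI sF).
have mEA := mF FEA; have mA := mF FA.
have msg : measurable_fun setT (fun x => Num.max (s - g x) 0).
  by apply: measurable_maxr => //; apply: measurable_funB.
(* The positive part of [s - g] lives on [A], a set of [F n], so the hypothesis on [W] tested on [A]
   is exactly the bound. *)
have intA : (\int[mu]_(x in E) (Num.max (s - g x) 0)%:E <= eta%:E)%E.
  have -> : (\int[mu]_(x in E) (Num.max (s - g x) 0)%:E =
      \int[mu]_(x in E `&` A) (s - g x)%:E)%E.
    rewrite [RHS]integral_mkcondr; apply: eq_integral => x _; rewrite patchE.
    case: ifPn => [/set_mem/ltW xA|xA]; first by rewrite max_l ?subr_ge0.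
    rewrite max_r// subr_le0 leNgt; apply/negP => xs; move/negP: xA; apply.
    exact: mem_set.
  have H : (\int[mu]_(x in E `&` A) (s - g x)%:E + \int[mu]_(x in E `&` A) (g x)%:E =
      (s * m (E `&` A))%:E)%E.
    rewrite -ge0_integralD//; last 4 first.
    - by move=> x [_ /ltW xs]; rewrite lee_fin subr_ge0.
    - by apply/measurable_funTS/measurable_EFinP/measurable_funB.
    - by move=> x _; rewrite lee_fin.
    - exact: measurable_funTS.
    rewrite -integral_cst_fine//; apply: eq_integral => x _.
    by rewrite -EFinD subrK.
  have gWA : (\int[mu]_(x in E `&` A) (g x)%:E = (m (W `&` A))%:E)%E.
    rewrite -[LHS]/(\int[mu]_(x in E `&` A) (EFin \o g) x)%E gW// integral_indic_fine//.
    by rewrite setIA (setIidl WE).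
  rewrite gWA in H; rewrite -(@leeD2rE _ (m (W `&` A))%:E)// H -EFinD lee_fin addrC.
  exact: WA.
(* Either [g] is at least [s] and [u <= f] is enough, or the deficit [s - g] is charged to [u],
   which is at most [K]. *)
have Hpt x : s * u x <= g x * f x + K * Num.max (s - g x) 0.
  have [gs|sg] := leP (s - g x) 0.
    rewrite mulr0 addr0; apply: (@le_trans _ _ (g x * u x)).
      by rewrite ler_wpM2r// -subr_le0.
    by rewrite ler_wpM2l//; have /andP[] := uf x.
  apply: (@le_trans _ _ (g x * u x + u x * (s - g x))); first by lra.
  by rewrite lerD// ?ler_wpM2l// ?ler_wpM2r// ?(ltW sg)//; have /andP[] := uf x.
rewrite intWX -ge0_integralZl//; last 2 first.
- by apply/measurable_funTS/measurable_EFinP.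
- by move=> x _; rewrite lee_fin.
apply: (@le_trans _ _ (\int[mu]_(x in E) ((g x * f x)%:E + K%:E * (Num.max (s - g x)
  0)%:E))%E).
  apply: ge0_le_integral => //.
  - by move=> x _; rewrite -EFinM lee_fin mulr_ge0.
  - by apply/measurable_funTS/measurable_EFinP/measurable_funM.
  - apply/measurable_funTS/emeasurable_funD; first exact/measurable_EFinP/measurable_funM.
    by apply: measurable_funeM; exact/measurable_EFinP.
  - by move=> x _; rewrite -!EFinM -EFinD lee_fin.
rewrite ge0_integralD//; last 4 first.
- by move=> x _; rewrite lee_fin mulr_ge0.
- by apply/measurable_funTS/measurable_EFinP/measurable_funM.
- by move=> x _; rewrite mule_ge0 ?lee_fin// le_max lexx orbT.
- by apply/measurable_funTS/measurable_funeM/measurable_EFinP.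
rewrite leeD//.
  apply: ge0_subset_integral => //.
    by apply/measurable_EFinP/measurable_funM.
  by move=> x _; rewrite lee_fin mulr_ge0.
rewrite ge0_integralZl//; last 2 first.
- by apply/measurable_funTS/measurable_EFinP.
- by move=> x _; rewrite lee_fin le_max lexx orbT.
by rewrite EFinM lee_wpmul2l// lee_fin.
Qed.

End refining.

(** * Decreasing chains of sets *)

Lemma continuous_powR (R : realType) (p x : R) : 0 < x ->
  {for x, continuous (fun y : R => y `^ p)}.
Proof.
move=> x0; apply/differentiable_continuous/derivable1_diffP.
by have [] := is_derive1_powR p x0.
Qed.

Section step_functions.
Context (d : measure_display) (T : measurableType d) (R : realType).
Variables (mu : probability T R) (E : nat -> set T).
Hypotheses (mE : forall j, measurable (E j)) (E0 : E 0%N = setT).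
Hypothesis ES : forall j, E j.+1 `<=` E j.
Local Notation m j := (fine (mu (E j))).

(** In a decreasing chain this selects the last of [E 0, ..., E N] that contains [x], so [stepf N v]
    is [v j] on [E j] minus [E j.+1] for [j < N], and [v N] on all of [E N]. *)
Fixpoint level N x : nat :=
  if N is N'.+1 then (if x \in E N then N else level N' x) else 0%N.

Lemma level_in N x : E N x -> level N x = N.
Proof. by case: N => //= N xE; rewrite mem_set. Qed.

Definition stepf N (v : nat -> R) x := v (level N x).

Lemma stepfS N v x :
  stepf N.+1 v x = stepf N v x + (v N.+1 - v N) * \1_(E N.+1) x.
Proof.
rewrite /stepf /= indicE; case: ifPn => [/set_mem xE|_]; last by rewrite mulr0 addr0.
by rewrite (level_in (ES xE)) mulr1 addrCA subrr addr0.
Qed.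

Lemma measurable_stepf N v : measurable_fun setT (stepf N v).
Proof.
elim: N => [|N IH].
  by rewrite (_ : stepf 0 v = cst (v 0%N))//; exact: measurable_cst.
rewrite (_ : stepf N.+1 v = fun x => stepf N v x + (v N.+1 - v N) * \1_(E N.+1) x); last first.
  by apply/funext => x; rewrite stepfS.
by apply: measurable_funD => //; apply: measurable_funM => //; exact: measurable_indic.
Qed.

Lemma chain_sub i j : (i <= j)%N -> E j `<=` E i.
Proof.
move=> ij; rewrite -(subnK ij); elim: (j - i)%N => // k IH.
by rewrite addSn; apply: subset_trans IH; exact: ES.
Qed.

Lemma integral_stepf i N (v : nat -> R) : (i <= N)%N -> (forall j, 0 <= v j) ->
  (\int[mu]_(x in E i) (stepf N v x)%:E =
   (\sum_(i <= j < N) v j * (m j - m j.+1) + v N * m N)%:E)%E.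
Proof.
move=> iN v0; elim: N iN => [|N IH] iN.
  move: iN; rewrite leqn0 => /eqP ->; rewrite big_geq// add0r.
  by rewrite -integral_cst_fine.
have [Ni|{}iN] := ltnP N i.
  have -> : i = N.+1 by apply/eqP; rewrite eqn_leq iN.
  rewrite big_geq// add0r -integral_cst_fine//; apply: eq_integral => x /[!inE] xE.
  by rewrite /stepf level_in.
have ms k : measurable_fun (E i) (EFin \o stepf k v).
  by apply/measurable_funTS/measurable_EFinP/measurable_stepf.
have s0 k x : 0 <= stepf k v x by exact: v0.
have mi c : measurable_fun (E i) (fun x => (c%:E * (\1_(E N.+1) x)%:E)%E : \bar R).
  by apply/measurable_funTS/measurable_funeM/measurable_EFinP/measurable_indic.
(* The jump [v N.+1 - v N] may be negative; adding [v N] times the indicator on both sides keeps all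
   integrands non-negative. *)
have H : (\int[mu]_(x in E i) ((stepf N.+1 v x)%:E + (v N)%:E * (\1_(E N.+1) x)%:E) =
   \int[mu]_(x in E i) ((stepf N v x)%:E + (v N.+1)%:E * (\1_(E N.+1) x)%:E))%E.
  apply: eq_integral => x _; rewrite -!EFinM -!EFinD stepfS; congr EFin; ring.
have intI c : 0 <= c -> (\int[mu]_(x in E i) (c%:E * (\1_(E N.+1) x)%:E) = (c * m N.+1)%:E)%E.
  move=> c0; rewrite ge0_integralZl//; last exact/measurable_EFinP/measurable_indic.
  rewrite integral_indic_fine// EFinM (setIidl _)//.
  by apply: chain_sub; exact: leqW.
move: H; rewrite !ge0_integralD//; do ?[by move=> x _; rewrite ?mule_ge0 ?lee_fin | exact:
  ms | exact: mi].
rewrite !intI// IH// -EFinD => H.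
have := congr1 (fun z => z - (v N * m N.+1)%:E)%E H; rewrite addeK// => ->.
by rewrite big_nat_recr//= -EFinB; congr EFin; ring.
Qed.

End step_functions.

(** The tangent of the [p]-th power at [b], integrated over [W]. A lower bound [b] for the mean
    suffices because the slope is non-negative. *)
Lemma powR_jensen_on (d : measure_display) (T : measurableType d) (R : realType)
    (mu : probability T R) (W : set T) (X : T -> R) (p b : R) : 1 < p -> 0 <= b ->
  measurable W -> measurable_fun setT X -> (forall x, 0 <= X x) ->
  ((b * fine (mu W))%:E <= \int[mu]_(x in W) (X x)%:E)%E ->
  ((b `^ p * fine (mu W))%:E <= \int[mu]_(x in W) (X x `^ p)%:E)%E.
Proof.
move=> p1 b0 mW mX X0 H.
have p0 : 0 < p by exact: lt_trans p1.
have pb0 : 0 <= p * b `^ (p - 1) by rewrite mulr_ge0 ?powR_ge0 ?ltW.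
have p1b : 0 <= (p - 1) * b `^ p by rewrite mulr_ge0 ?powR_ge0// subr_ge0 ltW.
have mXp : measurable_fun W (fun x => (X x `^ p)%:E).
  apply/measurable_funTS/measurable_EFinP.
  exact: (measurableT_comp (measurable_powR p)).
have mXE : measurable_fun W (EFin \o X) by exact/measurable_funTS/measurable_EFinP.
have : (\int[mu]_(x in W) ((p * b `^ (p - 1))%:E * (X x)%:E) <=
    \int[mu]_(x in W) ((X x `^ p)%:E + cst ((p - 1) * b `^ p)%:E x))%E.
  apply: ge0_le_integral => //.
  - by move=> x _; rewrite mule_ge0 ?lee_fin.
  - exact: measurable_funeM.
  - by apply: emeasurable_funD => //; exact: measurable_cst.
  - move=> x _; rewrite /cst -EFinM -EFinD lee_fin.
    by have := powR_young p1 b0 (X0 x); rewrite mulrA mulrAC.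
rewrite ge0_integralZl//; last by move=> x _; rewrite lee_fin.
rewrite ge0_integralD//; last by move=> x _; rewrite lee_fin powR_ge0.
rewrite integral_cst_fine// => H2.
have : ((p * b `^ (p - 1))%:E * (b * fine (mu W))%:E <=
   \int[mu]_(x in W) (X x `^ p)%:E + ((p - 1) * b `^ p * fine (mu W))%:E)%E.
  by apply: le_trans H2; rewrite lee_wpmul2l ?lee_fin.
rewrite -leeBlDr// -EFinM -EFinB.
have -> : p * b `^ (p - 1) * (b * fine (mu W)) = p * b `^ p * fine (mu W).
  by rewrite -(mulr_powRB1 b0 p0); ring.
by have -> : p * b `^ p * fine (mu W) - (p - 1) * b `^ p * fine (mu W) =
  b `^ p * fine (mu W) by ring.
Qed.

(** * Geometric progressions along a chain *)

Section geometric_chain.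
Context (R : realType).
Variables (p a s1 s2 : R) (m : nat -> R).
Hypotheses (p1 : 1 < p) (a0 : 0 < a) (s10 : 0 < s1) (s12 : s1 <= s2) (s21 : s2 < 1).
Hypotheses (as12 : a * s2 <= s1).
Hypotheses (m0 : m 0%N = 1) (mgt0 : forall j, 0 < m j).
Local Notation w j := (m j - m j.+1).
Hypothesis w_ge : forall j, s1 * m j <= w j.
Hypothesis w_le : forall j, w j <= s2 * m j.
(** When [t] shrinks by the factor [1 - s], the mean of [t ^ (- a)] over [[0, t]] grows by
    [(1 - s) ^ (- a)], about [1 + a * s]. Taking the upper bound [s2] of the proportions makes
    [cfac j] at most [1 - a + a * s2], close to the extremal [1 - a]. *)
Let rho := 1 + a * s2.
Let b := rho `^ p - 1.
Hypothesis bs1 : b < s1.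

(* A function equal to [rho ^+ j * cfac j] on [E j `\` E j.+1] has mean
   [rho ^+ j] over [E j]. *)
Definition cfac j := (m j - rho * m j.+1) / w j.

Let s20 : 0 < s2. Proof. exact: lt_le_trans s12. Qed.
Let as20 : 0 < a * s2. Proof. exact: mulr_gt0. Qed.
Lemma chain_w_gt0 j : 0 < w j.
Proof. by apply: lt_le_trans (w_ge j); rewrite mulr_gt0. Qed.

Lemma rho_ge1 : 1 <= rho. Proof. by rewrite lerDl ltW. Qed.
Let rho0 : 0 < rho. Proof. exact: lt_le_trans rho_ge1. Qed.

Lemma cfacE j : cfac j * w j = m j - rho * m j.+1.
Proof. by rewrite divfK// gt_eqF// chain_w_gt0. Qed.

Lemma cfac_ge0 j : 0 <= cfac j.
Proof.
rewrite divr_ge0 ?(ltW (chain_w_gt0 j))// subr_ge0 /rho.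
have := w_ge j; have := mgt0 j; have := mgt0 j.+1; have := w_le j.
have : a * s2 * m j <= s1 * m j by rewrite ler_pM2r.
have : a * s2 * m j.+1 <= a * s2 * m j.
  by rewrite ler_pM2l// -subr_ge0; exact/ltW/chain_w_gt0.
move: (m j) (m j.+1) => x y; lra.
Qed.

Lemma cfac_le1 j : cfac j <= 1.
Proof.
rewrite ler_pdivrMr ?chain_w_gt0// mul1r lerB// ler_peMl ?(ltW (mgt0 _))//.
exact: rho_ge1.
Qed.

Lemma cfac_le j : cfac j <= 1 - a + a * s2.
Proof.
rewrite ler_pdivrMr ?chain_w_gt0// /rho.
have : a * w j <= a * (s2 * m j) by rewrite ler_pM2l.
move: (m j) (m j.+1) => x y; lra.
Qed.

Let beta := rho `^ p.
(** With the value [rho ^ j] on [E j] minus [E j.+1], [Sfac J] is the [p]-th moment outside [E J],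
    while [qfac J] is that of the constant [rho ^ J] on [E J]. The moments of the step function and
    of its maximal function are both estimated through [Sfac]. *)
Definition qfac j := beta ^+ j * m j.
Definition Sfac J := \sum_(0 <= j < J) beta ^+ j * w j.

Let b0 : 0 <= b.
Proof.
have p0 : 0 <= p by rewrite ltW// (lt_trans _ p1).
by rewrite subr_ge0; have := le_powR p0 ler01 rho_ge1; rewrite powR1.
Qed.
Let beta0 : 0 < beta. Proof. exact: powR_gt0. Qed.

Lemma b_ge : a * p * s2 <= b.
Proof.
have := powR_bernoulli p1 (ltW rho0); rewrite -/beta /b -/beta /rho; lra.
Qed.

Lemma Sfac_ge0 J : 0 <= Sfac J.
Proof.
by apply: sumr_ge0 => j _; rewrite mulr_ge0 ?exprn_ge0 ?(ltW beta0)// ltW// chain_w_gt0.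
Qed.

Let q_telescope J : \sum_(0 <= j < J) (qfac j - qfac j.+1) = 1 - qfac J.
Proof.
rewrite (@telescope_sumr_eq _ 0 J (fun j => - qfac j))//; last first.
  by move=> k _; rewrite opprK addrC.
by rewrite opprK addrC /qfac expr0 mul1r m0.
Qed.

(** [Sfac] is compared with the telescoping sum of [qfac j - qfac j.+1], which is
    [beta ^ j * ((1 + b) * w j - b * m j)]. Here [m j] is at most [w j / s1]; for the opposite bound
    [m j] is at least [w j / s2], and [b] at least [a * p * s2]. In the limit both factors of [Sfac]
    become [1 - a * p]. *)
Lemma Sfac_le J : Sfac J * (1 - b / s1) <= 1.
Proof.
apply: (@le_trans _ _ (1 - qfac J)); last first.
  by rewrite gerBl mulr_ge0 ?exprn_ge0 ?(ltW beta0)// ltW.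
rewrite -q_telescope /Sfac mulr_suml; apply: ler_sum => j _.
rewrite /qfac exprS (_ : beta ^+ j * m j - _ = beta ^+ j * ((1 + b) * w j - b * m j)); last
  first.
  by rewrite /b -/beta; ring.
rewrite -mulrA ler_pM2l ?exprn_gt0//.
have : b * m j <= b * (w j / s1) by rewrite ler_wpM2l// ler_pdivlMr// mulrC.
have : 0 <= b * w j by rewrite mulr_ge0// ltW// chain_w_gt0.
move: (w j) => x; lra.
Qed.

Lemma Sfac_ge J : 1 - qfac J <= Sfac J * (1 - a * p * (1 - s2)).
Proof.
rewrite -q_telescope /Sfac mulr_suml; apply: ler_sum => j _.
rewrite /qfac exprS (_ : beta ^+ j * m j - _ = beta ^+ j * ((1 + b) * w j - b * m j)); last
  first.
  by rewrite /b -/beta; ring.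
rewrite -mulrA ler_pM2l ?exprn_gt0//.
have H1 : b * (w j / s2) <= b * m j by rewrite ler_wpM2l// ler_pdivrMr// mulrC.
have H2 : a * p * s2 * (w j * (s2^-1 - 1)) <= b * (w j * (s2^-1 - 1)).
  rewrite ler_wpM2r ?b_ge// mulr_ge0 ?(ltW (chain_w_gt0 j))// subr_ge0.
  by rewrite invf_ge1// ltW.
have H3 : a * p * s2 * (w j * (s2^-1 - 1)) = a * p * (w j * (1 - s2)).
  by field; rewrite gt_eqF.
move: H1 H2; rewrite H3; move: (w j) => x; lra.
Qed.

Let r0 : 0 <= (1 + b) * (1 - s1).
Proof.
apply: mulr_ge0; first exact: addr_ge0.
by rewrite subr_ge0 (le_trans s12)// ltW.
Qed.

Lemma qfac_le j : qfac j <= ((1 + b) * (1 - s1)) ^+ j.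
Proof.
elim: j => [|j IH]; first by rewrite /qfac !expr0 mul1r m0.
rewrite exprS /qfac exprS.
have H : m j.+1 <= (1 - s1) * m j by have := w_ge j; move: (m j) (m j.+1) => x y; lra.
have bE : beta = 1 + b by rewrite /b -/beta; ring.
apply: (@le_trans _ _ ((1 + b) * (1 - s1) * qfac j)); last first.
  by rewrite ler_wpM2l.
rewrite /qfac -bE -!mulrA ler_pM2l// [leRHS]mulrCA ler_pM2l ?exprn_gt0//.
Qed.

(** The ratio [(1 + b) * (1 - s1)] is below 1 because [b < s1], the discrete form of [a * p < 1]. *)
Lemma qfac_cvg0 : qfac j @[j --> \oo] --> 0.
Proof.
apply: (@squeeze_cvgr _ _ _ _ (fun=> 0) (fun j => ((1 + b) * (1 - s1)) ^+ j)).
- near=> j; rewrite qfac_le andbT mulr_ge0 ?exprn_ge0 ?(ltW beta0)//.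
  exact: ltW.
- exact: cvg_cst.
- apply: cvg_expr; rewrite ger0_norm//.
  have : 0 <= b * s1 by rewrite mulr_ge0// ltW.
  by move: bs1; lra.
Unshelve. all: by end_near. Qed.

Lemma chain_cvg0 : m j @[j --> \oo] --> 0.
Proof.
apply: (@squeeze_cvgr _ _ _ _ (fun=> 0) qfac); last exact: qfac_cvg0.
- near=> j; rewrite (ltW (mgt0 j))/= /qfac ler_peMl ?(ltW (mgt0 j))//.
  by rewrite exprn_ege1//; move: b0; rewrite /b -/beta subr_ge0.
- exact: cvg_cst.
Unshelve. all: by end_near. Qed.

End geometric_chain.

(** * The lower bound *)

Lemma powR_expr (R : realType) (x p : R) n : 0 <= x -> (x ^+ n) `^ p = (x `^ p) ^+ n.
Proof.
move=> x0; elim: n => [|n IH]; first by rewrite !expr0 powR1.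
by rewrite !exprS powRM ?exprn_ge0// IH.
Qed.

Section lower_step.
Context (d : measure_display) (T : measurableType d) (R : realType).
Variables (mu : probability T R) (F : nat -> set (set T)).
Hypotheses (filF : filtration F) (irF : inf_refining mu F).
Variables (p a fv Fv s : R).
Hypotheses (p1 : 1 < p) (a0 : 0 < a) (ap : a * p < 1) (fv0 : 0 < fv).
Hypotheses (s0 : 0 < s) (s_half : 2 * s <= 1).
(** Removing the proportion [s] up to a relative error [s ^ 2] means removing a proportion between
    [s1] and [s2]. *)
Let s1 := s * (1 - s).
Let s2 := s * (1 + s).
Let rho := 1 + a * s2.
Let b := rho `^ p - 1.
Hypotheses (as12 : a * s2 <= s1) (bs1 : b < s1).
Hypothesis FvP : fv `^ p * ((1 - a + a * s2) `^ p / (1 - b / s1) + s) <= Fv.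

Let p0 : 0 < p. Proof. exact: lt_trans p1. Qed.
Let s_lt1 : s < 1.
Proof. by move: s0 s_half; lra. Qed.
Let s10 : 0 < s1. Proof. by rewrite mulr_gt0// subr_gt0. Qed.
Let s12 : s1 <= s2. Proof. by rewrite ler_pM2l// lerD2l; move: s0; lra. Qed.
Let s21 : s2 < 1. Proof. by rewrite /s2; move: s0 s_half; nra. Qed.
Let rho1 : 1 <= rho.
Proof. by rewrite lerDl mulr_ge0 ?(ltW a0)// (le_trans (ltW s10)). Qed.
Let rho0 : 0 < rho. Proof. exact: lt_le_trans rho1. Qed.

Section chain.
Variables (J : nat) (E W : nat -> set T) (k : nat -> nat).
(** The error of a split is multiplied by the bound [fv * rho ^ J] of the step function, so
    [rho ^ J] is divided out in advance; [fv * s ^ 2 * (1 - s)] times the mass of [E j] is left. *)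
Let e := s ^+ 2 * (1 - s) / rho ^+ J.
Local Notation m j := (fine (mu (E j))).
Hypothesis qJ : ((1 + b) * (1 - s1)) ^+ J <= s.
Hypothesis E0 : E 0%N = setT.
Hypothesis chainP : forall j, [/\ F (k j) (E j), measurable (W j), W j `<=` E j,
    E j.+1 = E j `\` W j & 0 < m j /\
    forall A, F (k j) A ->
      `|fine (mu (W j `&` A)) - s * fine (mu (E j `&` A))| <= e * m j].

Let mE j : measurable (E j).
Proof. by have [/(filtration_measurable filF)] := chainP j. Qed.
Let mW j : measurable (W j). Proof. by have [] := chainP j. Qed.
Let mgt0 j : 0 < m j. Proof. by have [_ _ _ _ []] := chainP j. Qed.
Let ES j : E j.+1 `<=` E j. Proof. by have [_ _ _ -> _] := chainP j. Qed.
Let m0 : m 0%N = 1. Proof. by rewrite E0 fine_mu_setT. Qed.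
Let wE j : fine (mu (W j)) = m j - m j.+1.
Proof.
have [_ _ WE -> _] := chainP j.
by rewrite fine_mu_setD//; ring.
Qed.
Local Notation w j := (m j - m j.+1).

Let rhoJ0 : 0 < rho ^+ J. Proof. exact: exprn_gt0. Qed.
Let e_le : e <= s ^+ 2.
Proof.
rewrite ler_pdivrMr// ler_wpM2l ?sqr_ge0//.
apply: (@le_trans _ _ 1); first by move: s0; lra.
exact: exprn_ege1.
Qed.

Let w_bound j : `|w j - s * m j| <= e * m j.
Proof.
have [FE _ _ _ [_ /(_ setT)]] := chainP j.
by rewrite !setIT wE; apply; exact: G_setT (filtration_sigma filF _).
Qed.

Let e_m j : e * m j <= s ^+ 2 * m j. Proof. by rewrite ler_pM2r. Qed.

Let w_ge j : s1 * m j <= w j.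
Proof.
move: (w_bound j) (e_m j); rewrite ler_norml => /andP[+ _].
by rewrite /s1; move: (m j) (m j.+1) (e * m j) => x y z; lra.
Qed.

Let w_le j : w j <= s2 * m j.
Proof.
move: (w_bound j) (e_m j); rewrite ler_norml => /andP[_].
by rewrite /s2; move: (m j) (m j.+1) (e * m j) => x y z; lra.
Qed.

Let w_gt0 j : 0 < w j. Proof. by apply: lt_le_trans (w_ge j); rewrite mulr_gt0. Qed.

Let c := cfac a s2 (fun j => m j).
Let c0 j : 0 <= c j. Proof. exact: cfac_ge0 a0 s10 s12 as12 mgt0 w_ge w_le j. Qed.
Let c_le1 j : c j <= 1. Proof. exact: cfac_le1 a0 s10 s12 mgt0 w_ge j. Qed.
Let c_le j : c j <= 1 - a + a * s2. Proof. exact: cfac_le a0 s10 mgt0 w_ge w_le j. Qed.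
Let cE j : c j * w j = m j - rho * m j.+1. Proof. exact: cfacE s10 mgt0 w_ge j. Qed.
Let q := qfac p a s2 (fun j => m j).
Let S := Sfac p a s2 (fun j => m j) J.
Let qJs : q J <= s.
Proof. by apply: le_trans qJ; apply: qfac_le. Qed.
Let S0 : 0 <= S. Proof. exact: Sfac_ge0 a0 s10 s12 mgt0 w_ge J. Qed.
Let S_le : S * (1 - b / s1) <= 1. Proof. exact: Sfac_le p1 a0 s10 s12 m0 mgt0 w_ge J. Qed.
Let S_ge : 1 - q J <= S * (1 - a * p * (1 - s2)).
Proof. exact: Sfac_ge p1 a0 s10 s12 s21 m0 mgt0 w_ge w_le J. Qed.

Let A := fv * rho ^+ J.
Let A0 : 0 < A. Proof. exact: mulr_gt0. Qed.

Let tele_c i : (i <= J)%N ->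
  \sum_(i <= j < J) fv * (rho ^+ j * c j) * w j = fv * rho ^+ i * m i - A * m J.
Proof.
move=> iJ; rewrite (@telescope_sumr_eq _ i J (fun j => - (fv * rho ^+ j * m j)))//.
  by rewrite opprK addrC.
by move=> j _; rewrite -mulrA -(mulrA _ (c j)) cE exprS; ring.
Qed.

Let tele_cst x N : (J <= N)%N -> \sum_(J <= j < N) x * w j = x * (m J - m N).
Proof.
move=> JN; rewrite -mulr_sumr; congr (_ * _).
rewrite (@telescope_sumr_eq _ J N (fun j => - m j))//; first by rewrite opprK addrC.
by move=> j _; rewrite opprK addrC.
Qed.

(** A mass [C] concentrated on [E N] has the [p]-th moment [C ^ p * m N ^ (1 - p)], unbounded as
    [m N] tends to 0 since [p > 1]. Here [C] is the share [s] of the mass on [E J]. *)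
Let small : exists2 N, (J <= N)%N & Fv <= (s * (A * (m J / m N))) `^ p * m N.
Proof.
pose C := s * (A * m J); have C0 : 0 < C by rewrite !mulr_gt0.
have Fv0 : 0 <= Fv.
  apply: le_trans FvP; rewrite mulr_ge0 ?powR_ge0// addr_ge0 ?(ltW s0)//.
  apply: divr_ge0; rewrite ?powR_ge0// subr_ge0 ler_pdivrMr// mul1r.
  exact: ltW.
have p10 : 0 < p - 1 by rewrite subr_gt0.
pose z := (Fv / C) `^ (p - 1)^-1.
have z0 : 0 <= z by exact: powR_ge0.
have z10 : 0 < z + 1 by rewrite ltr_wpDl.
have := chain_cvg0 p1 a0 s10 s12 s21 m0 mgt0 w_ge bs1.
move=> /cvgrPdist_le/(_ (C / (z + 1)) (divr_gt0 C0 z10)) [N1 _ HN].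
exists (maxn J N1); first exact: leq_maxl.
have := HN (maxn J N1) (leq_maxr _ _).
set N := maxn J N1; rewrite /= sub0r normrN gtr0_norm// => mN.
have -> : s * (A * (m J / m N)) = C / m N by rewrite /C; ring.
have y_ge : z <= C / m N.
  rewrite ler_pdivlMr//; apply: (@le_trans _ _ ((z + 1) * m N)).
    by rewrite ler_pM2r// lerDl.
  by rewrite mulrC -ler_pdivlMr.
have y0 : 0 <= C / m N by exact: le_trans y_ge.
rewrite -(mulr_powRB1 y0 p0) mulrAC divfK ?gt_eqF//.
rewrite mulrC -ler_pdivrMr//.
have -> : Fv / C = z `^ (p - 1).
  by rewrite /z -powRrM mulVf ?gt_eqF// powRr1// divr_ge0// ltW.
by rewrite le_powR// ltW.
Qed.

Section values.
Variables (N : nat) (JN : (J <= N)%N).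
Hypothesis FvN : Fv <= (s * (A * (m J / m N))) `^ p * m N.

(* [v0] has the right means; [vt t] moves a proportion [t] of its mass on [E J]
   into the small set [E N], which keeps the mean and raises the [p]-th moment
   continuously to [Fv]. *)
Let v0 j := if (j < J)%N then fv * (rho ^+ j * c j) else A.
Let vt t j := if (j < J)%N then fv * (rho ^+ j * c j) else
  if (j < N)%N then A * (1 - t) else A * (1 - t) + t * (A * (m J / m N)).

Let v_lt_ge0 j : 0 <= fv * (rho ^+ j * c j).
Proof. by rewrite mulr_ge0 ?(ltW fv0)// mulr_ge0// exprn_ge0// ltW. Qed.

Let v_lt_leA j : (j < J)%N -> fv * (rho ^+ j * c j) <= A.
Proof.
move=> jJ; rewrite ler_pM2l//; apply: (@le_trans _ _ (rho ^+ j)).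
  by rewrite ler_piMr// exprn_ge0// ltW.
by rewrite ler_weXn2l// ltnW.
Qed.

Let v0_ge0 j : 0 <= v0 j.
Proof. by rewrite /v0; case: ifP => // _; exact: ltW. Qed.

Let v0_leA j : v0 j <= A.
Proof. by rewrite /v0; case: ifP => // jJ; exact: v_lt_leA. Qed.

Let vt_ge0 t j : 0 <= t <= 1 -> 0 <= vt t j.
Proof.
move=> /andP[t0 t1]; have h : 0 <= A * (1 - t) by rewrite mulr_ge0 ?(ltW A0)// subr_ge0.
rewrite /vt; case: ifP => // _; case: ifP => // _; rewrite addr_ge0// mulr_ge0//.
by rewrite mulr_ge0 ?(ltW A0)// divr_ge0// ltW.
Qed.

(** On [E N] the values [vt t] can be very large, whereas [v0] is bounded by [A]: this is the
    bounded minorant that [condexp_split_lower] asks for. *)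
Let v0_le_vt t j : 0 <= t <= s -> (1 - s) * v0 j <= vt t j.
Proof.
move=> /andP[t0 ts].
have h : (1 - s) * A <= A * (1 - t) by rewrite mulrC ler_pM2l// lerD2l lerN2.
rewrite /vt /v0; case: ifP => _.
  by rewrite ler_piMl// gerBl ltW.
case: ifP => // _; rewrite (le_trans h)// lerDl mulr_ge0// mulr_ge0 ?(ltW A0)//.
by rewrite divr_ge0// ltW.
Qed.

Let sum_split (v : nat -> R) i x y : (i <= J)%N ->
  (forall j, (j < J)%N -> v j = fv * (rho ^+ j * c j)) ->
  (forall j, (J <= j < N)%N -> v j = x) -> v N = y ->
  \sum_(i <= j < N) v j * w j + v N * m N =
  fv * rho ^+ i * m i - A * m J + x * (m J - m N) + y * m N.
Proof.
move=> iJ v1 v2 ->; rewrite (big_cat_nat iJ JN)/=; congr (_ + _ + _).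
  rewrite -tele_c//; apply: eq_big_nat => j /andP[_ jJ]; rewrite v1//.
by rewrite -tele_cst//; apply: eq_big_nat => j jJN; rewrite v2.
Qed.

Let int_v0 i : (i <= J)%N ->
  (\int[mu]_(x in E i) (stepf E N v0 x)%:E = (fv * rho ^+ i * m i)%:E)%E.
Proof.
move=> iJ; rewrite integral_stepf//; last exact: leq_trans JN.
rewrite (@sum_split v0 i A A)//; first by congr EFin; ring.
- by move=> j jJ; rewrite /v0 jJ.
- by move=> j /andP[Jj _]; rewrite /v0 ltnNge Jj.
- by rewrite /v0 ltnNge JN.
Qed.

Let int_vt t : 0 <= t <= 1 -> (\int[mu]_x (stepf E N (vt t) x)%:E = fv%:E)%E.
Proof.
move=> t01; rewrite -E0 integral_stepf//; last by move=> j; exact: vt_ge0.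
rewrite (@sum_split (vt t) 0%N (A * (1 - t)) (A * (1 - t) + t * (A * (m J / m N))))//.
- by rewrite m0 expr0; congr EFin; field; rewrite gt_eqF.
- by move=> j jJ; rewrite /vt jJ.
- by move=> j /andP[Jj jN]; rewrite /vt ltnNge Jj jN.
- by rewrite /vt ltnNge JN ltnn.
Qed.

Let G := \sum_(0 <= j < J) (fv * (rho ^+ j * c j)) `^ p * w j.
Let Psi t := G + (A * (1 - t)) `^ p * (m J - m N) +
  (A * (1 - t) + t * (A * (m J / m N))) `^ p * m N.

Let int_vtp t : 0 <= t <= 1 ->
  (\int[mu]_x ((stepf E N (vt t) x) `^ p)%:E = (Psi t)%:E)%E.
Proof.
move=> t01.
have -> : (\int[mu]_x ((stepf E N (vt t) x) `^ p)%:E =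
  \int[mu]_(x in E 0%N) (stepf E N (fun j => vt t j `^ p) x)%:E)%E by rewrite E0.
rewrite integral_stepf//; last by move=> j; exact: powR_ge0.
rewrite (big_cat_nat (leq0n J) JN)/= /Psi; congr (_ + _ + _)%:E.
- by apply: eq_big_nat => j /andP[_ jJ]; rewrite /vt jJ.
- by rewrite -tele_cst//; apply: eq_big_nat => j /andP[Jj jN]; rewrite /vt ltnNge Jj jN.
- by rewrite /vt ltnNge JN ltnn.
Qed.

Let mJN : m N <= m J.
Proof.
apply: fine_le; rewrite ?fin_num_measure// le_measure ?inE//.
exact: (chain_sub ES JN).
Qed.

(** The sum outside [E J] is bounded through [Sfac_le]; the part on [E J] is [fv ^ p * q J], which
    the extra term [s] in [FvP] pays for. *)
Let Psi0 : Psi 0 <= Fv.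
Proof.
apply: le_trans FvP; rewrite /Psi subr0 mulr1 mul0r addr0 -addrA -mulrDr subrK.
rewrite mulrDr lerD//; last first.
  by rewrite powRM ?exprn_ge0 ?(ltW fv0) ?(ltW rho0)// -mulrA ler_wpM2l ?powR_ge0//
    powR_expr ?(ltW rho0)//; exact: qJs.
apply: (@le_trans _ _ (fv `^ p * ((1 - a + a * s2) `^ p * S))); last first.
  rewrite ler_wpM2l ?powR_ge0// ler_wpM2l ?powR_ge0//.
  by rewrite -[leRHS]mul1r ler_pdivlMr// subr_gt0 ltr_pdivrMr// mul1r.
rewrite /G /S /Sfac mulrA mulr_sumr ler_sum// => j _.
rewrite [leRHS]mulrA ler_pM2r// -/rho.
rewrite powRM; [|exact: ltW|by rewrite mulr_ge0// exprn_ge0// ltW].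
rewrite -mulrA ler_wpM2l ?powR_ge0//.
rewrite powRM ?exprn_ge0 ?(ltW rho0)// powR_expr ?(ltW rho0)// mulrC ler_wpM2r//.
  by rewrite exprn_ge0// powR_ge0.
by rewrite le_powR ?(ltW p0).
Qed.

Let Psis : Fv <= Psi s.
Proof.
apply: (le_trans FvN); rewrite /Psi -[leLHS]add0r lerD//.
  rewrite addr_ge0 ?mulr_ge0 ?powR_ge0 ?subr_ge0//.
  by apply: sumr_ge0 => j _; rewrite mulr_ge0 ?powR_ge0// ltW.
rewrite ler_pM2r// le_powR ?(ltW p0)//.
  by rewrite mulr_ge0 ?(ltW s0)// mulr_ge0 ?(ltW A0)// divr_ge0// ltW.
by rewrite lerDr mulr_ge0 ?(ltW A0)// subr_ge0 ltW.
Qed.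

(** Intermediate values between [Psi0] and [Psis]. With [t] in [[0, s]] the minorant [(1 - s) * v0]
    survives, so reaching the moment [Fv] exactly costs only a factor [1 - s]. *)
Let exists_t : exists2 t, 0 <= t <= s & Psi t = Fv.
Proof.
have cPsi : {within `[0, s], continuous Psi}.
  apply: continuous_in_subspaceT => t; rewrite inE/= in_itv/= => /andP[t0 ts].
  have t1 : 0 < 1 - t by rewrite subr_gt0 (le_lt_trans ts).
  have At : 0 < A * (1 - t) by rewrite mulr_gt0.
  have cl : {for t, continuous (fun t : R => A * (1 - t))}.
    apply: cvgM; first exact: cvg_cst.
    by apply: cvgB; [exact: cvg_cst|exact: cvg_id].
  have c2 : {for t, continuous (fun t : R => A * (1 - t) + t * (A * (m J / m N)))}.
    by apply: cvgD => //; apply: cvgM; [exact: cvg_id|exact: cvg_cst].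
  apply: cvgD; first (apply: cvgD; first exact: cvg_cst).
  - apply: cvgM; last exact: cvg_cst.
    by apply: (@continuous_comp _ _ _ (fun t : R => A * (1 - t)) (fun y => y `^ p)) => //;
      exact: continuous_powR.
  - apply: cvgM; last exact: cvg_cst.
    apply: (@continuous_comp _ _ _ (fun t : R => A * (1 - t) + t * (A * (m J / m N))) (fun
      y => y `^ p)) => //.
    apply: continuous_powR; apply: ltr_pwDl => //.
    by rewrite mulr_ge0// mulr_ge0 ?(ltW A0)// divr_ge0 ?(ltW (mgt0 _)).
have [||t tin <-] := @IVT _ Psi 0 s Fv _ cPsi.
- exact: ltW.
- by rewrite ge_min Psi0 le_max Psis orbT.
- by exists t => //; move: tin; rewrite in_itv.
Qed.

(** On [W j] the term [fn (k j)] has nearly the mean of [f] over [E j]. In the base of the power,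
    [1 - s] is the price of the displaced mass and [1 - 2 * s] that of the splitting errors; the
    numerator [1 - s] comes from stopping the sum at [J]. *)
Lemma lower_values :
  (((fv * ((1 - s) * (1 - 2 * s))) `^ p * ((1 - s) / (1 - a * p * (1 - s2))))%:E
    <= Btilde mu F p Fv fv)%E.
Proof.
have [t ts Ft] := exists_t; have /andP[t0 ts'] := ts.
have t01 : 0 <= t <= 1 by rewrite t0 (le_trans ts')// ltW.
pose f := stepf E N (vt t).
have f0 x : 0 <= f x by exact: vt_ge0.
have mf : measurable_fun setT f by exact: measurable_stepf.
have fi : mu.-integrable setT (EFin \o f).
  apply/integrableP; split; first exact/measurable_EFinP.
  under eq_integral do rewrite /= ger0_norm//.
  by rewrite int_vt// ltry.
have f0E x : (0 <= (EFin \o f) x)%E by rewrite lee_fin.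
have /choice[fn fnP] n := condexp_exists (filtration_sigma filF n)
  (@filtration_measurable _ _ _ filF n) fi f0E.
have fnE : cond_exps mu F f fn by move=> n; have [] := fnP n.
have fn0 n x : 0 <= fn n x by have [_ _] := fnP n; apply.
have mfn n := cond_exps_measurable fnE n.
apply: (@le_trans _ _ (\int[mu]_x (maxfun fn x `^ p))%E); last first.
  by apply: ereal_sup_ubound; exists f, fn; split => //; split => //; rewrite ?int_vtp ?Ft
    ?int_vt.
pose u x := (1 - s) * stepf E N v0 x.
have mu_ : measurable_fun setT u by apply: measurable_funM => //; exact: measurable_stepf.
pose bb j := fv * ((1 - s) * (1 - 2 * s)) * rho ^+ j.
have k0 : 0 <= fv * ((1 - s) * (1 - 2 * s)).
  by rewrite mulr_ge0 ?(ltW fv0)// mulr_ge0 ?subr_ge0// ltW.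
have bb0 j : 0 <= bb j by rewrite mulr_ge0// exprn_ge0// ltW.
have Wj j : (j < J)%N -> ((bb j `^ p * w j)%:E <= \int[mu]_(x in W j) (maxfun fn x `^ p))%E.
  move=> jJ; have [FE _ WE _ [_ WA]] := chainP j.
  have H : (s%:E * \int[mu]_(x in E j) (u x)%:E <=
      \int[mu]_(x in W j) (fn (k j) x)%:E + (A * (e * m j))%:E)%E.
    apply: (@condexp_split_lower _ _ _ mu F filF (k j) (E j) (W j) s (e * m j) A f u (fn (k
      j))) => //.
    - exact: ltW.
    - exact: ltW.
    - move=> B FB; have := WA B FB; rewrite ler_norml => /andP[+ _].
      by rewrite lerNl opprB lerBlDr addrC.
    - move=> x; rewrite mulr_ge0 ?v0_ge0 ?subr_ge0 ?(ltW s_lt1)//=.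
      exact: v0_le_vt.
    - move=> x; apply: le_trans (v0_leA (level E N x)).
      by rewrite ler_piMl ?v0_ge0// gerBl ltW.
    - by have [] := fnE (k j).
  have Hu : (\int[mu]_(x in E j) (u x)%:E = ((1 - s) * (fv * rho ^+ j * m j))%:E)%E.
    rewrite EFinM -int_v0; last exact: ltnW.
    under eq_integral do rewrite EFinM.
    rewrite ge0_integralZl//.
    - by apply/measurable_funTS/measurable_EFinP; exact: measurable_stepf.
    - by move=> x _; rewrite lee_fin; exact: v0_ge0.
    - by rewrite lee_fin subr_ge0 ltW.
  rewrite Hu -EFinM -leeBlDr// -EFinB in H.
  apply: (@le_trans _ _ (\int[mu]_(x in W j) (fn (k j) x `^ p)%:E)%E).
    rewrite -wE; apply: powR_jensen_on => //; apply: le_trans H; rewrite lee_fin wE.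
    have -> : A * (e * m j) = fv * (s ^+ 2 * (1 - s)) * m j.
      by rewrite /A /e; field; rewrite gt_eqF.
    have r1 : 1 <= rho ^+ j by exact: exprn_ege1.
    have h0 : 0 <= fv * (1 - s) * m j by rewrite !mulr_ge0 ?subr_ge0 ?ltW.
    apply: (@le_trans _ _ (bb j * (s2 * m j))); first by rewrite ler_wpM2l.
    rewrite /bb /s2 [leLHS](_ : _ = fv * (1 - s) * m j * (s * rho ^+ j * ((1 - 2 * s) * (1
      + s)))); last by ring.
    rewrite [leRHS](_ : _ = fv * (1 - s) * m j * (s * (rho ^+ j - s))); last by ring.
    rewrite ler_wpM2l// -mulrA ler_pM2l//.
    move: (rho ^+ j) r1 => r r1; move: s0; nra.
  apply: ge0_le_integral => //.
  - by move=> x _; rewrite lee_fin powR_ge0.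
  - by apply/measurable_funTS/measurable_EFinP/(measurableT_comp (measurable_powR p)).
  - by apply/measurable_funTS; exact: measurable_maxfun_pow.
  - move=> x _; rewrite -poweR_EFin le_poweR ?(ltW p0) ?lee_fin//.
    by apply: ereal_sup_ubound; exists (k j) => //; rewrite ger0_norm.
apply: (@le_trans _ _ (\sum_(0 <= j < J) \int[mu]_(x in W j) (maxfun fn x `^ p))%E); last
  first.
  rewrite -ge0_integral_bigsetU//; last 4 first.
  - exact: iota_uniq.
  - apply: sub_trivIset (@subsetT _ _) _; apply/trivIsetP => i j _ _; wlog ij : i j / (i <
    j)%N.
      move=> H; rewrite neq_ltn => /orP[ij|ji]; first by apply: H => //; rewrite ltn_eqF.
      by rewrite setIC; apply: H => //; rewrite ltn_eqF.
    move=> _; apply/seteqP; split => x // [Wi Wjx].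
    have [_ _ WEj _ _] := chainP j; have [_ _ _ Ei _] := chainP i.
    by have := chain_sub ES ij (WEj _ Wjx); rewrite Ei => -[].
  - by apply/measurable_funTS; exact: measurable_maxfun_pow.
  - by move=> x _; rewrite poweR_ge0.
  apply: ge0_subset_integral => //.
  - by apply: bigsetU_measurable => j _.
  - by exact: measurable_maxfun_pow.
  - by move=> x _; rewrite poweR_ge0.
apply: (@le_trans _ _ (\sum_(0 <= j < J) (bb j `^ p * w j)%:E)%E); last first.
  by rewrite !big_mkord; apply: lee_sum => j _; exact: Wj.
rewrite sumEFin lee_fin.
have -> : \sum_(0 <= j < J) bb j `^ p * w j = (fv * ((1 - s) * (1 - 2 * s))) `^ p * S.
  rewrite /S /Sfac mulr_sumr; apply: eq_bigr => j _.
  by rewrite [RHS]mulrA -/rho /bb powRM ?exprn_ge0 ?(ltW rho0)// powR_expr ?(ltW rho0).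
rewrite ler_wpM2l ?powR_ge0// ler_pdivrMr; last first.
  rewrite subr_gt0; apply: le_lt_trans ap; rewrite ler_piMr ?mulr_ge0 ?ltW//.
  by rewrite gtrBl (lt_le_trans s10).
by apply: le_trans S_ge; rewrite lerD2l lerN2.
Qed.

End values.

Lemma lower_chain :
  (((fv * ((1 - s) * (1 - 2 * s))) `^ p * ((1 - s) / (1 - a * p * (1 - s2))))%:E
    <= Btilde mu F p Fv fv)%E.
Proof. by have [N JN FvN] := small; exact: lower_values JN FvN. Qed.

End chain.

(** The order of the choices matters: [J] makes the moment left on [E J] small, the tolerance
    depends on [J], the chain on the tolerance, and [N] on the chain. [s] is a power of one half
    because sets are split by halving. *)
Lemma Btilde_lower_step i : s = 2^-1 ^+ i ->
  (((fv * ((1 - s) * (1 - 2 * s))) `^ p * ((1 - s) / (1 - a * p * (1 - s2))))%:E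
    <= Btilde mu F p Fv fv)%E.
Proof.
move=> sE.
have b0 : 0 <= b.
  by rewrite subr_ge0; have := le_powR (ltW p0) ler01 rho1; rewrite powR1.
have r0 : 0 <= (1 + b) * (1 - s1).
  apply: mulr_ge0; first exact: addr_ge0.
  by rewrite subr_ge0 (le_trans s12)// ltW.
have r1 : `|(1 + b) * (1 - s1)| < 1.
  rewrite ger0_norm//; have : 0 <= b * s1 by rewrite mulr_ge0// ltW.
  by move: bs1; lra.
have /cvgrPdist_le/(_ s s0) [J _ /(_ J (leqnn J))] := cvg_expr r1.
rewrite /= sub0r normrN ger0_norm ?exprn_ge0// => qJ.
have e0 : 0 < s ^+ 2 * (1 - s) / rho ^+ J.
  by rewrite divr_gt0 ?exprn_gt0// mulr_gt0 ?subr_gt0// exprn_gt0.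
have [|E [W [k [E0 H]]]] := @refine_chain _ _ _ mu F filF irF _ i e0.
  rewrite -sE; apply: le_lt_trans s21; rewrite /s2 [leRHS](_ : _ = s + s ^+ 2); last by ring.
  rewrite lerD2l.
  rewrite ler_pdivrMr ?exprn_gt0// ler_wpM2l ?sqr_ge0//.
  apply: (@le_trans _ _ 1); first by move: s0; lra.
  exact: exprn_ege1.
rewrite -sE in H.
exact: (lower_chain qJ E0 H).
Qed.

End lower_step.

(** * The common value *)

Lemma cvg_half_expr (R : realType) : (2^-1 : R) ^+ i @[i --> \oo] --> (0 : R).
Proof.
apply: cvg_expr; rewrite ger0_norm ?invr_ge0// invf_lt1// ltr1n//.
Qed.

Lemma cvg_seq_EFin (R : realType) (u : nat -> R) (l : R) :
  u i @[i --> \oo] --> l -> (u i)%:E @[i --> \oo] --> l%:E.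
Proof. by move=> ul; apply/fine_cvgP; split; [exact: nearW|exact: ul]. Qed.

Lemma powR_le1 (R : realType) (p x : R) : 0 <= p -> 0 <= x -> x <= 1 -> x `^ p <= 1.
Proof. by move=> p0 x0 x1; have := le_powR p0 x0 x1; rewrite powR1. Qed.

(** Bernoulli's inequality bounds [1 - x * p] by [(1 - x) ^ p], and [(1 + x) * (1 - x) <= 1]. *)
Lemma powR_increment_le (R : realType) (p x : R) : 1 < p -> 0 <= x -> x * p < 1 ->
  ((1 + x) `^ p - 1) * (1 - x * p) <= x * p.
Proof.
move=> p1 x0 xp1; have x1 : x < 1 by nra.
have p0 : 0 < p by exact: lt_trans p1.
have h : (1 + x) `^ p * (1 - x * p) <= 1.
  apply: (@le_trans _ _ ((1 + x) `^ p * (1 - x) `^ p)).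
    rewrite ler_wpM2l ?powR_ge0//.
    have := @powR_bernoulli _ p (1 - x) p1; rewrite subr_ge0 => /(_ (ltW x1)); lra.
  rewrite -powRM ?subr_ge0 ?(ltW x1) ?addr_ge0//.
  rewrite powR_le1 ?(ltW p0)//; last nra.
  by rewrite mulr_ge0 ?subr_ge0 ?(ltW x1)// addr_ge0.
by lra.
Qed.

(** The strict inequality on [Fv] is the room that the approximations use up: the moment bound [Q i]
    falls below [Fv] for large [i], while the value [V i] reached tends to the claimed one. *)
Lemma Btilde_lower (R : realType) (d : measure_display) (T : measurableType d)
    (mu : probability T R) (F : nat -> set (set T)) (p a fv Fv : R) :
  filtration F -> inf_refining mu F -> 1 < p -> 0 < a -> a * p < 1 -> 0 < fv ->
  fv `^ p * ((1 - a) `^ p / (1 - a * p)) < Fv ->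
  ((fv `^ p / (1 - a * p))%:E <= Btilde mu F p Fv fv)%E.
Proof.
move=> filF irF p1 a0 ap fv0 FvP.
have p0 : 0 < p by exact: lt_trans p1.
have a1 : a < 1 by nra.
pose s i : R := 2^-1 ^+ i.
have s0 i : 0 < s i by rewrite exprn_gt0// invr_gt0.
have cs : s i @[i --> \oo] --> (0 : R) by exact: cvg_half_expr.
have cc (x : R) : (fun _ : nat => x) i @[i --> \oo] --> x by exact: cvg_cst.
have cpow (u : nat -> R) (l : R) : 0 < l -> u i @[i --> \oo] --> l ->
    u i `^ p @[i --> \oo] --> l `^ p.
  move=> l0 cu; apply: (@cvg_comp _ _ _ u (fun y => y `^ p) _ _ _ cu).
  exact: (@continuous_powR _ p l l0).
pose s2 i := s i * (1 + s i).
have cs2 : s2 i @[i --> \oo] --> (0 : R).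
  by rewrite -[X in _ --> X](mul0r (1 + 0)); apply: cvgM => //; exact: cvgD.
(* A rational bound for [b / s1], with limit [a * p]: [powR_increment_le] at [a * s2 i], divided by
   [s i * (1 - s i)]. *)
pose g i := a * p * (1 + s i) / ((1 - a * s2 i * p) * (1 - s i)).
have cg : g i @[i --> \oo] --> a * p.
  have gE : a * p * ((1 + 0) / ((1 - a * 0 * p) * (1 - 0))) = a * p.
    by rewrite !(mulr0, mul0r, subr0, addr0, mulr1) divr1 mulr1.
  rewrite -[X in _ --> X]gE.
  under eq_fun do rewrite /g -mulrA.
  apply: cvgM => //; apply: cvgM; first exact: cvgD.
  apply: cvgV; first by rewrite !(mulr0, mul0r, subr0, mulr1) oner_neq0.
  apply: cvgM; last exact: cvgB.
  by apply: cvgB => //; apply: cvgM => //; exact: cvgM.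
pose Q i := fv `^ p * ((1 - a + a * s2 i) `^ p / (1 - g i) + s i).
have cQ : Q i @[i --> \oo] --> fv `^ p * ((1 - a) `^ p / (1 - a * p)).
  apply: cvgM => //; rewrite -[X in _ --> X]addr0; apply: cvgD => //; apply: cvgM.
    apply: cpow; first by rewrite subr_gt0.
    have aE : 1 - a + a * 0 = 1 - a by rewrite mulr0 addr0.
    by rewrite -[X in _ --> X]aE; apply: cvgD => //; exact: cvgM.
  by apply: cvgV; [rewrite gt_eqF// subr_gt0|exact: cvgB].
pose V i := (fv * ((1 - s i) * (1 - 2 * s i))) `^ p * ((1 - s i) / (1 - a * p * (1 - s2 i))).
have cV : V i @[i --> \oo] --> fv `^ p / (1 - a * p).
  have -> : fv `^ p / (1 - a * p) =
      (fv * ((1 - 0) * (1 - 2 * 0))) `^ p * ((1 - 0) / (1 - a * p * (1 - 0))).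
    by rewrite !(mulr0, subr0, mulr1) mul1r.
  apply: cvgM.
    apply: cpow; first by rewrite !(mulr0, subr0, mulr1).
    by apply: cvgM => //; apply: cvgM; apply: cvgB => //; exact: cvgM.
  apply: cvgM; first exact: cvgB.
  apply: cvgV; first by rewrite subr0 mulr1 gt_eqF// subr_gt0.
  by apply: cvgB => //; apply: cvgM => //; exact: cvgB.
have cVE : (V i)%:E @[i --> \oo] --> (fv `^ p / (1 - a * p))%:E.
  exact: cvg_seq_EFin.
rewrite -(cvg_lim _ cVE)//; apply: lime_le; first by apply/cvg_ex; eexists; exact: cVE.
near=> i.
have h1 : s i <= 2^-1.
  by near: i; apply: (cvgr_le _ cs); rewrite invr_gt0.
have h2 : a * (1 + s i) <= 1 - s i.
  have h : s i <= (1 - a) / 2.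
    by near: i; apply: (cvgr_le _ cs); rewrite divr_gt0// subr_gt0.
  have := s0 i; nra.
have h3 : a * s2 i * p < 1.
  have h : s2 i < (a * p)^-1.
    by near: i; apply: (cvgr_lt _ cs2); rewrite invr_gt0 mulr_gt0.
  by rewrite mulrAC -ltr_pdivlMl ?mulr_gt0// mulr1.
have h4 : g i < 1 by near: i; exact: (cvgr_lt _ cg).
have h5 : Q i <= Fv by near: i; exact: (cvgr_le _ cQ).
have si := s0 i.
have s20 : 0 < s2 i by rewrite mulr_gt0// addr_gt0.
have s10 : 0 < s i * (1 - s i) by rewrite mulr_gt0// subr_gt0 (le_lt_trans h1)// invf_lt1//
  ltr1n.
have bg : ((1 + a * s2 i) `^ p - 1) / (s i * (1 - s i)) <= g i.
  have H := powR_increment_le p1 (ltW (mulr_gt0 a0 s20)) h3.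
  rewrite -ler_pdivlMr ?subr_gt0// in H.
  rewrite ler_pdivrMr//; apply: (le_trans H).
  rewrite /g /s2 [leRHS](_ : _ = a * (s i * (1 + s i)) * p / (1 - a * (s i * (1 + s i)) *
    p))//.
  field; rewrite -/(s2 i) !gt_eqF ?subr_gt0// (le_lt_trans h1)// invf_lt1// ltr1n//.
apply: (@Btilde_lower_step _ _ _ mu F filF irF p a fv Fv (s i) p1 a0 ap fv0 si _ _ _ _ i)
  => //.
- by move: h1; rewrite -ler_pdivlMl// mulr1.
- by rewrite mulrCA ler_pM2l.
- by rewrite -[ltRHS]mul1r -ltr_pdivrMr//; exact: le_lt_trans h4.
- apply: le_trans h5; rewrite /Q ler_wpM2l ?powR_ge0// lerD2r ler_wpM2l ?powR_ge0//.
  by rewrite lef_pV2 ?posrE ?subr_gt0 ?(le_lt_trans bg)// lerD2l lerN2.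
Unshelve. all: by end_near. Qed.

Lemma Btilde_const_ge (R : realType) (d : measure_display) (T : measurableType d)
    (mu : probability T R) (F : nat -> set (set T)) (p fv : R) :
  filtration F -> 0 <= fv -> 0 < p ->
  ((fv `^ p)%:E <= Btilde mu F p (fv `^ p) fv)%E.
Proof.
move=> filF fv0 p0; apply: ereal_sup_ubound.
exists (cst fv), (fun _ => cst fv); split => //.
- by split => //; rewrite -[RHS](integral_cst_prob mu).
- move=> n; split; last exact: finite_measure_integrable_cst.
  split => //; apply/(G_measurable_EFinP (filtration_sigma filF n)).
  exact: measurable_cst.
- rewrite -[LHS](integral_cst_prob mu); apply: eq_integral => x _.
  rewrite /maxfun (_ : range _ = [set fv%:E]) ?ereal_sup1//.
  by apply/seteqP; split => [_ [n _ <-]|_ ->]; [rewrite /= ger0_norm|exists 0%N => //=;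
    rewrite ger0_norm].
Qed.

Lemma Btilde_upper (R : realType) (d : measure_display) (T : measurableType d)
    (mu : probability T R) (F : nat -> set (set T)) (p a fv Fv : R) :
  filtration F -> 1 < p -> 0 < a -> a * p < 1 -> 0 <= fv ->
  Fv <= fv `^ p * ((1 - a) `^ p / (1 - a * p)) ->
  (Btilde mu F p Fv fv <= (fv `^ p / (1 - a * p))%:E)%E.
Proof.
move=> filF p1 a0 ap fv0 FvP.
apply: ub_ereal_sup => _ [f [fn [[mf f0 fF fE] fnE ->]]].
exact: (maximal_upper filF mf f0 fnE p1 fv0 fF fE a0 ap FvP).
Qed.

(** Bernoulli's inequality at [y = (1 - a) / (1 - a')]. Once the denominators are cleared, the gap
    [p * (p - 1) * a' * z] remains, with [z = 1 - y]. *)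
Lemma extremal_ratio_lt (R : realType) (p a' a : R) : 1 < p -> 0 < a' -> a' < a -> a * p < 1 ->
  (1 - a') `^ p / (1 - a' * p) < (1 - a) `^ p / (1 - a * p).
Proof.
move=> p1 a'0 a'a ap.
have a0 : 0 < a by exact: lt_trans a'a.
have a1 : a < 1 by nra.
have a'1 : a' < 1 by exact: lt_trans a1.
have a'p : a' * p < 1 by apply: lt_trans ap; rewrite ltr_pM2r// (lt_trans _ p1).
rewrite ltr_pdivrMr ?subr_gt0// mulrAC ltr_pdivlMr ?subr_gt0//.
pose y := (1 - a) / (1 - a').
have y0 : 0 <= y by rewrite divr_ge0// subr_ge0 ltW.
have yE : 1 - a = (1 - a') * y by rewrite mulrC divfK// gt_eqF// subr_gt0.
rewrite yE powRM ?subr_ge0 ?(ltW a'1)// -mulrA ltr_pM2l ?powR_gt0 ?subr_gt0//.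
have := powR_bernoulli p1 y0.
have -> : y - 1 = - ((a - a') / (1 - a')) by rewrite /y; field; rewrite gt_eqF// subr_gt0.
set z := (a - a') / (1 - a') => H.
have z0 : 0 < z by rewrite divr_gt0// subr_gt0.
have zE : z * (1 - a') = a - a' by rewrite divfK// gt_eqF// subr_gt0.
apply: (@lt_le_trans _ _ ((1 + p * - z) * (1 - a' * p))); last by rewrite ler_wpM2r//
  subr_ge0 ltW.
have p0 : 0 < p by exact: lt_trans p1.
have pp : 0 < p - 1 by rewrite subr_gt0.
have := mulr_gt0 (mulr_gt0 p0 pp) (mulr_gt0 a'0 z0).
have -> : a = a' + z * (1 - a') by rewrite zE; ring.
lra.
Qed.

Lemma extremal_ratio_surj (R : realType) (p t : R) : 1 < p -> 1 < t ->
  exists a, [/\ 0 < a, a * p < 1 & (1 - a) `^ p / (1 - a * p) = t].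
Proof.
move=> p1 t1; have p0 : 0 < p by exact: lt_trans p1.
have pV : p^-1 < 1 by rewrite invf_lt1.
pose kp := (1 - p^-1) `^ p.
have kp0 : 0 < kp by rewrite powR_gt0// subr_gt0.
have kp1 : kp <= 1.
  rewrite powR_le1 ?(ltW p0) ?subr_ge0 ?(ltW pV)//.
  by rewrite gerBl invr_ge0 ltW.
(* The value of [1 - a * p] at the right end [a1]. The numerator stays above [kp], so the ratio
   there is at least [t + 1]. *)
pose dl := kp / (t + 1).
have t10 : 0 < t + 1 by lra.
have dl0 : 0 < dl by rewrite divr_gt0.
have dl1 : dl < 1 by rewrite ltr_pdivrMr// mul1r; lra.
pose a1 := (1 - dl) / p.
have a10 : 0 < a1 by rewrite divr_gt0// subr_gt0.
have a1p : a1 * p = 1 - dl by rewrite divfK// gt_eqF.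
pose phi (a : R) := (1 - a) `^ p / (1 - a * p).
have cphi : {within `[0, a1], continuous phi}.
  apply: continuous_in_subspaceT => a; rewrite inE/= in_itv/= => /andP[a0 aa1].
  have ap : a * p < 1.
    by apply: (@le_lt_trans _ _ (a1 * p)); [rewrite ler_pM2r|rewrite a1p; lra].
  have a_lt1 : a < 1 by nra.
  apply: cvgM.
    apply: (@continuous_comp _ _ _ (fun a : R => 1 - a) (fun y => y `^ p)).
      by apply: cvgB; [exact: cvg_cst|exact: cvg_id].
    by apply: continuous_powR; rewrite subr_gt0.
  apply: cvgV; first by rewrite gt_eqF// subr_gt0.
  by apply: cvgB; [exact: cvg_cst|apply: cvgM; [exact: cvg_id|exact: cvg_cst]].
have phi0 : phi 0 = 1 by rewrite /phi subr0 mul0r subr0 powR1 divr1.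
have phi1 : t <= phi a1.
  rewrite /phi a1p (_ : 1 - (1 - dl) = dl) ?ler_pdivlMr//; last by ring.
  apply: (@le_trans _ _ kp).
    by rewrite /dl mulrCA ler_piMr ?(ltW kp0)// ler_pdivrMr// mul1r; lra.
  rewrite le_powR ?(ltW p0) ?subr_ge0 ?(ltW pV)// lerD2l lerN2 /a1 ler_pdivrMr// mulVf
    ?gt_eqF//.
  by lra.
have [||a ain aE] := @IVT _ phi 0 a1 t _ cphi.
- exact: ltW.
- by rewrite ge_min phi0 (ltW t1) le_max phi1 orbT.
move: ain; rewrite in_itv/= => /andP[a0 aa1].
exists a; split => //.
- rewrite lt_neqAle a0 andbT; apply/negP => /eqP a00.
  by move: t1; rewrite -aE -a00 phi0 ltxx.
- by apply: (@le_lt_trans _ _ (a1 * p)); [rewrite ler_pM2r|rewrite a1p; lra].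
Qed.

(** The explicit value separates the two sides. Allowing two unrelated spaces is what later gives
    the comparison with the dyadic filtration in both directions. *)
Lemma Btilde_le (R : realType) (d1 d2 : measure_display) (T1 : measurableType d1)
    (T2 : measurableType d2) (mu1 : probability T1 R) (mu2 : probability T2 R)
    (F1 : nat -> set (set T1)) (F2 : nat -> set (set T2)) (p fv Fv : R) :
  1 < p -> filtration F1 -> filtration F2 -> inf_refining mu2 F2 ->
  0 <= fv -> fv `^ p <= Fv ->
  (Btilde mu1 F1 p Fv fv <= Btilde mu2 F2 p Fv fv)%E.
Proof.
move=> p1 filF1 filF2 irF2 fv0 FvP; have p0 : 0 < p by exact: lt_trans p1.
have cc (x : R) : (fun _ : nat => x) i @[i --> \oo] --> x by exact: cvg_cst.
have cs := @cvg_half_expr R.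
have sle i : (2^-1 : R) ^+ i <= 1 by rewrite exprn_ile1 ?invr_ge0// invf_le1// ler1n.
(* [Fv = fv ^ p] corresponds to [a = 0]: the upper bound is used with [a] tending to 0, and the
   constant function reaches the limit. *)
move: FvP; rewrite le_eqVlt => /predU1P[<-|FvP].
  apply: le_trans (Btilde_const_ge mu2 filF2 fv0 p0).
  pose a i : R := (2 * p)^-1 * 2^-1 ^+ i.
  have a0 i : 0 < a i by rewrite mulr_gt0 ?invr_gt0 ?mulr_gt0// exprn_gt0// invr_gt0.
  have ap i : a i * p < 1.
    rewrite /a (_ : _ * p = 2^-1 * 2^-1 ^+ i); last first.
      by move: (2^-1 ^+ i) => x; field; rewrite gt_eqF.
    apply: (@le_lt_trans _ _ 2^-1); last by rewrite invf_lt1// ltr1n.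
    by rewrite ler_piMr ?invr_ge0.
  have ca : (fv `^ p / (1 - a i * p))%:E @[i --> \oo] --> (fv `^ p)%:E.
    apply: cvg_seq_EFin.
    have fE : fv `^ p / (1 - (2 * p)^-1 * 0 * p) = fv `^ p.
      by rewrite mulr0 mul0r subr0 divr1.
    rewrite -[X in _ --> X]fE.
    apply: cvgM => //; apply: cvgV; first by rewrite mulr0 mul0r subr0 oner_neq0.
    by apply: cvgB => //; apply: cvgM => //; exact: cvgM.
  rewrite -(cvg_lim _ ca)//; apply: lime_ge; first by apply/cvg_ex; eexists; exact: ca.
  near=> i; apply: Btilde_upper => //; rewrite ler_peMr ?powR_ge0//.
  rewrite ler_pdivlMr ?subr_gt0// mul1r.
  have a1 : a i <= 1 by have := a0 i; have := ap i; nra.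
  by have := @powR_bernoulli _ p (1 - a i) p1; rewrite subr_ge0 => /(_ a1); lra.
(* With mean 0, [f] vanishes almost everywhere, against [0 < Fv]: no function is admissible, and the
   left side is the supremum of the empty set. *)
have [fv_eq0|fv_neq0] := eqVneq fv 0.
  apply: ub_ereal_sup => _ [f [fn [[mf f0 fF fE] fnE ->]]]; exfalso.
  have mfE : measurable_fun setT (EFin \o f) by exact/measurable_EFinP.
  have : (\int[mu1]_x `|(f x)%:E| = 0)%E.
    by rewrite -[RHS]/0%:E -fv_eq0 -fE; apply: eq_integral => x _; rewrite /= ger0_norm.
  move=> /(ae_eq_integral_abs mu1 measurableT mfE) fae.
  have : (\int[mu1]_x ((f x) `^ p)%:E = \int[mu1]_x (cst 0 x))%E.
    apply: ge0_ae_eq_integral => //.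
    - by apply/measurable_EFinP; exact: (measurableT_comp (measurable_powR p)).
    - by move=> x _; rewrite lee_fin powR_ge0.
    - by apply: filterS fae => x /(_ Logic.I) [] fx0 _; rewrite fx0 powR0// gt_eqF.
  rewrite fF integral0 => -[] Fv0; move: FvP.
  by rewrite Fv0 fv_eq0 powR0 ?gt_eqF// ltxx.
have fvp : 0 < fv by rewrite lt_neqAle eq_sym fv_neq0.
have fvp0 : 0 < fv `^ p by exact: powR_gt0.
have t1 : 1 < Fv / fv `^ p by rewrite ltr_pdivlMr// mul1r.
have [a [a0 ap aE]] := extremal_ratio_surj p1 t1.
have FvE : Fv = fv `^ p * ((1 - a) `^ p / (1 - a * p)).
  by rewrite aE mulrC divfK// gt_eqF.
apply: (@le_trans _ _ (fv `^ p / (1 - a * p))%:E).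
  by apply: Btilde_upper => //; rewrite -FvE.
(* The lower bound asks for strict room, so it is applied at parameters increasing to [a]. *)
pose a' i := a * (1 - 2^-1 ^+ i.+1).
have half_lt1 i : (2^-1 : R) ^+ i.+1 < 1.
  by rewrite exprn_ilt1 ?invr_ge0// invf_lt1// ltr1n.
have a'0 i : 0 < a' i by rewrite mulr_gt0// subr_gt0.
have a'a i : a' i < a by rewrite gtr_pMr// gtrBl exprn_gt0// invr_gt0.
have a'p i : a' i * p < 1 by apply: lt_trans ap; rewrite ltr_pM2r.
have ca : (fv `^ p / (1 - a' i * p))%:E @[i --> \oo] --> (fv `^ p / (1 - a * p))%:E.
  apply: cvg_seq_EFin.
  have aE' : fv `^ p / (1 - a * (1 - 0) * p) = fv `^ p / (1 - a * p) by rewrite subr0 mulr1.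
  rewrite -[X in _ --> X]aE'.
  apply: cvgM => //; apply: cvgV; first by rewrite subr0 mulr1 gt_eqF// subr_gt0.
  apply: cvgB => //; apply: cvgM => //; apply: cvgM => //; apply: cvgB => //.
  by rewrite -(cvg_shiftS (fun i => (2^-1 : R) ^+ i)) in cs.
rewrite -(cvg_lim _ ca)//; apply: lime_le; first by apply/cvg_ex; eexists; exact: ca.
near=> i; apply: Btilde_lower => //.
by rewrite FvE ltr_pM2l//; exact: extremal_ratio_lt.
Unshelve. all: by end_near. Qed.

(** * The dyadic filtration *)

Section dyadic_filtration.
Context (R : realType).
Local Notation RT := (measurableTypeR R).
Local Notation leb := (@lebesgue_measure R).
Let mu0 : probability RT R := uniform_prob (@ltr01 R).
Let D : set RT := dyad 0 0.

(* Negative reals are put into cell 0, which is harmless because the uniform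
   probability is carried by [[0, 1]]. *)
Definition dcell (m : nat) (x : R) : nat := Num.truncn (2 ^+ m * Num.max x 0).

(** As [dcell m] takes countably many values, preimages of arbitrary sets of integers are measurable
    and form a sigma-algebra. Cells beyond [[0, 1[] are null. *)
Definition dyadic_filtration (m : nat) : set (set RT) :=
  [set A | exists B : set nat, A = dcell m @^-1` B].

Let arg_ge0 m x : 0 <= 2 ^+ m * Num.max x 0 :> R.
Proof. by rewrite mulr_ge0 ?exprn_ge0// le_max lexx orbT. Qed.

Let dyadE0 : D = `[0, 1[%classic.
Proof.
apply/seteqP; split => x; rewrite /D /dyad /= in_itv/= expr0 !divr1//.
Qed.

Lemma dcellS m x : dcell m x = (dcell m.+1 x %/ 2)%N.
Proof.
rewrite /dcell exprS -mulrA; set y := 2 ^+ m * _.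
have y0 : 0 <= y by exact: arg_ge0.
have y20 : 0 <= 2 * y by rewrite mulr_ge0.
have /andP[h1 h2] := truncn_itv y20.
move: h1 h2; set z := Num.truncn (2 * y) => h1 h2.
apply: truncn_def; apply/andP; split.
  have : ((z %/ 2) * 2)%:R <= z%:R :> R by rewrite ler_nat leq_divM.
  by rewrite natrM => h; move: (le_trans h h1); rewrite mulrC ler_pM2l.
have : (z.+1)%:R <= ((z %/ 2).+1 * 2)%:R :> R.
  by rewrite ler_nat ltn_ceil.
by rewrite natrM => h; move: (lt_le_trans h2 h); rewrite [X in _ < X]mulrC ltr_pM2l.
Qed.

Lemma dcell_div m M x : (m <= M)%N -> dcell m x = (dcell M x %/ 2 ^ (M - m))%N.
Proof.
move=> mM; rewrite -{1}(subKn mM); elim: (M - m)%N (leq_subr m M) => [_|k IH kM].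
  by rewrite subn0 expn0 divn1.
rewrite expnSr divnMA -IH ?(ltnW kM)//.
by rewrite dcellS subnSK.
Qed.

Lemma dcell_dyad m j x : (j < 2 ^ m)%N -> dyad m j x <-> D x /\ dcell m x = j.
Proof.
move=> jm; have m0 : 0 < 2 ^+ m :> R by exact: exprn_gt0.
have jm' : (j.+1)%:R <= 2 ^+ m :> R by rewrite -natrX ler_nat.
have eqv : 0 <= x -> dyad m j x <-> dcell m x = j.
  move=> x0; rewrite /dyad /dcell /= max_l// ler_pdivrMr// ltr_pdivlMr// mulrC.
  have h := @truncn_eq _ (2 ^+ m * x) j (mulr_ge0 (ltW m0) x0).
  by rewrite -h; split => [/eqP|->].
split.
  move=> jx; have x0 : 0 <= x.
    by move: jx => /andP[+ _]; apply: le_trans; rewrite divr_ge0// ltW.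
  split; last exact/eqv.
  rewrite dyadE0 /= in_itv/= x0/=; move: jx => /andP[_ h]; apply: (lt_le_trans h).
  by rewrite ler_pdivrMr// mul1r.
by rewrite {1}dyadE0 /= in_itv/= => -[/andP[x0 _]] /(eqv x0).
Qed.

Lemma dcell_lt m x : D x -> (dcell m x < 2 ^ m)%N.
Proof.
rewrite dyadE0 /= in_itv/= => /andP[x0 x1]; rewrite -(@ltr_nat R).
have /andP[h _] := truncn_itv (arg_ge0 m x); apply: (le_lt_trans h).
by rewrite max_l// natrX gtr_pMr// exprn_gt0.
Qed.

Lemma dcell_nat m j : dcell m (j%:R / 2 ^+ m) = j.
Proof.
rewrite /dcell max_l; last by rewrite divr_ge0// exprn_ge0.
by rewrite mulrC divfK ?gt_eqF ?exprn_gt0// natrK.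
Qed.

Let mcell m (j : nat) : measurable (dcell m @^-1` [set j] : set RT).
Proof.
have -> : (dcell m @^-1` [set j]) = setT `&` (fun x : RT => 2 ^+ m * Num.max x 0) @^-1`
  `[j%:R, j.+1%:R[%classic.
  rewrite setTI; apply/seteqP; split => x /=; rewrite in_itv/= -truncn_eq ?arg_ge0//.
    by move=> /eqP.
  by move=> /eqP.
have mf : measurable_fun setT (fun x : RT => 2 ^+ m * Num.max x 0).
  by apply: measurable_funM => //; apply: measurable_maxr.
by apply: mf.
Qed.

Lemma dyadic_measurable m : dyadic_filtration m `<=` measurable.
Proof.
move=> _ [B ->].
rewrite (_ : dcell m @^-1` B = \bigcup_(j in B) (dcell m @^-1` [set j])).
  by apply: bigcup_measurable => j _; exact: mcell.
by apply/seteqP; split => x /=; [move=> Bx; exists (dcell m x)|move=> [j Bj /= ->]].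
Qed.

Lemma dyadic_filtrationP : filtration dyadic_filtration.
Proof.
move=> m; split; last 2 first.
- exact: dyadic_measurable.
- move=> _ [B ->]; exists [set j | B (j %/ 2)%N].
  by apply/seteqP; split => x /=; rewrite (dcellS m x).
split.
- by exists set0; rewrite preimage_set0.
- by move=> _ [B ->]; exists (~` B); rewrite setTD preimage_setC.
- move=> A HA; have /choice[B BE] n := HA n; exists (\bigcup_n B n).
  by rewrite preimage_bigcup; apply: eq_bigcupr => n _; rewrite BE.
Qed.

Lemma dyadic_G_comp m (g : nat -> \bar R) : G_measurable (dyadic_filtration m) (g \o dcell m).
Proof. by move=> B _; exists (g @^-1` B). Qed.

(** The preimage of the value [g x] is a union of cells containing that of [x], hence also its left
    end point, which serves as representative. *)
Lemma dyadic_G_const m (g : RT -> \bar R) : G_measurable (dyadic_filtration m) g ->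
  forall x, g x = g ((dcell m x)%:R / 2 ^+ m).
Proof.
move=> mg x; have [B BE] := mg [set g x] (emeasurable_set1 _).
have Bx : B (dcell m x).
  by have : (g @^-1` [set g x]) x by []; rewrite BE.
have : (dcell m @^-1` B) ((dcell m x)%:R / 2 ^+ m) by rewrite /= dcell_nat.
by rewrite -BE /= => ->.
Qed.

Let mD : measurable D. Proof. by rewrite dyadE0. Qed.

(** The uniform probability is defined on the closed interval and the cells are half-open; the end
    point 1 is dropped as a null set. *)
Lemma integral_mu0 (A : set RT) (h : RT -> \bar R) : measurable A ->
  measurable_fun setT h -> (forall x, (0 <= h x)%E) ->
  (\int[mu0]_(x in A) h x = \int[leb]_(x in A `&` D) h x)%E.
Proof.
move=> mA mh h0; rewrite integral_mkcond integral_uniform//; last 2 first.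
- exact/(measurable_restrictT _ mA)/measurable_funTS.
- by move=> x; rewrite patchE; case: ifP.
rewrite subr0 invr1 mul1e -integral_itv_bndo_bndc; last first.
  exact/measurable_funTS/(measurable_restrictT _ mA)/measurable_funTS.
by rewrite -dyadE0 setIC [RHS]integral_mkcondr.
Qed.

Let mdyad m j : measurable (dyad m j : set RT).
Proof.
have -> : dyad m j = `[j%:R / 2 ^+ m, j.+1%:R / 2 ^+ m[%classic :> set R.
  by apply/seteqP; split => x /=; rewrite in_itv.
exact: measurable_itv.
Qed.

Let leb_dyad m j : leb (dyad m j) = ((2 ^+ m)^-1)%:E.
Proof.
have -> : dyad m j = `[j%:R / 2 ^+ m, j.+1%:R / 2 ^+ m[%classic :> set R.
  by apply/seteqP; split => x /=; rewrite in_itv.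
rewrite lebesgue_measure_itv/= lte_fin ltr_pM2r ?invr_gt0 ?exprn_gt0// ltr_nat ltnSn.
by rewrite -EFinD -mulrBl -natrB// subSnn mul1r.
Qed.

(** The event is described at level [m] and the integral cut at the finer level [M];
    [j %/ 2 ^ (M - m)] is the ancestor of cell [j], as in [dsub]. *)
Lemma integral_cells m M (P : pred nat) (h : RT -> \bar R) : (m <= M)%N ->
  measurable_fun setT h -> (forall x, (0 <= h x)%E) ->
  (\int[mu0]_(x in dcell m @^-1` [set j | P j]) h x =
   \sum_(j < 2 ^ M | P (j %/ 2 ^ (M - m))%N) \int[leb]_(x in dyad M j) h x)%E.
Proof.
move=> mM mh h0.
have mA : measurable (dcell m @^-1` [set j | P j] : set RT).
  by apply: (@dyadic_measurable m); exists [set j | P j].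
rewrite integral_mu0//.
have mr (A : set RT) : measurable A -> measurable_fun D (h \_ A).
  by move=> mA'; exact/measurable_funTS/(measurable_restrictT _ mA')/measurable_funTS.
have r0 (A : set RT) x : (0 <= (h \_ A) x)%E by rewrite patchE; case: ifP.
rewrite setIC integral_mkcondr.
transitivity (\int[leb]_(x in D) \sum_(j < 2 ^ M | P (j %/ 2 ^ (M - m))%N) (h \_ (dyad M
  j)) x)%E.
  apply: eq_integral => x /[!inE] Dx.
  have cx := dcell_lt M Dx.
  pose j0 := Ordinal cx.
  have off (j : 'I_(2 ^ M)) : j != j0 -> (h \_ (dyad M j)) x = 0%E.
    move=> jj0; rewrite patchE memNset// => /(dcell_dyad _ (ltn_ord j)) [_ xj].
    by move/eqP: jj0; apply; apply/val_inj; rewrite /= xj.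
  have on : (h \_ (dyad M j0)) x = h x.
    by rewrite patchE mem_set//; apply/(dcell_dyad _ cx).
  rewrite patchE; case: ifPn => [/set_mem /= Px|Px].
    rewrite (bigD1 j0)/=; last by rewrite -dcell_div.
    by rewrite on big1 ?adde0// => j /andP[_]; exact: off.
  rewrite big1// => j Pj; apply: off; apply/eqP => jj0; move/negP: Px; apply.
  by apply: mem_set => /=; rewrite (dcell_div _ mM); rewrite jj0 in Pj.
under eq_integral do rewrite -big_filter.
rewrite ge0_integral_sum//; last by move=> j; exact: mr.
rewrite big_filter; apply: eq_bigr => j _.
rewrite -integral_mkcondr setIidr// => x /(dcell_dyad _ (ltn_ord j)) [].
exact.
Qed.

Lemma integral_cellsT M (h : RT -> \bar R) :
  measurable_fun setT h -> (forall x, (0 <= h x)%E) ->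
  (\int[mu0]_x h x = \sum_(j < 2 ^ M) \int[leb]_(x in dyad M j) h x)%E.
Proof.
move=> mh h0; rewrite -(@integral_cells M M xpredT)//.
by congr (integral _ _ _); apply/seteqP; split => x.
Qed.

Lemma integral_cell1 m M j (h : RT -> \bar R) : (m <= M)%N ->
  measurable_fun setT h -> (forall x, (0 <= h x)%E) ->
  (\int[mu0]_(x in dcell m @^-1` [set j]) h x =
   \sum_(j' < 2 ^ M | (j' %/ 2 ^ (M - m) == j)%N) \int[leb]_(x in dyad M j') h x)%E.
Proof.
move=> mM mh h0; rewrite -(@integral_cells m M (fun i => i == j))//.
by congr (integral _ _ _); apply/seteqP; split => x /= /eqP.
Qed.

Lemma integral_dyad_comp M j (g : nat -> \bar R) : (j < 2 ^ M)%N ->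
  (\int[leb]_(x in dyad M j) (g (dcell M x)) = g j * ((2 ^+ M)^-1)%:E)%E.
Proof.
move=> jM; rewrite -(leb_dyad M j) -integral_cst//; apply: eq_integral => x /[!inE].
by move=> /(dcell_dyad _ jM) [_ ->].
Qed.

Lemma measurable_dcell_comp M (g : nat -> \bar R) :
  measurable_fun setT ((fun x => g (dcell M x)) : RT -> \bar R).
Proof.
by apply: (@G_measurableW _ _ _ (dyadic_filtration M)); [exact: dyadic_measurable|exact:
  dyadic_G_comp].
Qed.

Lemma sum_double (V : zmodType) (G : nat -> V) N :
  \sum_(j < N * 2) G j = \sum_(j < N) (G (j * 2)%N + G (j * 2).+1).
Proof.
elim: N => [|N IH]; first by rewrite mul0n !big_ord0.
by rewrite mulSn add2n !big_ord_recr/= IH addrA.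
Qed.


(** The Rademacher sign of level [n.+1] has conditional expectation 0 at time [n], whatever [eps]
    is. *)
Lemma dyadic_inf_refining : inf_refining mu0 dyadic_filtration.
Proof.
move=> eps n E eps0 [B EB].
pose hn (j : nat) : R := if odd j then -1 else 1.
pose h : RT -> R := fun x => hn (dcell n.+1 x).
have hG : G_measurable (dyadic_filtration n.+1) (EFin \o h).
  exact: (@dyadic_G_comp n.+1 (EFin \o hn)).
have mh : measurable_fun setT (EFin \o h).
  exact: (measurable_dcell_comp n.+1 (EFin \o hn)).
have hi : mu0.-integrable setT (EFin \o h).
  apply/integrableP; split => //.
  under eq_integral do rewrite /= /h /hn (fun_if Num.norm) normrN1 normr1 if_same.
  by rewrite -[X in (X < _)%E]/(\int[mu0]_x (cst 1%E x))%E integral_cst_prob ltry.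
exists n.+1, h; split => //.
  move=> x; rewrite normrM [X in _ * X]ger0_norm//.
  by rewrite /h /hn (fun_if Num.norm) normrN1 normr1 if_same mul1r.
exists (cst 0); split.
- split; first exact: (@dyadic_G_comp n (cst 0%E)).
  move=> A [C AC]; rewrite [LHS]integral0.
  have mA : measurable A by apply: (@dyadic_measurable n); exists C.
  (* Adding 1 makes the sign non-negative, as the decomposition into cells requires; the constant is
     subtracted at the end. *)
  have m1 : measurable_fun setT (fun x : RT => ((h x)%:E + cst 1 x)%E).
    by apply: emeasurable_funD => //; exact: measurable_cst.
  have h1_0 x : (0 <= (h x)%:E + cst 1 x)%E.
    by rewrite /cst -EFinD lee_fin /h /hn; case: ifP => _; rewrite ?addNr ?addr_ge0.
  have AE : A = dcell n @^-1` [set j | j \in C].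
    by rewrite AC; apply/seteqP; split => x /=; rewrite inE.
  have H : (\int[mu0]_(x in A) ((h x)%:E + cst 1 x) = \int[mu0]_(x in A) (cst 1 x))%E.
    rewrite AE (@integral_cells n n.+1 (fun j => j \in C))//.
    rewrite (@integral_cells n n (fun j => j \in C))//.
    rewrite subnn expn0 subSnn expn1.
    rewrite (eq_bigr (fun j : 'I_(2 ^ n.+1) => ((hn j + 1) * (2 ^+ n.+1)^-1)%:E)); last first.
      move=> j _; rewrite (integral_dyad_comp (fun j => (hn j)%:E + 1)%E)//.
    rewrite [RHS](eq_bigr (fun j : 'I_(2 ^ n) => ((2 ^+ n)^-1)%:E)); last first.
      by move=> j _; rewrite [LHS](@integral_dyad_comp n j (cst 1%E))// mul1e.
    rewrite !sumEFin; congr EFin.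
    rewrite big_mkcond [RHS]big_mkcond/=.
    have -> : (2 ^ n.+1 = 2 ^ n * 2)%N by rewrite expnSr.
    rewrite (sum_double (fun j => if (j %/ 2)%N \in C then (hn j + 1) / 2 ^+ n.+1 else 0)).
    apply: eq_bigr => j _.
    have e1 : ((j * 2).+1 %/ 2 = j)%N by rewrite -addn1 divnMDl// addn0.
    rewrite mulnK// e1 divn1; case: ifP => _; last by rewrite addr0.
    rewrite /hn /= oddM andbF /= addNr mul0r addr0 exprS.
    by field; rewrite gt_eqF// exprn_gt0.
  have c1 : mu0.-integrable A (cst 1%E).
    by apply: (integrableS measurableT) => //; exact: finite_measure_integrable_cst.
  rewrite integralD// in H; last exact: (integrableS measurableT).
  have fin1 : (\int[mu0]_(x in A) (cst 1%E x))%E \is a fin_num.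
    exact: integrable_fin_num.
  have := congr1 (fun z => z - \int[mu0]_(x in A) (cst 1%E x))%E H.
  by rewrite addeK// subee.
- exact: finite_measure_integrable_cst.
- under eq_integral do rewrite normr0.
  by rewrite integral0 lee_fin ltW.
Qed.

Lemma dyadic_condexp m (g : nat -> \bar R) (h : RT -> \bar R) :
  (forall j, (0 <= g j)%E) -> measurable_fun setT h -> (forall x, (0 <= h x)%E) ->
  (forall j, (j < 2 ^ m)%N ->
    (g j * ((2 ^+ m)^-1)%:E = \int[leb]_(x in dyad m j) h x)%E) ->
  is_condexp mu0 (dyadic_filtration m) h (fun x => g (dcell m x)).
Proof.
move=> g0 mh h0 gh; split; first exact: dyadic_G_comp.
move=> A [C ->].
have -> : dcell m @^-1` C = dcell m @^-1` [set j | j \in C].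
  by apply/seteqP; split => x /=; rewrite inE.
rewrite !(@integral_cells m m (fun j => j \in C))//; last exact: measurable_dcell_comp.
by apply: eq_bigr => j _; rewrite integral_dyad_comp// gh.
Qed.

Lemma integral_mu0_T (h : RT -> \bar R) :
  measurable_fun setT h -> (forall x, (0 <= h x)%E) ->
  (\int[mu0]_x h x = \int[leb]_(x in D) h x)%E.
Proof. by move=> mh h0; rewrite integral_mu0// setTI. Qed.

(** * Dyadic families and adapted sequences *)

Lemma Bdyadic_le (p Fv fv : R) : 0 < p ->
  (Bdyadic p Fv fv 1 1 <= Bmart mu0 dyadic_filtration p Fv fv 1 1)%E.
Proof.
move=> p0; apply: ub_ereal_sup => _ [f0 [alpha [[mf0 f0_ge0 fF fE] al0 al1 alC ->]]].
pose f : RT -> R := f0 \_ D.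
have f_ge0 x : 0 <= f x.
  by rewrite /f patchE; case: ifP => // /set_mem; exact: f0_ge0.
have mf : measurable_fun setT f by exact/(measurable_restrictT _ mD).
have mfE : measurable_fun setT (EFin \o f) by exact/measurable_EFinP.
have fD x : x \in D -> f x = f0 x by move=> xD; rewrite /f patchE xD.
have int_f : (\int[mu0]_x (f x)%:E = fv%:E)%E.
  by rewrite integral_mu0_T// -fE; apply: eq_integral => x xD; rewrite fD.
have int_fp : (\int[mu0]_x (f x `^ p)%:E = Fv%:E)%E.
  rewrite integral_mu0_T//; last 2 first.
  - by apply/measurable_EFinP; exact: (measurableT_comp (measurable_powR p)).
  - by move=> x; rewrite lee_fin powR_ge0.
  by rewrite -fF; apply: eq_integral => x xD; rewrite fD.
have dyad_sub m j : (j < 2 ^ m)%N -> dyad m j `<=` D.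
  by move=> jm x /(dcell_dyad _ jm) [].
have int_dyad m j : (j < 2 ^ m)%N ->
    (\int[leb]_(x in dyad m j) (f x)%:E = \int[leb]_(x in dyad m j) (f0 x)%:E)%E.
  by move=> jm; apply: eq_integral => x /[!inE] /(dyad_sub m j jm) /mem_set xD; rewrite fD.
have fin_dyad m j : (j < 2 ^ m)%N ->
    (\int[leb]_(x in dyad m j) (f x)%:E)%E \is a fin_num.
  move=> jm; rewrite ge0_fin_numE; last by apply: integral_ge0 => x _; rewrite lee_fin.
  apply: (@le_lt_trans _ _ (\int[leb]_(x in D) (f x)%:E)%E).
    apply: ge0_subset_integral => //; last exact: dyad_sub.
      exact: measurable_funTS.
    by move=> x _; rewrite lee_fin.
  by rewrite -integral_mu0_T// int_f ltry.
(* Cells outside [[0, 1[] see values of [f0] that nothing controls; the default 0 keeps [fn m]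
   non-negative there. *)
pose avg m j : R := if (j < 2 ^ m)%N then fine (dyavg f0 m j) else 0.
have avgE m j : (j < 2 ^ m)%N -> dyavg f0 m j = (avg m j)%:E.
  move=> jm; rewrite /avg jm fineK// /dyavg -int_dyad// fin_numM//.
  exact: fin_dyad.
have avg0 m j : 0 <= avg m j.
  rewrite /avg; case: ifP => // jm; rewrite fine_ge0// /dyavg mule_ge0 ?lee_fin ?exprn_ge0//.
  by rewrite -int_dyad//; apply: integral_ge0 => x _; rewrite lee_fin.
pose fn m : RT -> R := fun x => avg m (dcell m x).
(* The weight of an interval is spread evenly over it, so [al m] integrates over cell [j] to
   [alpha m j]. *)
pose al m : RT -> R := fun x => 2 ^+ m * alpha m (dcell m x).
have al_ge0 m x : 0 <= al m x by rewrite mulr_ge0// exprn_ge0.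
have al_ge0E m x : (0 <= (al m x)%:E)%E by rewrite lee_fin.
have mal m : measurable_fun setT (fun x => (al m x)%:E).
  exact: (measurable_dcell_comp m (fun j => (2 ^+ m * alpha m j)%:E)).
have fi : mu0.-integrable setT (EFin \o f).
  apply/integrableP; split => //; under eq_integral do rewrite /= ger0_norm//.
  by rewrite int_f ltry.
have fnE : cond_exps mu0 dyadic_filtration f fn.
  move=> m.
  have ce : is_condexp mu0 (dyadic_filtration m) (EFin \o f) (EFin \o fn m).
    apply: (@dyadic_condexp m (EFin \o avg m)) => //.
    - by move=> j; rewrite lee_fin.
    - move=> j jm; rewrite /= -avgE// /dyavg muleAC -EFinM divff ?mul1e ?int_dyad//.
  split => //; have [fG fnf] := ce; apply/integrableP; split.
    exact: (measurable_dcell_comp m (EFin \o avg m)).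
  under eq_integral do rewrite /= ger0_norm ?avg0//.
  rewrite -[X in (X < _)%E]/(\int[mu0]_x (EFin \o fn m) x)%E fnf ?int_f ?ltry//.
  by exists setT; rewrite preimage_setT.
have int_al k m j : (m <= k)%N -> (\int[mu0]_(x in dcell m @^-1` [set j]) (al k x)%:E =
    \sum_(j' < 2 ^ k | (j' %/ 2 ^ (k - m) == j)%N) (alpha k j')%:E)%E.
  move=> mk; rewrite (@integral_cell1 m k)//; apply: eq_bigr => j' _.
  rewrite (integral_dyad_comp (fun j => (2 ^+ k * alpha k j)%:E))// -EFinM.
  by congr EFin; field; rewrite gt_eqF// exprn_gt0.
have int_ser n j : (j < 2 ^ n)%N ->
    (\int[leb]_(x in dyad n j) (\sum_(n <= k <oo) (al k x)%:E) = dsub alpha n j)%E.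
  move=> jn.
  have mser : measurable_fun setT (fun x => \sum_(n <= k <oo) (al k x)%:E)%E.
    by apply: measurable_nneseries_from.
  have ser0 x : (0 <= \sum_(n <= k <oo) (al k x)%:E)%E by apply: nneseries_ge0.
  transitivity (\int[mu0]_(x in dcell n @^-1` [set j]) (\sum_(n <= k <oo) (al k x)%:E))%E.
    rewrite (@integral_cell1 n n)// subnn expn0.
    rewrite (big_pred1 (Ordinal jn))// => j'; rewrite divn1.
    by apply/eqP/eqP => [j'j|->//]; exact: val_inj.
  rewrite ge0_integral_nneseries_from//.
  by congr (limn _); apply/funext => M; apply: eq_big_nat => k /andP[nk _]; exact: int_al.
apply: ereal_sup_ubound; exists f, fn, al; split => //.
- by split => // n; exact: (@dyadic_G_comp n (fun j => (2 ^+ n * alpha n j)%:E)).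
(* On a cell of [[0, 1[] the conditional expectation of the tail is the Carleson sum divided by the
   length, which turns one Carleson condition into the other. *)
- move=> n; pose g j : \bar R := if (j < 2 ^ n)%N then ((2 ^+ n)%:E * dsub alpha n j)%E
  else 0%E.
  have ds0 j : (0 <= dsub alpha n j)%E.
    by apply: nneseries_ge0 => k _ _; apply: sume_ge0 => j' _; rewrite lee_fin.
  have g0 j : (0 <= g j)%E.
    by rewrite /g; case: ifP => // _; rewrite mule_ge0// lee_fin exprn_ge0.
  exists (fun x => g (dcell n x)); split => //.
  + apply: dyadic_condexp => //.
    * by apply: measurable_nneseries_from.
    * by move=> x; apply: nneseries_ge0.
    * move=> j jn; rewrite /g jn int_ser// muleAC -EFinM divff ?mul1e//.
  + apply: aeW => x; rewrite /g; case: ifP => [jn|_]; last by rewrite lee_fin.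
    apply: (@le_trans _ _ ((2 ^+ n)%:E * (1 / 2 ^+ n)%:E)%E).
      by rewrite lee_wpmul2l ?lee_fin ?exprn_ge0// alC.
    by rewrite -EFinM mul1r divff// gt_eqF// exprn_gt0.
- rewrite integral_nneseries//.
  rewrite -al1; apply: eq_eseriesr => k _.
  rewrite (@integral_cellsT k)//; apply: eq_bigr => j _.
  rewrite (integral_dyad_comp (fun j => (2 ^+ k * alpha k j)%:E))// -EFinM.
  by congr EFin; field; rewrite gt_eqF// exprn_gt0.
- pose tm k j := (2 ^+ k * alpha k j * avg k j `^ p)%:E.
  have tm0 k j : (0 <= tm k j)%E by rewrite lee_fin !mulr_ge0 ?exprn_ge0 ?powR_ge0.
  rewrite integral_nneseries//; last 2 first.
  + by move=> k; exact: (measurable_dcell_comp k (tm k)).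
  + by move=> k x _; exact: (tm0 k (dcell k x)).
  apply: eq_eseriesr => k _.
  rewrite (@integral_cellsT k)//; last 2 first.
  + exact: (measurable_dcell_comp k (tm k)).
  + by move=> x; exact: (tm0 k (dcell k x)).
  apply: eq_bigr => j _; rewrite (integral_dyad_comp (tm k))// avgE// poweR_EFin -!EFinM.
  by congr EFin; field; rewrite gt_eqF// exprn_gt0.
Qed.

(** An adapted sequence is constant on cells, so its values at left end points define the family.
    Integration over a cell turns the almost everywhere Carleson condition into one for each dyadic
    interval. *)
Lemma Bmart_le_Bdyadic (p Fv fv : R) :
  (Bmart mu0 dyadic_filtration p Fv fv 1 1 <= Bdyadic p Fv fv 1 1)%E.
Proof.
apply: ub_ereal_sup => _ [f [fn [al [[mf f_ge0 fF fE fnE] [al_ge0 alG] alC al1 ->]]]].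
have mfE : measurable_fun setT (EFin \o f) by exact/measurable_EFinP.
have al_ge0E m x : (0 <= (al m x)%:E)%E by rewrite lee_fin.
have mal m : measurable_fun setT (fun x => (al m x)%:E).
  by apply: (G_measurableW (@dyadic_measurable m)); exact: alG.
pose pt m j : RT := j%:R / 2 ^+ m.
have alE m x : (al m x)%:E = (al m (pt m (dcell m x)))%:E.
  exact: (dyadic_G_const (alG m)).
have fnE' m x : (fn m x)%:E = (fn m (pt m (dcell m x)))%:E.
  by apply: (dyadic_G_const (g := EFin \o fn m)); have [[]] := fnE m.
pose alpha m j := (2 ^+ m)^-1 * al m (pt m j).
have alpha0 m j : 0 <= alpha m j by rewrite mulr_ge0// invr_ge0 exprn_ge0.
have int_dyad_al m j : (j < 2 ^ m)%N ->
    (\int[leb]_(x in dyad m j) (al m x)%:E = (alpha m j)%:E)%E.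
  move=> jm; under eq_integral do rewrite alE.
  by rewrite (integral_dyad_comp (fun j => (al m (pt m j))%:E))// -EFinM mulrC.
have avgE m j : (j < 2 ^ m)%N -> dyavg f m j = (fn m (pt m j))%:E.
  move=> jm; rewrite /dyavg.
  have Fj : dyadic_filtration m (dcell m @^-1` [set j]) by exists [set j].
  have mj := dyadic_measurable Fj.
  have cell_one h : measurable_fun setT h -> (forall x, (0 <= h x)%E) ->
      (\int[mu0]_(x in dcell m @^-1` [set j]) h x = \int[leb]_(x in dyad m j) h x)%E.
    move=> mh h0; rewrite (@integral_cell1 m m)// subnn expn0.
    rewrite (big_pred1 (Ordinal jm))// => j'; rewrite divn1.
    by apply/eqP/eqP => [j'j|->//]; exact: val_inj.
  rewrite -cell_one//.
  have [[_ fnf] _] := fnE m; rewrite -[X in (_ * X)%E]/(\int[mu0]_(x in _) (EFin \o f) x)%E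
    -fnf//.
  rewrite (@eq_integral _ _ _ mu0 _ (cst (fn m (pt m j))%:E)); last first.
    by move=> x /[!inE] /= xj; rewrite /= fnE' xj.
  rewrite integral_cst_fine//.
  have -> : fine (mu0 (dcell m @^-1` [set j])) = (2 ^+ m)^-1.
    have := cell_one (cst 1%E) (measurable_cst _) (fun=> lee01).
    by rewrite integral_cst_fine// mul1r [RHS](@integral_dyad_comp m j (cst 1%E))// mul1e
      => -[].
  by rewrite -EFinM; congr EFin; field; rewrite gt_eqF// exprn_gt0.
apply: ereal_sup_ubound; exists f, alpha; split => //.
- split => //.
  + exact: measurable_funTS.
  + rewrite -integral_mu0_T//.
    * by apply/measurable_EFinP; exact: (measurableT_comp (measurable_powR p)).
    * by move=> x; rewrite lee_fin powR_ge0.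
  + by rewrite -integral_mu0_T// => x; rewrite lee_fin.
- rewrite -al1 integral_nneseries//; apply: eq_eseriesr => k _.
  by rewrite (@integral_cellsT k)//; apply: eq_bigr => j _; rewrite int_dyad_al.
- move=> m j jm.
  have Fj : dyadic_filtration m (dcell m @^-1` [set j]) by exists [set j].
  have mj := dyadic_measurable Fj.
  have -> : dsub alpha m j = (\int[mu0]_(x in dcell m @^-1` [set j])
      (\sum_(m <= k <oo) (al k x)%:E))%E.
    rewrite ge0_integral_nneseries_from//.
    congr (limn _); apply/funext => M; apply: eq_big_nat => k /andP[mk _].
    by rewrite (@integral_cell1 m k)//; apply: eq_bigr => j' _; rewrite int_dyad_al.
  have [g [[gG gS] g0 g1]] := alC m; rewrite -gS//.
  have -> : (1 / 2 ^+ m)%:E = (\int[mu0]_(x in dcell m @^-1` [set j]) (cst 1%E x))%E.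
    rewrite (@integral_cell1 m m)// subnn expn0.
    rewrite (big_pred1 (Ordinal jm)) => [|j'].
      by rewrite [RHS](@integral_dyad_comp m j (cst 1%E))// mul1e mul1r.
    by rewrite divn1; apply/eqP/eqP => [j'j|->//]; exact: val_inj.
  apply: ae_ge0_le_integral => //.
  + by apply: measurable_funTS; apply: (G_measurableW (@dyadic_measurable m)).
  + by apply: filterS g1 => x gx _.
- pose tm k j := (al k (pt k j) * fn k (pt k j) `^ p)%:E.
  have tmE k x : (al k x * fn k x `^ p)%:E = tm k (dcell k x).
    by rewrite /tm; have [->] := alE k x; have [->] := fnE' k x.
  have tm0 k x : (0 <= (al k x * fn k x `^ p)%:E)%E by rewrite lee_fin mulr_ge0 ?powR_ge0.
  have mtm k : measurable_fun setT (fun x => (al k x * fn k x `^ p)%:E).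
    rewrite (_ : (fun x => _) = (fun x => tm k (dcell k x))); last exact/funext.
    exact: measurable_dcell_comp.
  rewrite integral_nneseries//; apply: eq_eseriesr => k _.
  rewrite (@integral_cellsT k)//; apply: eq_bigr => j _.
  under eq_integral do rewrite tmE.
  rewrite (integral_dyad_comp (tm k))// avgE// poweR_EFin -!EFinM; congr EFin.
  by rewrite /alpha; ring.
Qed.

End dyadic_filtration.

Lemma Btilde_Bdyadic (R : realType) (d : measure_display) (T : measurableType d)
  (mu : probability T R) (F : nat -> set (set T)) (p Fv fv : R) :
  1 < p -> filtration F -> inf_refining mu F -> 0 <= fv -> fv `^ p <= Fv ->
  Btilde mu F p Fv fv = Bdyadic p Fv fv 1 1.
Proof.
move=> p1 filF irF fv0 FvP; have p0 : 0 < p by exact: lt_trans p1.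
have filD := @dyadic_filtrationP R.
have irD := @dyadic_inf_refining R.
transitivity (Bmart (uniform_prob (@ltr01 R)) (@dyadic_filtration R) p Fv fv 1 1).
  rewrite -Btilde_Bmart//; apply/eqP; rewrite eq_le.
  by apply/andP; split; exact: Btilde_le.
apply/eqP; rewrite eq_le; apply/andP; split.
  exact: Bmart_le_Bdyadic.
exact: Bdyadic_le.
Qed.

Unset Implicit Arguments.

Theorem theoremB (R : realType) (d : measure_display) (T : measurableType d)
  (mu : probability T R) (F : nat -> set (set T)) (p : R) :
  1 < p -> filtration F ->
  forall Fv fv : R, 0 <= fv -> fv `^ p <= Fv ->
  (Btilde mu F p Fv fv <= Bmart mu F p Fv fv 1 1)%E /\
  (inf_refining mu F ->
     Btilde mu F p Fv fv = Bmart mu F p Fv fv 1 1 /\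
     Bmart mu F p Fv fv 1 1 = Bdyadic p Fv fv 1 1).
Proof.
move=> p1 filF Fv fv fv0 FvP; have p0 : 0 < p by exact: lt_trans p1.
rewrite -(Btilde_Bmart mu Fv fv p0 filF); split=> // irF; split=> //.
exact: Btilde_Bdyadic.
Qed.
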